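(* Let $X$ be a finite, simply connected, conformally nonpositively curved $2$-complex. Then $X$ is collapsible.
   Context: A (combinatorial) 2-complex $X$ is a cell complex constructed by gluing together cells of dimensions $0,1,2$ (called vertices, edges and faces, respectively) by maps which are homeomorphisms on interiors of cells. Each face is a polygon with some number $n$ of sides and $n$ corners, whose boundary is attached along an edge loop of $X$, each open side being mapped homeomorphically onto an open edge. A face may be adjacent to the same edge or vertex several times. All 2-complexes are assumed connected. A 2-complex is finite if it has finitely many cells. An angled 2-complex is a 2-complex in which each corner of each face is prescribed a positive real number (its angle), such that the angles of a face with $n$ corners sum up to $(n-2)\pi$. The link $Lk_X(v)$ of a vertex $v$ of $X$ is the multigraph whose vertices correspond to the edges of $X$ adjacent to $v$ (an edge both of whose ends are at $v$ contributes two vertices, one for each end), and in which two (possibly equal) vertices are joined by one edge for each corner at $v$ of a 2-cell which the corresponding two edge-ends define. In an angled 2-complex, each edge of $Lk_X(v)$ is given length equal to the angle of the corresponding corner. The length of a cycle in $Lk_X(v)$ is the sum of the lengths of its edges (loops and pairs of parallel edges count as cycles). A vertex $v$ satisfies the link condition if each cycle in $Lk_X(v)$ has length $\geq 2\pi$. An angled 2-complex is conformally nonpositively curved (has nonpositive planar sectional curvature) if all of its vertices satisfy the link condition. A free face of a 2-complex is a cell $c$ of dimension $n=0$ or $1$ such that $c$ is adjacent to one cell of dimension $n+1$ and to no other cells of dimension $\geq n+1$, and such that the attaching map of the adjacent $(n+1)$-cell is a homeomorphism on the preimage of the interior of $c$. An elementary collapse is the removal of the interiors of a free face of dimension $n$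 and of its adjacent $(n+1)$-cell. A collapse is a sequence of elementary collapses. A 2-complex is collapsible if it can be collapsed to a single point. *)

(* Defs.v *)
From Stdlib Require Import Relation_Operators.
From mathcomp Require Import all_boot all_order all_algebra.
From mathcomp Require Import reals trigo.

Set Implicit Arguments.
Unset Strict Implicit.
Unset Printing Implicit Defensive.

Import Order.TTheory GRing.Theory Num.Theory.
Local Open Scope ring_scope.

(* A finite combinatorial 2-complex. An edge [e] is a 1-cell with two ends
   [(e, false)] and [(e, true)], attached at the vertices [endpt e false] and
   [endpt e true] (possibly equal). A dart [(e, b)] is at the same time the end
   [b] of [e] and the edge [e] oriented so as to start at that end.
   A face [f] is a polygon with [sides f] sides, its boundary being attached
   along the closed edge path [bd f 0, bd f 1, ...]; [ordS] is the cyclic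
   successor. A face may run several times over the same edge or vertex. *)
Record complex2 := Complex2 {
  vert : finType;
  edge : finType;
  face : finType;
  endpt : edge -> bool -> vert;
  sides : face -> nat;
  sides_gt0 : forall f, (0 < sides f)%N;
  bd : forall f, 'I_(sides f) -> edge * bool;
  bd_closed : forall f (i : 'I_(sides f)),
    endpt (bd i).1 (~~ (bd i).2) = endpt (bd (ordS i)).1 (bd (ordS i)).2
}.

Section Complex.
Variable X : complex2.

Definition dart : Type := (edge X * bool)%type.

Definition dinv (d : dart) : dart := (d.1, ~~ d.2).
Definition src (d : dart) : vert X := endpt d.1 d.2.
Definition tgt (d : dart) : vert X := src (dinv d).

(** Edge paths and simple connectedness *)

Fixpoint is_path (x : vert X) (p : seq dart) (y : vert X) : bool :=
  if p is d :: p' then (src d == x) && is_path (tgt d) p' y else x == y.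

Definition bd_word (f : face X) : seq dart :=
  [seq bd i | i <- enum 'I_(sides f)].

(* Reading the boundary of a face from one fixed corner in one fixed direction
   is enough: its cyclic shifts and its inverse can then be inserted by
   combining [homot_face] with [homot_backtrack]. *)
Variant homot_step : seq dart -> seq dart -> Prop :=
| homot_backtrack p q d : homot_step (p ++ q) (p ++ d :: dinv d :: q)
| homot_face p q f : homot_step (p ++ q) (p ++ bd_word f ++ q).

Definition path_step (x y : vert X) (p q : seq dart) : Prop :=
  [/\ is_path x p y, is_path x q y & homot_step p q].

Definition homotopic (x y : vert X) : seq dart -> seq dart -> Prop :=
  clos_refl_sym_trans (seq dart) (path_step x y).

Definition connected2 : Prop :=
  (exists x : vert X, True) /\ (forall x y, exists p, is_path x p y).

(* Connected, with trivial edge-path group at every vertex. *)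
Definition simply_connected : Prop :=
  connected2 /\ (forall x p, is_path x p x -> homotopic x x p [::]).

(** Corners, links and angles *)

Definition corner : Type := {f : face X & 'I_(sides f)}.

(* [Corner i] lies between the side [i] and the next side [ordS i]. *)
Definition Corner (f : face X) (i : 'I_(sides f)) : corner :=
  Tagged (fun g => 'I_(sides g)) i.

Definition apex (c : corner) : vert X := tgt (bd (tagged c)).

(* The link of [v] has for vertices the darts [d] with [src d = v] and for
   edges the corners [c] with [apex c = v]. The edge [c] joins the two ends,
   at its apex, of the two sides meeting there. The pair [(c, b)] is the
   edge [c] of the link, traversed in the direction given by [b]. *)
Definition lk_end (c : corner) (b : bool) : dart :=
  if b then bd (ordS (tagged c)) else dinv (bd (tagged c)).

Definition lk_start (a : corner * bool) : dart := lk_end a.1 a.2.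
Definition lk_stop (a : corner * bool) : dart := lk_end a.1 (~~ a.2).

(* Graph-theoretic cycles, without repeated edges or vertices: a single loop
   and a pair of parallel edges are cycles. *)
Definition lk_cycle (v : vert X) (s : seq (corner * bool)) : bool :=
  [&& s != [::],
      all (fun a => apex a.1 == v) s,
      cycle (fun a a' => lk_stop a == lk_start a') s,
      uniq [seq a.1 | a <- s]
    & uniq [seq lk_start a | a <- s]].

Section Angles.
Variables (R : realType) (angle : corner -> R).

Definition is_angling : Prop :=
  (forall c, 0 < angle c) /\
  (forall f, \sum_(i < sides f) angle (Corner i) = ((sides f)%:R - 2) * pi).

Definition link_condition (v : vert X) : Prop :=
  forall s, lk_cycle v s -> 2 * pi <= \sum_(a <- s) angle a.1.

Definition conformally_nonpositively_curved : Prop :=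
  is_angling /\ (forall v, link_condition v).

End Angles.

(** Collapses *)

(* The cells remaining after some elementary collapses. *)
Record cells := Cells {
  cvert : {set vert X};
  cedge : {set edge X};
  cface : {set face X}
}.

Definition all_cells : cells := Cells setT setT setT.

(* The preimage in the boundary of the polygon [f] of the interior of [e]
   consists of as many open sides as there are [i] with [(bd i).1 = e]. *)
Definition free_edge (Y : cells) (e : edge X) (f : face X) : Prop :=
  [/\ e \in cedge Y, f \in cface Y,
      #|[set i : 'I_(sides f) | (bd i).1 == e]| = 1%N
    & forall (g : face X) (i : 'I_(sides g)),
        g \in cface Y -> (bd i).1 = e -> g = f].

Definition free_vertex (Y : cells) (v : vert X) (e : edge X) : Prop :=
  [/\ v \in cvert Y, e \in cedge Y,
      #|[set b | endpt e b == v]| = 1%N,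
      forall (e' : edge X) (b : bool),
        e' \in cedge Y -> endpt e' b = v -> e' = e
    & forall (g : face X) (i : 'I_(sides g)),
        g \in cface Y -> src (bd i) != v].

Variant elementary_collapse (Y : cells) : cells -> Prop :=
| collapse_edge e f : free_edge Y e f ->
    elementary_collapse Y (Cells (cvert Y) (cedge Y :\ e) (cface Y :\ f))
| collapse_vertex v e : free_vertex Y v e ->
    elementary_collapse Y (Cells (cvert Y :\ v) (cedge Y :\ e) (cface Y)).

Definition collapses : cells -> cells -> Prop :=
  clos_refl_trans cells elementary_collapse.

Definition collapsible : Prop :=
  exists x : vert X, collapses all_cells (Cells [set x] set0 set0).

End Complex.

(* Main.v *)
Require Import Defs.
From Stdlib Require Import Relation_Operators.
From HB Require Import structures.
From mathcomp Require Import all_boot all_order all_algebra all_fingroup.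
From mathcomp Require Import zify ring lra.
From mathcomp Require Import boolp reals trigo.

Set Implicit Arguments.
Unset Strict Implicit.
Unset Printing Implicit Defensive.

Import Order.TTheory GRing.Theory Num.Theory.

(* Suppose that the complex, or what is left of it after some collapses, has a
   face but no free edge. Cut its polygons into triangles along diagonals, chosen
   so that all angles stay positive; the links keep their lengths. Since every
   side lies on an edge with another side, one can walk forever from triangle to
   triangle, cutting off a corner of each and choosing at each step, left or
   right, the corner to be cut so that the total signed angle X of the corners
   met so far stays in ]0, pi[: the two candidates have angles of sum < pi. There
   are finitely many corners, so that some stretch of this gallery is closed. By
   simple connectivity it bounds a planar diagram, whose inner cells are closed
   walks in links (total angle at least 2 pi) and closed walks around triangles.
   For a minimal diagram, the Gauss-Bonnet formula would force X to vary by more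
   than pi along its boundary.
   So there is always a free edge as long as a face remains; collapsing it
   preserves simple connectivity. A simply connected graph has leaves, and
   collapses to a point. *)

(** * Euler characteristic of a pair of permutations *)

(** A diagram is never a drawing: it is a pair of permutations of a finite set of letters, and
    planarity is an inequality between numbers of cycles. Surgeries are products with
    transpositions, and the Jordan curve theorem is replaced by an upper bound on the Euler
    characteristic. The letters of a diagram are not edges of the complex but corners cut by a
    gallery. This makes two kinds of relators, closed walks in links and closed walks around
    triangles, and two kinds of inner cells. Simple connectivity enters only through values of paths
    in groups, and is tested on one group: words of corners modulo the syntactic congruence of the
    words that bound diagrams. The stretch of gallery that bounds a diagram closes up as a sequence
    of corners only: the real number X need not recur, so nothing is known of the angle at the
    closing node. The boundary has to contribute at least 2 pi; the closing node is charged pi, and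
    what remains is a variation inside ]0, pi[, strictly less than pi. The length pi of the interval
    also pays for every change of sign along the boundary. *)

Section EulerCalculus.
Variable T : finType.
Implicit Types (a b c s : {perm T}) (x y z : T) (e : rel T).
Import GroupScope.

Definition ncyc s := #|porbits s|.

Definition hlink a b : rel T :=
  fun x y => [|| a x == y, a y == x, b x == y | b y == x].

Definition nclasses e := n_comp e T.

Definition addedge e u v : rel T :=
  fun x y => [|| e x y, (x == u) && (y == v) | (x == v) && (y == u)].

Lemma connect_sym_sym e : symmetric e -> connect_sym e.
Proof.
move=> se x y; have H : subrel (connect e) (fun x y => connect e y x).
  move=> u v /connectP [p]; elim: p u => [|w p IH] u /=; first by move=> _ ->.
  move=> /andP [euw pw] lv; apply: connect_trans (IH _ pw lv) _.
  by apply: connect1; rewrite se.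
by apply/idP/idP; apply: H.
Qed.

Lemma hlink_sym a b : symmetric (hlink a b).
Proof. by move=> x y; rewrite /hlink; do !case: eqP. Qed.

Lemma addedge_sym e u v : symmetric e -> symmetric (addedge e u v).
Proof. by move=> se x y; rewrite /addedge se orbCA orbC -orbA [in RHS]orbC -orbA; do !case: eqP => ? //=; rewrite ?orbT ?orbF. Qed.

Lemma nclassesE e : symmetric e ->
  nclasses e = #|[set [set y | connect e x y] | x : T]|.
Proof.
move=> se; have ce := connect_sym_sym se.
rewrite /nclasses /n_comp_mem.
have -> : #|[set [set y | connect e x y] | x : T]| =
          #|[set [set y | connect e x y] | x in roots e]|.
  apply: eq_card => A; apply/imsetP/imsetP => -[x _ ->].
    exists (fingraph.root e x); first exact: roots_root.
    by apply/setP => y; rewrite !inE (same_connect ce (connect_root e x)).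
  by exists x.
rewrite card_in_imset; first by apply: eq_card => x; rewrite !inE andbT.
move=> x y rx ry /setP /(_ y); rewrite !inE connect0 => cxy.
by rewrite -(eqP rx) -(eqP ry); apply/eqP; rewrite root_connect.
Qed.

Lemma eq_nclasses e e' : symmetric e -> symmetric e' ->
  connect e =2 connect e' -> nclasses e = nclasses e'.
Proof.
move=> se se' ee'; rewrite !nclassesE //; congr #|pred_of_set _|.
by apply: eq_imset => x; apply/setP => y; rewrite !inE ee'.
Qed.

Lemma connect_addedge e u v x y : symmetric e ->
  connect (addedge e u v) x y =
    [|| connect e x y, connect e x u && connect e v y
      | connect e x v && connect e u y].
Proof.
move=> se; have ce := connect_sym_sym se.
have sub : subrel (connect e) (connect (addedge e u v)).
  by apply: connect_sub => w z ewz; apply: connect1; rewrite /addedge ewz.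
apply/idP/idP; last first.
  case/or3P => [/sub //||] /andP [/sub h1 /sub h2];
    apply: connect_trans h1 (connect_trans _ h2); apply: connect1;
    by rewrite /addedge !eqxx ?orbT.
move=> /connectP [p]; elim: p x => [|w p IH] x /=; first by move=> _ ->; rewrite connect0.
case/andP => exw pw ly; have := IH _ pw ly.
case/or3P: exw => [exw|/andP [/eqP -> /eqP ->]|/andP [/eqP -> /eqP ->]].
- have cxw : connect e x w by apply: connect1.
  by rewrite !(same_connect ce cxw).
- by rewrite !connect0 /=; case/or3P => [->|/andP [_ ->]|->]; rewrite ?orbT.
- by rewrite !connect0 /=; case/or3P => [->|->|/andP [_ ->]]; rewrite ?orbT.
Qed.

Lemma nclasses_addedge e u v : symmetric e ->
  nclasses e = nclasses (addedge e u v) + ~~ connect e u v.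
Proof.
move=> se; have ce := connect_sym_sym se.
have sa := addedge_sym u v se; have ca := connect_sym_sym sa.
case: (boolP (connect e u v)) => cuv /=.
  rewrite addn0; apply: eq_nclasses => // x y.
  rewrite connect_addedge //; apply/idP/idP => [->//|].
  case/or3P => // /andP [h1 h2]; apply: connect_trans h1 (connect_trans _ h2) => //.
  by rewrite ce.
rewrite !nclassesE //.
pose cl x := [set y | connect e x y].
have clE x y : (cl x == cl y) = connect e x y.
  apply/eqP/idP => [/setP /(_ y)|cxy]; first by rewrite !inE connect0.
  by apply/setP => z; rewrite !inE (same_connect ce cxy).
pose f (A : {set T}) := if (A == cl u) || (A == cl v) then cl u :|: cl v else A.
have fcl x : f (cl x) = [set y | connect (addedge e u v) x y].
  apply/setP => y; rewrite /f !clE inE connect_addedge // (ce x u) (ce x v).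
  case: (boolP (connect e u x)) => cux; rewrite ?inE /=.
    have -> : connect e v x = false.
      by apply/negP => cvx; case/negP: cuv; rewrite (same_connect ce cux) ce.
    by rewrite (ce x y) -(same_connect_r ce cux) (ce y u) orbF.
  case: (boolP (connect e v x)) => cvx; rewrite ?inE /= ?orbF //.
  by rewrite (ce x y) -(same_connect_r ce cvx) (ce y v) orbC.
pose S := [set cl x | x : T].
have -> : [set [set y | connect (addedge e u v) x y] | x : T] = f @: (S :\ cl v).
  apply/setP => A; apply/imsetP/imsetP => [[x _ ->]|[B]].
    case: (boolP (connect e x v)) => cxv.
      exists (cl u); first by rewrite !inE clE cuv /S imset_f.
      have cxu : connect (addedge e u v) x u.
        by rewrite connect_addedge // cxv connect0 !orbT.
      by rewrite fcl; apply/setP => y; rewrite !inE (same_connect ca cxu).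
    exists (cl x); last by rewrite fcl.
    by rewrite !inE clE cxv imset_f.
  rewrite !inE => /andP [_ /imsetP [x _ ->]] ->; exists x => //; exact: fcl.
rewrite card_in_imset.
  by rewrite (cardsD1 (cl v) S) imset_f // addnC.
move=> A B; rewrite !inE => /andP [Av /imsetP [x _ Ax]] /andP [Bv /imsetP [y _ By]].
rewrite /f (negbTE Av) (negbTE Bv) !orbF.
case: eqP => [->|/eqP Au]; case: eqP => [->//|/eqP Bu] //.
- move=> /setP /(_ y); rewrite By !inE connect0.
  move: Bu Bv; rewrite By !clE (ce y u) (ce y v) => /negbTE -> /negbTE ->. by [].
- move=> /setP /(_ x); rewrite Ax !inE connect0.
  by move: Au Av; rewrite Ax !clE (ce x u) (ce x v) => /negbTE -> /negbTE ->.
Qed.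

(* The pair [(a, b)] is a hypermap with cells the cycles of [a], of [b] and of
   [a * b]; its Euler characteristic is [chi a b - #|T|], which is at most twice
   the number of components. *)
Definition chi a b := ncyc a + ncyc b + ncyc (a * b).
Definition ncomps a b := nclasses (hlink a b).

Lemma ncyc_tperm_split s x y : x != y -> y \in porbit s x ->
  ncyc (tperm x y * s) = (ncyc s).+1.
Proof.
move=> xy yx; have := porbits_mul_tperm s x y; rewrite /= xy porbit_sym yx /=.
by rewrite addn0 addn1.
Qed.

Lemma ncyc_tperm_merge s x y : x != y -> y \notin porbit s x ->
  ncyc s = (ncyc (tperm x y * s)).+1.
Proof.
move=> xy yx; have := porbits_mul_tperm s x y; rewrite /= xy porbit_sym yx /=.
by rewrite /ncyc addn2 addn1 => -[].
Qed.

Lemma hlink_porbitl a b x y : y \in porbit a x -> connect (hlink a b) x y.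
Proof.
move=> /porbitP [i ->]; elim: i => [|i IH]; first by rewrite expg0 perm1.
by apply: connect_trans IH (connect1 _); rewrite /hlink expgSr permM eqxx.
Qed.

Lemma hlink_porbitM a b x y : y \in porbit (a * b) x -> connect (hlink a b) x y.
Proof.
move=> /porbitP [i ->]; elim: i => [|i IH]; first by rewrite expg0 perm1.
apply: connect_trans IH _; rewrite expgSr !permM.
by apply: (connect_trans (y := a (((a * b) ^+ i) x))); apply: connect1; rewrite /hlink eqxx ?orbT.
Qed.

(** Once [x] and [y] are joined, multiplying by their transposition no longer affects components.
    The numbers of components before and after a surgery are thus compared through one common
    graph. *)
Lemma connect_hlink_tperm a b x y :
  connect (addedge (hlink a b) x y) =2
  connect (addedge (hlink (tperm x y * a) b) x y).
Proof.
have H a' : subrel (connect (addedge (hlink (tperm x y * a') b) x y))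
                   (connect (addedge (hlink a' b) x y)).
  have sa := connect_sym_sym (addedge_sym x y (@hlink_sym a' b)).
  have K w : connect (addedge (hlink a' b) x y) w ((tperm x y * a') w).
    rewrite permM; case: tpermP => [->|->|_ _]; last first.
    - by apply: connect1; rewrite /addedge /hlink eqxx.
    - apply: (connect_trans (y := x)); apply: connect1; rewrite /addedge /hlink !eqxx ?orbT //.
    - apply: (connect_trans (y := y)); apply: connect1; rewrite /addedge /hlink !eqxx ?orbT //.
  apply: connect_sub => w z /or3P [|h|h]; last 2 first.
  - by apply: connect1; rewrite /addedge h orbT.
  - by apply: connect1; rewrite /addedge h !orbT.
  case/or4P => [/eqP <-|/eqP <-|h|h] //; first by rewrite sa.
  - by apply: connect1; rewrite /addedge /hlink h !orbT.
  - by apply: connect1; rewrite /addedge /hlink h !orbT.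
move=> w z; apply/idP/idP; last exact: H.
by move=> h; apply: H; rewrite mulgA tperm2 mul1g.
Qed.

Lemma ncomps_tperm a b x y :
  ncomps a b + ~~ connect (hlink (tperm x y * a) b) x y =
  ncomps (tperm x y * a) b + ~~ connect (hlink a b) x y.
Proof.
rewrite /ncomps (nclasses_addedge x y (@hlink_sym a b)).
rewrite (nclasses_addedge x y (@hlink_sym (tperm x y * a) b)).
have -> : nclasses (addedge (hlink a b) x y) =
          nclasses (addedge (hlink (tperm x y * a) b) x y).
  apply: eq_nclasses; try exact/addedge_sym/hlink_sym.
  exact: connect_hlink_tperm.
by rewrite addnAC.
Qed.

(* Multiplying by a transposition changes each of two cycle counts by one; at
   least one of them grows unless two components get joined. *)
Lemma chi_tperm a b x y : x != y ->
  [|| y \in porbit a x, y \in porbit (a * b) x | ~~ connect (hlink a b) x y] ->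
  chi a b + 2 * ncomps (tperm x y * a) b <= chi (tperm x y * a) b + 2 * ncomps a b.
Proof.
move=> xy H; have E := ncomps_tperm a b x y; rewrite /chi.
have -> : tperm x y * a * b = tperm x y * (a * b) by rewrite mulgA.
have KL : y \in porbit a x -> connect (hlink a b) x y by exact: hlink_porbitl.
have KM : y \in porbit (a * b) x -> connect (hlink a b) x y by exact: hlink_porbitM.
have KL' : y \in porbit (tperm x y * a) x -> connect (hlink (tperm x y * a) b) x y.
  exact: hlink_porbitl.
have KM' : y \in porbit (tperm x y * (a * b)) x -> connect (hlink (tperm x y * a) b) x y.
  by rewrite mulgA; exact: hlink_porbitM.
have D s : y \notin porbit s x -> y \in porbit (tperm x y * s) x.
  move=> ys; apply: contraT => ys'.
  have e1 := ncyc_tperm_merge xy ys; have := ncyc_tperm_merge xy ys'.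
  by rewrite mulgA tperm2 mul1g; lia.
case: (boolP (y \in porbit a x)) H => [ha _|ha].
  rewrite (ncyc_tperm_split xy ha); rewrite (KL ha) /= addn0 in E.
  case: (boolP (y \in porbit (a * b) x)) => hm.
    by move: E; rewrite (ncyc_tperm_split xy hm); case: connect => /=; lia.
  by move: E; rewrite (KM' (D _ hm)) /=; have := ncyc_tperm_merge xy hm; lia.
have e1 := ncyc_tperm_merge xy ha; rewrite (KL' (D _ ha)) /= addn0 in E.
case: (boolP (y \in porbit (a * b) x)) => [hm _|hm] /=.
  by move: E; rewrite (ncyc_tperm_split xy hm) (KM hm) /=; lia.
by move=> nc; move: E; rewrite nc; have := ncyc_tperm_merge xy hm; lia.
Qed.

Lemma ncyc_conj s u : ncyc (s ^ u) = ncyc s.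
Proof.
rewrite /ncyc; have -> : porbits (s ^ u) = (fun A : {set T} => u @: A) @: porbits s.
  have E x : porbit (s ^ u) (u x) = u @: porbit s x.
    apply/setP => z; apply/porbitP/imsetP => [[i ->]|[w /porbitP [i ->] ->]].
      by exists ((s ^+ i) x); [exact: mem_porbit | rewrite -conjXg permJ].
    by exists i; rewrite -conjXg permJ.
  apply/setP => A; apply/imsetP/imsetP => [[x _ ->]|[B /imsetP [x _ ->] ->]].
    by exists (porbit s (u^-1 x)); [exact: imset_f | rewrite -E permKV].
  by exists (u x) => //; rewrite E.
by rewrite card_imset //; apply: imset_inj; apply: perm_inj.
Qed.

Lemma ncycV s : ncyc s^-1 = ncyc s.
Proof. by rewrite /ncyc -(porbitsV s). Qed.

Lemma ncycC a b : ncyc (a * b) = ncyc (b * a).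
Proof. by rewrite -(ncyc_conj (a * b) a) conjgE !mulgA mulVg mul1g. Qed.

(** The triple [a], [b], [(a * b)^-1] has product 1, and a cyclic shift of it describes the same
    surface. A surgery may therefore be done on whichever pair makes it simplest. *)
Lemma chi_rot a b : chi b (a * b)^-1 = chi a b.
Proof.
have E : b * (a * b)^-1 = a^-1 by rewrite invMg mulgA mulgV mul1g.
by rewrite /chi E !ncycV; lia.
Qed.

Lemma chiC a b : chi b a = chi a b.
Proof. by rewrite /chi ncycC; lia. Qed.

Lemma ncompsC a b : ncomps b a = ncomps a b.
Proof.
apply: eq_nclasses; try exact: hlink_sym.
by apply: eq_connect => x y; rewrite /hlink; do !case: (_ == _).
Qed.

Lemma ncomps_rot a b : ncomps b (a * b)^-1 = ncomps a b.
Proof.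
apply: eq_nclasses; try exact: hlink_sym.
have S1 := connect_sym_sym (@hlink_sym a b).
have S2 := connect_sym_sym (@hlink_sym b (a * b)^-1).
move=> x y; apply/idP/idP; apply: connect_sub => {x y} w z /or4P [] /eqP E.
- by apply: connect1; rewrite /hlink E eqxx !orbT.
- by apply: connect1; rewrite /hlink E eqxx !orbT.
- have -> : w = b (a z) by rewrite -E -permM permKV.
  by rewrite S1; apply: (connect_trans (y := a z)); apply: connect1; rewrite /hlink eqxx ?orbT.
- have -> : z = b (a w) by rewrite -E -permM permKV.
  by apply: (connect_trans (y := a w)); apply: connect1; rewrite /hlink eqxx ?orbT.
- rewrite -{}E; apply: (connect_trans (y := b (a w))); apply: connect1; rewrite /hlink ?eqxx ?orbT //.
  by rewrite -permM permK eqxx ?orbT.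
- rewrite -{}E S2; apply: (connect_trans (y := b (a z))); apply: connect1; rewrite /hlink ?eqxx ?orbT //.
  by rewrite -permM permK eqxx ?orbT.
- by apply: connect1; rewrite /hlink E eqxx ?orbT.
- by apply: connect1; rewrite /hlink E eqxx ?orbT.
Qed.

(** Genus 0 in every component: [chi_le] is the opposite inequality. As an inequality, it is
    preserved by any surgery that does not lower the Euler characteristic. *)
Definition planar a b := #|T| + 2 * ncomps a b <= chi a b.

Lemma planarC a b : planar b a = planar a b.
Proof. by rewrite /planar chiC ncompsC. Qed.

Lemma planar_rot a b : planar b (a * b)^-1 = planar a b.
Proof. by rewrite /planar chi_rot ncomps_rot. Qed.

Lemma planar_tperm a b x y : x != y ->
  [|| y \in porbit a x, y \in porbit (a * b) x | ~~ connect (hlink a b) x y] ->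
  planar a b -> planar (tperm x y * a) b.
Proof. by move=> xy H; have := chi_tperm xy H; rewrite /planar; lia. Qed.

Definition skip z s := tperm (s^-1 z) z * s.

Lemma skip_id z s : skip z s z = z.
Proof. by rewrite permM tpermR permKV. Qed.

Lemma skipE z s u : u != z -> skip z s u = if s u == z then s z else s u.
Proof.
move=> uz; rewrite permM; case: tpermP => [->|E|h _]; rewrite ?permKV ?eqxx //.
  by rewrite E eqxx in uz.
by case: eqP => // E; case: h; rewrite -E permK.
Qed.

Lemma skipV z s : (skip z s)^-1 = skip z s^-1.
Proof.
apply/permP => u; apply: (@perm_inj _ (skip z s)); rewrite permKV.
case: (u =P z) => [->|/eqP uz]; first by rewrite !skip_id.
rewrite [skip z s^-1 u]skipE //; case: eqP => E.
  have Es : s z = u by rewrite -E permKV.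
  have E2 : s^-1 z != z by apply: contraNneq uz => E2; rewrite -Es -{1}E2 permKV.
  by rewrite skipE // permKV eqxx Es.
by rewrite skipE ?permKV ?(negbTE uz) //; apply/eqP.
Qed.

(** The points [s^-1 z] and [z] lie on one cycle of [s], so skipping [z], first in one permutation
    and then in the other, is twice a transposition of the kind that [chi_tperm] admits. *)
Lemma chi_skip a b z :
  chi a b + 2 * ncomps (skip z a) (skip z b) <=
  chi (skip z a) (skip z b) + 2 * ncomps a b.
Proof.
have H s s' : chi s s' + 2 * ncomps (skip z s) s' <= chi (skip z s) s' + 2 * ncomps s s'.
  rewrite /skip; case: (s^-1 z =P z) => [->|/eqP E].
    by rewrite tperm1 mul1g.
  apply: chi_tperm => //; apply/orP; left; apply/porbitP; exists 1%N.
  by rewrite expg1 permKV.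
have := H b (skip z a); rewrite !(chiC (skip z a)) !(ncompsC (skip z a)).
by have := H a b; lia.
Qed.

Lemma planar_skip a b z : planar a b -> planar (skip z a) (skip z b).
Proof. by have := chi_skip a b z; rewrite /planar; lia. Qed.

Lemma ncyc1 : ncyc 1 = #|T|.
Proof.
rewrite /ncyc /porbits card_imset // => x y /setP /(_ y).
rewrite porbit_id => /porbitP [i]; by rewrite expg1n perm1.
Qed.

Lemma ncomps1 : ncomps 1 1 = #|T|.
Proof.
rewrite /ncomps nclassesE; last exact: hlink_sym.
rewrite card_imset // => x y /setP /(_ y); rewrite !inE connect0.
case/connectP => p; elim: p x => [|w p IH] x //=.
by rewrite {1}/hlink !perm1 => /andP [/or4P [] /eqP -> pw lw]; apply: IH.
Qed.

(** The points outside [K] that still move are skipped one at a time. On [K] nothing changes, since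
    no point of a stable set is mapped to a skipped point. *)
Lemma chi_restrict (K : {set T}) a b :
    {in K, forall x, a x \in K} -> {in K, forall x, b x \in K} ->
  exists a' b', [/\ {in K, forall x, a' x = a x /\ b' x = b x},
    forall x, x \notin K -> a' x = x /\ b' x = x
    & chi a b + 2 * ncomps a' b' <= chi a' b' + 2 * ncomps a b].
Proof.
pose D a b := [set x | (x \notin K) && ((a x != x) || (b x != x))].
have [n] := ubnP #|D a b|; elim: n a b => // n IH a b Dn Ka Kb.
case: (set_0Vmem (D a b)) => [D0|[z zD]].
  exists a, b; split=> // x xK; move/setP/(_ x): D0; rewrite !inE xK /=.
  by move/negbT; rewrite negb_or !negbK => /andP [/eqP -> /eqP ->].
have zK : z \notin K by move: zD; rewrite inE => /andP [].
have nz x : x \in K -> (x == z) = false by apply: contraTF => /eqP ->.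
have sK s x : {in K, forall x, s x \in K} -> x \in K -> skip z s x = s x.
  by move=> Ks xK; rewrite skipE ?nz ?Ks.
have sD s x : s x = x -> skip z s x = x.
  move=> sx; case: (x =P z) => [->|/eqP xz]; first by rewrite skip_id.
  by rewrite skipE // sx (negbTE xz).
case: (IH (skip z a) (skip z b)).
- apply: leq_trans (_ : #|D a b| <= n); last by rewrite -ltnS.
  apply: proper_card; apply/properP; split; last first.
    by exists z => //; rewrite !inE !skip_id eqxx andbF.
  apply/subsetP => x; rewrite !inE => /andP [-> /=].
  by apply: contraLR; rewrite !negb_or !negbK => /andP [/eqP /sD -> /eqP /sD ->]; rewrite eqxx.
- by move=> x xK; rewrite sK ?Ka.
- by move=> x xK; rewrite sK ?Kb.
move=> a' [b' [h1 h2 h3]]; exists a', b'; split => //.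
  by move=> x xK; have [-> ->] := h1 x xK; rewrite !sK.
by have := chi_skip a b z; lia.
Qed.

(** Restriction to the empty set leaves two identities, for which equality holds: every point is a
    component and a cycle of each of the three permutations. *)
Lemma chi_le a b : chi a b <= #|T| + 2 * ncomps a b.
Proof.
have [||a' [b' [_ h]]] := @chi_restrict set0 a b; try by move=> x; rewrite inE.
have -> : a' = 1 by apply/permP => x; have [->] := h x (negbT (in_set0 x)); rewrite perm1.
have -> : b' = 1 by apply/permP => x; have [_ ->] := h x (negbT (in_set0 x)); rewrite perm1.
rewrite /chi /ncomps mulg1 ncyc1; rewrite -[nclasses _]/(ncomps 1 1) ncomps1; lia.
Qed.

Lemma planar_restrict (K : {set T}) a b :
    {in K, forall x, a x \in K} -> {in K, forall x, b x \in K} -> planar a b ->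
  exists a' b', [/\ {in K, forall x, a' x = a x /\ b' x = b x},
    forall x, x \notin K -> a' x = x /\ b' x = x & planar a' b'].
Proof.
move=> Ka Kb pl; have [a' [b' [h1 h2 h3]]] := chi_restrict Ka Kb.
by exists a', b'; split=> //; move: pl h3; rewrite /planar; lia.
Qed.

(* A transposition joining two points of a common cycle of [a] and of a common
   cycle of [a * b] would increase the Euler characteristic by 2, so in the
   planar case it disconnects. *)
Lemma planar_split a b x y : x != y -> y \in porbit a x -> y \in porbit (a * b) x ->
  planar a b ->
  planar (tperm x y * a) b /\ ~~ connect (hlink (tperm x y * a) b) x y.
Proof.
move=> xy ya yab pl; split; first by apply: planar_tperm pl; rewrite ?ya.
apply/negP => cn; have := ncomps_tperm a b x y; rewrite cn (hlink_porbitl _ ya) /= => E.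
have := chi_le (tperm x y * a) b; move: pl; rewrite /planar /chi.
have -> : tperm x y * a * b = tperm x y * (a * b) by rewrite mulgA.
by rewrite !ncyc_tperm_split //; lia.
Qed.

End EulerCalculus.

(** * Cycles as sequences *)

Lemma eq_in_fpath (T : eqType) (f g : T -> T) x p :
  {in belast x p, f =1 g} -> fpath f x p = fpath g x p.
Proof.
elim: p x => //= y p IH x fg; rewrite fg ?inE ?eqxx // IH // => u up.
by apply: fg; rewrite inE up orbT.
Qed.

Lemma fcycle_mem (T : eqType) (f : T -> T) s x : fcycle f s -> x \in s -> f x \in s.
Proof. by move=> fs xs; rewrite (eqP (next_cycle fs xs)) mem_next. Qed.

Lemma porbit_step (T : finType) (s : {perm T}) x : porbit s (s x) = porbit s x.
Proof. exact: (porbit_perm s 1 x). Qed.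

Lemma fpath_porbit (T : finType) (s : {perm T}) x (p : seq T) :
  fpath s x p -> last x p \in porbit s x.
Proof.
elim: p x => [|y p IH] x /=; first by rewrite porbit_id.
by case/andP => /eqP <- /IH; rewrite porbit_step.
Qed.

Lemma fcycle_porbit (T : finType) (s : {perm T}) (c : seq T) x y :
  fcycle s c -> x \in c -> y \in c -> y \in porbit s x.
Proof.
move=> sc xc yc; case: (rot_to xc) => i c' E.
have: fcycle s (x :: c') by rewrite -E rot_cycle.
have: y \in x :: c' by rewrite -E mem_rot.
rewrite /= => yc'; case: (splitPl yc') => p1 p2 <-.
by rewrite rcons_cat cat_path => /andP [/fpath_porbit].
Qed.

(** Exchanging the images of the last elements of two complementary arcs closes each arc into a
    cycle of its own. *)
Lemma fcycle_cut (T : finType) (s : {perm T}) y B y' C :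
    uniq (y :: B ++ y' :: C) -> fcycle s (y :: B ++ y' :: C) ->
    let q := last y' C in let q' := last y B in let s' := (tperm q q' * s)%g in
  [/\ q != q', s q' = y' /\ s q = y, fcycle s' (y :: B), fcycle s' (y' :: C)
    & forall u, u != q -> u != q' -> s' u = s u].
Proof.
move=> uq cyc q q' s'.
have [pB [Eq' [pC Eq]]] : fpath s y B /\ (s q' = y' /\ (fpath s y' C /\ s q = y)).
  move: cyc; rewrite /= rcons_cat cat_path => /andP [->] /=.
  by rewrite rcons_path => /and3P [/eqP -> -> /eqP ->].
have qB : q' \in y :: B by apply: mem_last.
have qC : q \in y' :: C by apply: mem_last.
have disj u : u \in y :: B -> u \in y' :: C -> False.
  move: uq; rewrite -cat_cons cat_uniq => /and3P [_ /hasPn h _] h1 /h.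
  by rewrite h1.
have qq : q != q' by apply/eqP => E; apply: (disj q') => //; rewrite -E.
have e1q : s' q = y' by rewrite permM tpermL Eq'.
have e1q' : s' q' = y by rewrite permM tpermR Eq.
have e1u u : u != q -> u != q' -> s' u = s u.
  by move=> uq1 uq2; rewrite permM tpermD // eq_sym.
split=> //.
- rewrite /= rcons_path -/q' /= e1q' eqxx andbT; rewrite (eq_in_fpath (g := s)) // => u uB.
  have uB' : u \in y :: B by apply: mem_belast uB.
  rewrite e1u //; first by apply/eqP => E; apply: (disj u) => //; rewrite E.
  apply: contraTneq uB => -> .
  move: uq; rewrite -cat_cons cat_uniq => /and3P [h _ _].
  by move: h; rewrite lastI -/q' rcons_uniq => /andP [].
- rewrite /= rcons_path -/q /= e1q eqxx andbT; rewrite (eq_in_fpath (g := s)) // => u uB.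
  have uB' : u \in y' :: C by apply: mem_belast uB.
  rewrite e1u //; last by apply/eqP => E; apply: (disj u) => //; rewrite E.
  apply: contraTneq uB => -> .
  move: uq; rewrite -cat_cons cat_uniq => /and3P [_ _ h].
  by move: h; rewrite lastI -/q rcons_uniq => /andP [].
Qed.

(** * Planar diagrams *)

Section Diagrams.
Variables (L : eqType) (linv : L -> L) (meets : bool -> rel L).
Hypothesis linvK : involutive linv.
Hypothesis linv_neq : forall a, linv a != a.
Hypothesis meets_refl : forall k a, meets k a a.
Hypothesis meets_sym : forall k a b, meets k a b -> meets k b a.
Hypothesis meets_trans : forall k a b c, meets k a b -> meets k b c -> meets k a c.

(* Planar diagrams with one outer cell. The cycles of [eta] are the cells and
   the involution [eps] pairs the two letters of an edge; a letter fixed by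
   [eps] is dead (not part of the diagram). The cycle [os] is the outer cell
   and reads the word [w]; the other cells have one of two kinds. *)
Record diagram (T : finType) (eps eta : {perm T}) (lab : T -> L) (kd : T -> bool)
    (os : seq T) (w : seq L) : Prop := Diagram {
  dg_planar : planar eps eta;
  dg_inv : forall x, eps (eps x) = x;
  dg_dead : forall x, eps x = x -> eta x = x;
  dg_lab : forall x, eps x != x -> lab (eps x) = linv (lab x);
  dg_cell : forall x, eps x != x -> x \notin os ->
    meets (kd x) (lab (eta x)) (linv (lab x)) /\ kd (eta x) = kd x;
  dg_uniq : uniq os;
  dg_os : fcycle eta os;
  dg_live : {in os, forall x, eps x != x};
  dg_word : map lab os = w }.

Definition live (T : finType) (eps : {perm T}) := #|[set x | eps x != x]|.

(** A word that an inner cell of kind [k] may read: each letter starts where the previous one,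
    reversed, starts. *)
Definition relator k (r : seq L) := path.cycle (fun a b => meets k b (linv a)) r.

Section DiagramFacts.
Variables (T : finType) (eps eta : {perm T}) (lab : T -> L) (kd : T -> bool).
Variables (os : seq T) (w : seq L).
Hypothesis D : diagram eps eta lab kd os w.

Lemma dg_liveE x : eps x != x -> eps (eps x) != eps x.
Proof. by rewrite (dg_inv D) eq_sym. Qed.

Lemma dg_eta_live x : eps x != x -> eps (eta x) != eta x.
Proof.
move=> lx; apply: contra_neq lx => e.
by have /perm_inj E := dg_dead D e; rewrite E in e.
Qed.

End DiagramFacts.

(** Erasing an edge merges the two cells along it. The letter [x] is skipped in [eps] and in the
    node permutation; [eps x] has then lost its partner and is skipped in [eps] and in the new
    [eta]. The nested conditionals give the successor when a cell passes from one erased letter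
    directly to the other. *)
Lemma delete_edge_perm (T : finType) (eps eta : {perm T}) x :
    planar eps eta -> (forall u, eps (eps u) = u) -> eps x != x ->
    eta (eps x) != x ->
  exists eps' eta' : {perm T}, [/\ planar eps' eta',
    [/\ eps' x = x, eps' (eps x) = eps x, eta' x = x & eta' (eps x) = eps x],
    forall u, u != x -> u != eps x -> eps' u = eps u
    & forall u, u != x -> u != eps x -> eta' u =
        let c := if eta u == x then eta (eps x) else eta u in
        if c == eps x then if eta x == x then eta (eps x) else eta x else c].
Proof.
set y := eps x => pl epsK xy yx; set th := (eps * eta)%g.
have thE u : th u = eta (eps u) by rewrite permM.
have epsV u : (eps^-1)%g u = eps u by rewrite -{1}(epsK u) permK.
have yE : eps y = x by rewrite epsK.
pose eps1 := skip x eps; pose t1 := skip x th^-1%g.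
pose eta1 := ((t1 * eps1)^-1)%g.
have pl1 : planar eps1 eta1.
  rewrite planar_rot; apply: planar_skip.
  have -> : eps = ((eta * th^-1)^-1)%g by rewrite invMg invgK /th -mulgA mulgV mulg1.
  by rewrite planar_rot /th planar_rot.
have e1x : eps1 x = x by rewrite skip_id.
have e1y : eps1 y = y by rewrite skipE // yE eqxx.
have e1u u : u != x -> u != y -> eps1 u = eps u.
  move=> ux uy; rewrite skipE //; case: eqP => // E.
  by rewrite -(epsK u) E -/y eqxx in uy.
have h1E u v : eta1 u = v <-> u = eps1 (t1 v).
  by rewrite /eta1 -permM; split => [<-|->]; rewrite ?permKV ?permK.
have t1E v : t1^-1%g v = skip x th v by rewrite /t1 skipV invgK.
have h1 u v : skip x th u = v -> t1 v = u by move=> <-; rewrite -t1E permKV.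
have h1x : eta1 x = x by apply/h1E; rewrite (h1 x) ?skip_id.
have h1y : eta1 y = if eta x == x then eta y else eta x.
  by apply/h1E; rewrite (h1 y) ?e1y // skipE // !thE yE.
have h1u u : u != x -> u != y -> eta1 u = if eta u == x then eta y else eta u.
  move=> ux uy; have nx : eps u != x by rewrite -(inj_eq (@perm_inj _ eps)) epsK.
  have ny : eps u != y by rewrite (inj_eq (@perm_inj _ _)).
  by apply/h1E; rewrite (h1 (eps u)) ?e1u ?epsK // skipE // !thE epsK.
exists (skip y eps1), (skip y eta1); split.
- exact: planar_skip.
- have xy' : x != y by rewrite eq_sym.
  by split; rewrite ?skip_id // skipE // ?e1x ?h1x (negbTE xy').
- move=> u ux uy; rewrite skipE // e1u //; case: eqP => // /perm_inj E.
  by rewrite E eqxx in ux.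
- by move=> u ux uy /=; rewrite skipE // h1u // h1y.
Qed.

(* Two consecutive letters [x], [eta x] of a cell are removed, and their
   partners are paired. *)
Lemma fold_perm (T : finType) (eps eta : {perm T}) x :
    planar eps eta -> (forall u, eps (eps u) = u) -> eps x != x ->
    eps (eta x) != eta x -> eta x != x ->
  exists eps' eta' : {perm T}, [/\ planar eps' eta',
    [/\ eps' x = x, eps' (eta x) = eta x, eta' x = x & eta' (eta x) = eta x],
    forall u, u != x -> u != eta x -> eps' u =
        if eps u == x then eps (eta x) else if eps u == eta x then eps x else eps u
    & forall u, u != x -> u != eta x -> eta' u =
        if eta u == x then eta (eta x) else eta u].
Proof.
set z := eta x => pl epsK xl zl zx; set th := (eps * eta)%g.
have thE u : th u = eta (eps u) by rewrite permM.
have [Exz|Exz] := eqVneq (eps x) z.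
  have Ezx : eps z = x by rewrite -Exz epsK.
  exists (skip z (skip x eps)), (skip z (skip x eta)); split.
  - exact/planar_skip/planar_skip.
  - have xz : x != z by rewrite eq_sym.
    by split; rewrite ?skip_id // skipE // skip_id (negbTE xz).
  - move=> u ux uz; have e : eps u != x by rewrite -Ezx (inj_eq (@perm_inj _ _)).
    have e' : eps u != z by rewrite -Exz (inj_eq (@perm_inj _ _)).
    by rewrite skipE // skipE // (negbTE e) (negbTE e').
  - move=> u ux uz; rewrite skipE // skipE //.
    have e' : eta u != z by rewrite (inj_eq (@perm_inj _ _)).
    case: (eta u =P x) => [E|_]; last by rewrite (negbTE e').
    by rewrite -/z eqxx skipE //; case: eqP => // E2; rewrite -E2 in E; move/perm_inj: E uz => ->; rewrite eqxx.
pose eta1 := skip z eta; pose b1 := skip z th^-1%g.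
pose eps1 := ((eta1 * b1)^-1)%g.
have pl1 : planar eps1 eta1.
  have -> : eta1 = ((b1 * eps1)^-1)%g by rewrite invMg /eps1 invgK -mulgA mulgV mulg1.
  by rewrite planar_rot /eps1 planar_rot; apply: planar_skip; rewrite planar_rot.
have b1E v : b1^-1%g v = skip z th v by rewrite /b1 skipV invgK.
have e1E u v : eta1 v = skip z th u -> eps1 u = v.
  by move=> E; rewrite /eps1; apply: (@perm_inj _ (eta1 * b1)%g); rewrite permKV permM E -b1E permKV.
have h1x : eta1 x = eta z by rewrite skipE 1?eq_sym // eqxx.
have h1u u : u != x -> u != z -> eta1 u = eta u.
  by move=> ux uz; rewrite skipE // /z (inj_eq (@perm_inj _ _)) (negbTE ux).
have xz : x != z by rewrite eq_sym.
have e1z : eps1 z = z by apply: e1E; rewrite !skip_id.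
have nz u : u != x -> eta u != z by move=> ux; rewrite /z (inj_eq (@perm_inj _ _)).
have e1x : eps1 x = eps x.
  by apply: e1E; rewrite skipE // thE h1u // (negbTE (nz _ _)).
have e1y : eps1 (eps x) = eps z.
  have h : eps z != x by apply: contra_neq Exz => <-; rewrite epsK.
  by apply: e1E; rewrite skipE // !thE epsK -/z eqxx h1u.
have e1w : eps1 (eps z) = x.
  by apply: e1E; rewrite skipE // !thE epsK h1x (negbTE (nz _ zx)).
have e1u u : u != z -> eps u != x -> eps u != z -> eps1 u = eps u.
  by move=> uz ux ux'; apply: e1E; rewrite skipE // thE h1u // (negbTE (nz _ _)).
exists (skip x eps1), (skip x eta1); split.
- exact: planar_skip.
- by split; rewrite ?skip_id // skipE // ?e1z /eta1 ?skip_id (negbTE zx).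
- move=> u ux uz; rewrite skipE //.
  case: (eps u =P x) => [E|/eqP E].
    have -> : u = eps x by rewrite -E epsK.
    rewrite e1y; case: eqP => // E2; rewrite e1x.
    by move: Exz; rewrite -E2 epsK eqxx.
  case: (eps u =P z) => [E2|/eqP E2].
    by have -> : u = eps z; [rewrite -E2 epsK | rewrite e1w eqxx e1x].
  by rewrite e1u // (negbTE E).
- by move=> u ux uz; rewrite skipE // h1u // h1x.
Qed.

Lemma live_ltn (T : finType) (eps eps' : {perm T}) x :
  (forall u, eps u = u -> eps' u = u) -> eps x != x -> eps' x = x ->
  live eps' < live eps.
Proof.
move=> H lx dx; apply: proper_card; apply/properP; split.
  by apply/subsetP => u; rewrite !inE; apply: contra_neq => /H.
by exists x; rewrite !inE ?lx // dx eqxx.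
Qed.

(** The union of two cells of one kind is again a cell of that kind: at both ends of the erased edge
    the conditions compose by transitivity of [meets]. Hence kinds alternate in a diagram with
    fewest live letters. *)
Lemma delete_edge (T : finType) (eps eta : {perm T}) lab kd os w x :
    diagram eps eta lab kd os w -> eps x != x -> x \notin os -> eps x \notin os ->
    kd (eps x) = kd x -> eta (eps x) != x ->
  exists eps' eta' : {perm T}, diagram eps' eta' lab kd os w /\ live eps' < live eps.
Proof.
move=> D lx xo yo kxy bk.
have [eps' [eta' [pl [ex ey hx hy] eu hu]]] :=
  delete_edge_perm (dg_planar D) (dg_inv D) lx bk.
move: yo kxy bk ey hy eu hu; set y := eps x => yo kxy bk ey hy eu hu.
have ly : eps y != y by exact: (dg_liveE D lx).
have labx : lab x = linv (lab y) by rewrite (dg_lab D lx) linvK.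
have laby : lab y = linv (lab x) by rewrite (dg_lab D lx).
have ouE u : u \in os -> eta' u = eta u.
  move=> uo; have o z : z \notin os -> (u == z = false) * (eta u == z = false).
    move=> zo; split; first by apply: contraNF zo => /eqP <-.
    by apply: contraNF zo => /eqP <-; apply: fcycle_mem uo; apply: (dg_os D).
  by rewrite hu ?o //= !o.
have deadu u : eps u = u -> (u != x) * (u != y).
  by move=> e; split; [apply: contra_neq lx | apply: contra_neq ly] => <-.
exists eps', eta'; split; last first.
  by apply: (live_ltn (x := x)) => // u e; rewrite eu ?deadu.
split; rewrite ?(dg_uniq D) ?(dg_word D) //.
- move=> u; case: (u =P x) => [->|/eqP ux]; first by rewrite !ex.
  case: (u =P y) => [->|/eqP uy]; first by rewrite !ey.
  rewrite !eu ?(dg_inv D) //; last by rewrite /y (inj_eq (@perm_inj _ _)).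
  by rewrite -(inj_eq (@perm_inj _ eps)) (dg_inv D).
- move=> u; case: (u =P x) => [->|/eqP ux]; first by rewrite hx.
  case: (u =P y) => [->|/eqP uy]; first by rewrite hy.
  by rewrite eu // => /(dg_dead D) e; rewrite hu //= e (negbTE ux) (negbTE uy).
- move=> u; case: (u =P x) => [->|/eqP ux]; first by rewrite ex eqxx.
  case: (u =P y) => [->|/eqP uy]; first by rewrite ey eqxx.
  by rewrite eu //; apply: (dg_lab D).
- move=> u; case: (u =P x) => [->|/eqP ux]; first by rewrite ex eqxx.
  case: (u =P y) => [->|/eqP uy]; first by rewrite ey eqxx.
  rewrite eu // => lu uo; rewrite hu //=.
  have [mu ku] := dg_cell D lu uo; have [mx kx] := dg_cell D lx xo.
  have [my ky] := dg_cell D ly yo.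
  set c := if eta u == x then eta y else eta u.
  have [mc kc] : meets (kd u) (lab c) (linv (lab u)) /\ kd c = kd u.
    rewrite /c; case: eqP => // E; rewrite -ku E ky kxy; split => //.
    rewrite E -labx kxy in mu my *; apply: meets_trans my _.
    by rewrite -ku E in mu.
  case: eqP => // E; rewrite E in mc kc.
  have [mx' kx'] : meets (kd u) (lab (eta x)) (linv (lab u)) /\ kd (eta x) = kd u.
    rewrite kx -kxy kc; split => //; rewrite -kxy kc -laby in mx.
    exact: meets_trans mx mc.
  case: eqP => // E2; rewrite E2 in mx' kx'.
  rewrite ky kc -labx in my *; split => //.
  exact: meets_trans my mx'.
- have := dg_os D; case: (os) ouE => //= z s ouE; apply: etrans; apply: eq_in_fpath => u.
  by rewrite belast_rcons => /ouE.
- move=> u uo; have nx : u != x by apply: contraNneq xo => <-.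
  have ny : u != y by apply: contraNneq yo => <-.
  by rewrite eu ?(dg_live D).
Qed.

(** The partners of two consecutive inverse letters carry inverse labels, so they can be paired with
    each other while the two letters die. Hence inner cells of a diagram with fewest live letters
    read reduced words. *)
Lemma fold_cell (T : finType) (eps eta : {perm T}) lab kd os w x :
    diagram eps eta lab kd os w -> eps x != x -> x \notin os ->
    lab (eta x) = linv (lab x) ->
  exists eps' eta' : {perm T}, diagram eps' eta' lab kd os w /\ live eps' < live eps.
Proof.
move=> D lx xo lz.
have zx : eta x != x by apply: contra_neq (linv_neq (lab x)) => E; rewrite -lz E.
have zl : eps (eta x) != eta x by exact: (dg_eta_live D lx).
have zo : eta x \notin os.
  apply: contra xo => zo.
  have [y yo E] : exists2 y, y \in os & eta y = eta x.
    exists (prev os (eta x)); first by rewrite mem_prev.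
    exact/eqP/(prev_cycle (dg_os D)).
  by rewrite -(perm_inj E).
have [eps' [eta' [pl [ex ez hx hz] eu hu]]] :=
  fold_perm (dg_planar D) (dg_inv D) lx zl zx.
move: lz zx zl zo ez hz eu hu; set z := eta x => lz zx zl zo ez hz eu hu.
have ouE u : u \in os -> eta' u = eta u.
  move=> uo; have o v : v \notin os -> (u == v = false) * (eta u == v = false).
    move=> vo; split; first by apply: contraNF vo => /eqP <-.
    by apply: contraNF vo => /eqP <-; apply: fcycle_mem uo; apply: (dg_os D).
  by rewrite hu ?o //= !o.
have deadu u : eps u = u -> (u != x) * (u != z).
  by move=> e; split; [apply: contra_neq lx | apply: contra_neq zl] => <-.
have epsx u : (eps u == x) = (u == eps x).
  by rewrite -(inj_eq (@perm_inj _ eps)) (dg_inv D).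
have epsz u : (eps u == z) = (u == eps z).
  by rewrite -(inj_eq (@perm_inj _ eps)) (dg_inv D).
exists eps', eta'; split; last first.
  apply: (live_ltn (x := x)) => // u e; have [ux uz] := deadu u e.
  by rewrite eu // e (negbTE ux) (negbTE uz).
split; rewrite ?(dg_uniq D) ?(dg_word D) //.
- move=> u; case: (u =P x) => [->|/eqP ux]; first by rewrite !ex.
  case: (u =P z) => [->|/eqP uz]; first by rewrite !ez.
  rewrite (eu u) // !epsx !epsz; case: (u =P eps x) => [E|/eqP E].
    have nE : eps z != x by rewrite epsx; apply: contra_neq uz => ->; rewrite E.
    by rewrite eu // !(dg_inv D) ?eqxx ?(negbTE zx) // -E.
  case: (u =P eps z) => [E2|/eqP E2].
    have nE : eps x != z by rewrite epsz; apply: contra_neq ux => ->; rewrite E2.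
    by rewrite eu // !(dg_inv D) ?eqxx // -E2.
  have n1 : eps u != x by rewrite epsx.
  have n2 : eps u != z by rewrite epsz.
  by rewrite eu // !(dg_inv D) (negbTE ux) (negbTE uz).
- move=> u; case: (u =P x) => [->|/eqP ux]; first by rewrite hx.
  case: (u =P z) => [->|/eqP uz]; first by rewrite hz.
  rewrite eu //; case: (eps u =P x) => [E|_].
    have -> : u = eps x by rewrite -E (dg_inv D).
    by move/perm_inj=> E2; rewrite E2 eqxx in zx.
  case: (eps u =P z) => [E|_].
    have -> : u = eps z by rewrite -E (dg_inv D).
    by move/perm_inj=> E2; rewrite E2 eqxx in zx.
  by move=> /(dg_dead D) e; rewrite hu // e (negbTE ux).
- have labe u : eps u != u -> lab u = linv (lab (eps u)).
    by move=> lu; rewrite (dg_lab D lu) linvK.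
  move=> u; case: (u =P x) => [->|/eqP ux]; first by rewrite ex eqxx.
  case: (u =P z) => [->|/eqP uz]; first by rewrite ez eqxx.
  rewrite eu //; case: (eps u =P x) => [E|_].
    have -> : u = eps x by rewrite -E (dg_inv D).
    by rewrite (dg_lab D zl) (dg_lab D lx) lz linvK.
  case: (eps u =P z) => [E|_].
    have -> : u = eps z by rewrite -E (dg_inv D).
    by rewrite (dg_lab D zl) (dg_lab D lx) lz linvK.
  exact: (dg_lab D).
- move=> u; case: (u =P x) => [->|/eqP ux]; first by rewrite ex eqxx.
  case: (u =P z) => [->|/eqP uz]; first by rewrite ez eqxx.
  rewrite hu // => lu' uo; have lu : eps u != u.
    by apply: contra_neq lu' => e; rewrite eu // e (negbTE ux) (negbTE uz).
  have [mu ku] := dg_cell D lu uo; case: eqP => // E.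
  have [mz kz] := dg_cell D zl zo; have [mx kx] := dg_cell D lx xo.
  rewrite E in mu ku; have kzu : kd z = kd u by rewrite -ku -kx.
  rewrite kz kzu; split=> //; rewrite lz linvK kzu in mz.
  exact: meets_trans mz mu.
- have := dg_os D; case: (os) ouE => //= v s ouE; apply: etrans; apply: eq_in_fpath => u.
  by rewrite belast_rcons => /ouE.
- move=> u uo; have nx : u != x by apply: contraNneq xo => <-.
  have nz : u != z by apply: contraNneq zo => <-.
  rewrite eu //; case: (eps u =P x) => [E|_].
    have -> : u = eps x by rewrite -E (dg_inv D).
    by rewrite (inj_eq (@perm_inj _ _)).
  case: (eps u =P z) => [E|_].
    have -> : u = eps z by rewrite -E (dg_inv D).
    by rewrite (inj_eq (@perm_inj _ _)) eq_sym.
  exact: (dg_live D).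
Qed.

(** The outer cell passes twice through a node. Cutting this node in two cuts the outer cell in two
    and, by [planar_split], disconnects the two parts, as the Jordan curve theorem would. The
    component of [y] is a diagram for the arc that starts at [y]. *)
Lemma split_outer (T : finType) (eps eta : {perm T}) lab kd A y B y' C w :
    diagram eps eta lab kd (A ++ y :: B ++ y' :: C) w ->
    y' \in porbit (eps * eta)%g y ->
  exists eps' eta' : {perm T},
    diagram eps' eta' lab kd (y :: B) (map lab (y :: B)).
Proof.
move=> D yy'; set os := A ++ _ in D.
have cyc : fcycle eta (y :: (B ++ y' :: (C ++ A))).
  have := dg_os D; rewrite /os -(rot_cycle (size A)) rot_size_cat.
  by rewrite cat_cons -catA cat_cons.
have mos u : (u \in os) = (u \in y :: B) || (u \in y' :: (C ++ A)).
  rewrite /os !(inE, mem_cat); do !case: (_ == _); do !case: (_ \in _); done.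
have uq : uniq (y :: (B ++ y' :: (C ++ A))).
  have := dg_uniq D; rewrite /os -(rot_uniq (size A)) rot_size_cat.
  by rewrite cat_cons -catA cat_cons.
have := fcycle_cut uq cyc.
set q' := last y B; set q := last y' (C ++ A) => -[qq [Eq' Eq] cycB cycC e1u].
have qB : q' \in y :: B by apply: mem_last.
have qC : q \in y' :: (C ++ A) by apply: mem_last.
have disj u : u \in y :: B -> u \in y' :: (C ++ A) -> False.
  move: uq; rewrite -cat_cons cat_uniq => /and3P [_ /hasPn h _] h1 /h.
  by rewrite h1.
have [pl nc] : planar (tperm q q' * eta)%g eps /\
    ~~ connect (hlink (tperm q q' * eta)%g eps) q q'.
  apply: planar_split => //; last by rewrite planarC (dg_planar D).
    by apply: (fcycle_porbit (dg_os D)); rewrite mos ?qB ?qC ?orbT.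
  (* The permutation [eta] conjugates [eta * eps] to [eps * eta], and maps [q], [q'] to [y],
     [y']. *)
  have := yy'; rewrite -Eq -Eq' => /porbitP [i E]; apply/porbitP; exists i.
  apply: (@perm_inj _ eta); rewrite E {E}; elim: i => [|i IH]; first by rewrite !perm1.
  by rewrite !expgSr !permM IH.
set eta1 := (tperm q q' * eta)%g in pl nc cycB cycC e1u.
have cs := connect_sym_sym (@hlink_sym _ eta1 eps).
pose K := [set u | connect (hlink eta1 eps) y u].
have BK u : u \in y :: B -> u \in K.
  move=> h; rewrite inE; apply: hlink_porbitl; apply: fcycle_porbit cycB _ h.
  by rewrite inE eqxx.
have CK u : u \in y' :: (C ++ A) -> u \notin K.
  move=> h; rewrite inE; apply: contra nc => cu.
  rewrite cs; apply: (connect_trans (y := y)).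
    by move: (BK _ qB); rewrite inE cs.
  apply: connect_trans cu _; apply: hlink_porbitl.
  exact: fcycle_porbit cycC h qC.
have [||eta' [eps' [hK hN pl']]] := planar_restrict (K := K) _ _ pl.
- move=> u; rewrite !inE => cu; apply: connect_trans cu (connect1 _).
  by rewrite /hlink eqxx.
- move=> u; rewrite !inE => cu; apply: connect_trans cu (connect1 _).
  by rewrite /hlink eqxx !orbT.
have epsK u : u \in K -> eps u \in K.
  rewrite !inE => cu; apply: connect_trans cu (connect1 _).
  by rewrite /hlink eqxx !orbT.
have osK u : u \in K -> u \notin y :: B -> u \notin os.
  by move=> uK uB; rewrite mos (negbTE uB) /=; apply: contraL uK; apply: CK.
exists eps', eta'; split.
- by rewrite planarC.
- move=> u; case: (boolP (u \in K)) => uK; last by rewrite !(hN _ uK).2.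
  by rewrite (hK _ uK).2 (hK _ (epsK _ uK)).2 (dg_inv D).
- move=> u; case: (boolP (u \in K)) => uK; last by rewrite (hN _ uK).1.
  rewrite (hK _ uK).2 (hK _ uK).1 => e; rewrite e1u ?(dg_dead D) //.
    by apply: contraTneq uK => ->; apply: CK.
  apply: contra_eq_neq e => ->; apply: (dg_live D); by rewrite mos qB.
- move=> u; case: (boolP (u \in K)) => uK; last by rewrite (hN _ uK).2 eqxx.
  by rewrite (hK _ uK).2; apply: (dg_lab D).
- move=> u; case: (boolP (u \in K)) => uK; last by rewrite (hN _ uK).2 eqxx.
  rewrite (hK _ uK).2 (hK _ uK).1 => lu uB.
  have uo := osK _ uK uB; rewrite e1u; first exact: (dg_cell D).
    by apply: contraNneq uo => ->; rewrite mos qC orbT.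
  by apply: contraNneq uo => ->; rewrite mos qB.
- by move: uq; rewrite -cat_cons cat_uniq => /and3P [].
- rewrite /= (eq_in_fpath (g := eta1)); first exact: cycB.
  by move=> u; rewrite belast_rcons => /BK /hK [].
- by move=> u uB; rewrite (hK _ (BK _ uB)).2; apply: (dg_live D); rewrite mos uB.
- by [].
Qed.

(** A relator read along the outer cell is closed up, by one transposition in [eta], into a new
    inner cell of kind [k]; the pairing of letters stays the same. *)
Lemma cut_cell (T : finType) (eps eta : {perm T}) lab kd y' C y B D w k :
    diagram eps eta lab kd (y' :: C ++ y :: B ++ D) w ->
    relator k (map lab (y :: B)) ->
  exists (eta' : {perm T}) kd',
    diagram eps eta' lab kd' (y' :: C ++ D) (map lab (y' :: C ++ D)).
Proof.
move=> Dg rU; set os := y' :: _ in Dg.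
have [r [R ER]] : exists r R, D ++ y' :: C = r :: R.
  by case: D {Dg os} => [|r D]; [exists y', C | exists r, (D ++ y' :: C)].
have osE : rot (size (y' :: C)) os = y :: B ++ r :: R.
  by rewrite /os -cat_cons rot_size_cat cat_cons -catA ER.
have cyc : fcycle eta (y :: B ++ r :: R) by rewrite -osE rot_cycle (dg_os Dg).
have uq : uniq (y :: B ++ r :: R) by rewrite -osE rot_uniq (dg_uniq Dg).
have mos u : (u \in os) = (u \in y :: B) || (u \in r :: R).
  by rewrite -(mem_rot (size (y' :: C))) osE -cat_cons mem_cat.
have := fcycle_cut uq cyc.
set q' := last y B; set q := last r R => -[qq _ cycB cycC e1u].
set eta1 := (tperm q q' * eta)%g in cycB cycC e1u.
have qB : q' \in y :: B by apply: mem_last.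
have qC : q \in r :: R by apply: mem_last.
have disj u : u \in y :: B -> u \notin r :: R.
  move: uq; rewrite -cat_cons cat_uniq => /and3P [_ /hasPn h _] h1.
  by apply/negP => /h; rewrite h1.
have roE : rot (size (y' :: C)) (y' :: C ++ D) = r :: R.
  by rewrite -cat_cons rot_size_cat ER.
have mo u : (u \in y' :: C ++ D) = (u \in r :: R).
  by rewrite -(mem_rot (size (y' :: C))) roE.
pose kd' u := if u \in y :: B then k else kd u.
exists eta1, kd'; split => //.
- rewrite planarC; apply: planar_tperm => //; last by rewrite planarC (dg_planar Dg).
  by apply/orP; left; apply: (fcycle_porbit (dg_os Dg)); rewrite mos ?qB ?qC ?orbT.
- exact: (dg_inv Dg).
- move=> u e; have no : u \notin os by apply: contraL (introT eqP e); apply: (dg_live Dg).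
  rewrite e1u ?(dg_dead Dg) //; apply: contraNneq no => ->; by rewrite mos ?qB ?qC ?orbT.
- exact: (dg_lab Dg).
- move=> u lu; rewrite mo => uR; rewrite /kd'.
  case: (boolP (u \in y :: B)) => uB.
    have E := eqP (next_cycle cycB uB).
    rewrite E mem_next uB; split => //; rewrite -E.
    have h : path.cycle (fun u v => meets k (lab v) (linv (lab u))) (y :: B).
      by move: rU; rewrite /relator cycle_map.
    by rewrite E; exact: (next_cycle h uB).
  have uo : u \notin os by rewrite mos (negbTE uB).
  have e : eta1 u = eta u.
    by rewrite e1u //; apply: contraNneq uo => ->; rewrite mos ?qB ?qC ?orbT.
  have [h1 h2] := dg_cell Dg lu uo; rewrite e.
  have -> : (eta u \in y :: B) = false; last by [].
  apply: contraNF uo => h; have : eta u \in os by rewrite mos h.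
  rewrite -(mem_prev os) => h'; have := prev_cycle (dg_os Dg).
  have hu : eta u \in os by rewrite mos h.
  by move=> /(_ _ hu) /eqP /perm_inj <-.
- by rewrite -(rot_uniq (size (y' :: C))) roE; move: uq; rewrite -cat_cons cat_uniq => /and3P [].
- by rewrite -(rot_cycle (size (y' :: C))) roE.
- by move=> u; rewrite mo => uR; apply: (dg_live Dg); rewrite mos uR orbT.
Qed.

Definition dead (T : finType) (eps : {perm T}) := #|[set x | eps x == x]|.

Lemma hlink_isolated (T : finType) (a b : {perm T}) x y :
  a x = x -> b x = x -> connect (hlink a b) y x -> y = x.
Proof.
move=> ax bx /connectP [p]; elim: p y => [|z p IH] y //= /andP [yz pz] E.
have Ez := IH z pz E; subst z; case/or4P: yz => /eqP //.
- by move=> e; apply: (@perm_inj _ a); rewrite ax.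
- by rewrite ax.
- by move=> e; apply: (@perm_inj _ b); rewrite bx.
- by rewrite bx.
Qed.

(** Two dead letters become an edge that sticks out into the outer cell after [z]. Being isolated
    points, they may be attached to the outer cell by transpositions that join components;
    afterwards they lie on one cycle of the product, which allows pairing them. *)
Lemma insert_spur (T : finType) (eps eta : {perm T}) lab kd A z B w c x1 x2 :
    diagram eps eta lab kd (A ++ z :: B) w ->
    eps x1 = x1 -> eps x2 = x2 -> x1 != x2 ->
  exists (eps' eta' : {perm T}) lab',
    diagram eps' eta' lab' kd (A ++ z :: x1 :: x2 :: B)
      (map lab (rcons A z) ++ c :: linv c :: map lab B) /\
    forall u, u != x1 -> u != x2 -> eps' u = eps u.
Proof.
move=> D d1 d2 x12; set os := A ++ _ in D.
have h1 := dg_dead D d1; have h2 := dg_dead D d2.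
have no1 : x1 \notin os by apply: contraL (introT eqP d1); apply: (dg_live D).
have no2 : x2 \notin os by apply: contraL (introT eqP d2); apply: (dg_live D).
have zo : z \in os by rewrite mem_cat inE eqxx orbT.
have zx1 : z != x1 by apply: contraNneq no1 => <-.
have zx2 : z != x2 by apply: contraNneq no2 => <-.
pose eta1 := (tperm z x1 * eta)%g; pose eta2 := (tperm x1 x2 * eta1)%g.
pose eps1 := (tperm x1 x2 * eps)%g.
have e1z : eta1 z = x1 by rewrite permM tpermL.
have e1x1 : eta1 x1 = eta z by rewrite permM tpermR.
have e1u u : u != z -> u != x1 -> eta1 u = eta u.
  by move=> *; rewrite permM tpermD // eq_sym.
have e2x1 : eta2 x1 = x2 by rewrite permM tpermL e1u // eq_sym.
have e2x2 : eta2 x2 = eta z by rewrite permM tpermR.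
have e2z : eta2 z = x1 by rewrite permM tpermD // eq_sym.
have e2u u : u != z -> u != x1 -> u != x2 -> eta2 u = eta u.
  by move=> *; rewrite permM tpermD ?e1u // eq_sym.
have p1 : eps1 x1 = x2 by rewrite permM tpermL.
have p2 : eps1 x2 = x1 by rewrite permM tpermR.
have pu u : u != x1 -> u != x2 -> eps1 u = eps u.
  by move=> *; rewrite permM tpermD // eq_sym.
have lz : eps z != z by apply: (dg_live D).
pose lab' u := if u == x1 then c else if u == x2 then linv c else lab u.
have labu u : u != x1 -> u != x2 -> lab' u = lab u.
  by rewrite /lab' => /negbTE -> /negbTE ->.
have labo s : {subset s <= os} -> map lab' s = map lab s.
  move=> so; apply/eq_in_map => u /so uo; rewrite labu //.
    by apply: contraNneq no1 => <-.
  by apply: contraNneq no2 => <-.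
exists eps1, eta2, lab'; split=> //; split.
- rewrite /eps1; apply: planar_tperm => //.
    apply/orP; right; apply/orP; left; apply/porbitP; exists 1%N.
    by rewrite expg1 permM d1 e2x1.
  rewrite planarC /eta2; apply: planar_tperm => //.
    apply/orP; right; apply/orP; right; apply: (contra _ (x12)) => h.
    have e12 : eta1 x2 = x2 by rewrite e1u // eq_sym.
    by apply/eqP; apply: (hlink_isolated e12 d2 h).
  rewrite /eta1; apply: planar_tperm => //; last by rewrite planarC (dg_planar D).
  apply/orP; right; apply/orP; right; apply: (contra _ (zx1)) => h.
  by apply/eqP; apply: (hlink_isolated h1 d1 h).
- move=> u; case: (u =P x1) => [->|/eqP n1]; first by rewrite p1.
  case: (u =P x2) => [->|/eqP n2]; first by rewrite p2.
  rewrite (pu u) // pu ?(dg_inv D) //.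
    by apply: contra_neq n1 => E; rewrite -(dg_inv D u) E.
  by apply: contra_neq n2 => E; rewrite -(dg_inv D u) E.
- move=> u; case: (u =P x1) => [->|/eqP n1].
    by rewrite p1 => E; rewrite E eqxx in x12.
  case: (u =P x2) => [->|/eqP n2].
    by rewrite p2 => E; rewrite E eqxx in x12.
  rewrite pu // => e; rewrite e2u ?(dg_dead D) //.
  by apply: contraNneq lz => <-; apply/eqP.
- move=> u; case: (u =P x1) => [->|/eqP n1].
    by rewrite p1 /lab' [x2 == x1]eq_sym (negbTE x12) !eqxx.
  case: (u =P x2) => [->|/eqP n2].
    by rewrite p2 /lab' [x2 == x1]eq_sym (negbTE x12) !eqxx linvK.
  rewrite pu // => lu; rewrite !labu ?(dg_lab D) //.
    by apply: contra_neq n1 => E; rewrite -(dg_inv D u) E.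
  by apply: contra_neq n2 => E; rewrite -(dg_inv D u) E.
- move=> u lu uo.
  have n1 : u != x1 by apply: contraNneq uo => ->; rewrite mem_cat !inE eqxx !orbT.
  have n2 : u != x2 by apply: contraNneq uo => ->; rewrite mem_cat !inE eqxx !orbT.
  have nz : u != z by apply: contraNneq uo => ->; rewrite mem_cat !inE eqxx !orbT.
  have no : u \notin os.
    by apply: contra uo; rewrite /os !mem_cat !inE => /or3P [] ->; rewrite ?orbT.
  rewrite pu // in lu; have [m1 m2] := dg_cell D lu no.
  rewrite e2u // !labu //.
    by apply: contra_neq n1 => E; apply: (@perm_inj _ eta); rewrite E h1.
  by apply: contra_neq n2 => E; apply: (@perm_inj _ eta); rewrite E h2.
- rewrite (perm_uniq (s2 := x1 :: x2 :: os)).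
    by rewrite /= inE negb_or x12 no1 no2 (dg_uniq D).
  by apply/seq.permP => p; rewrite /= !count_cat /=; lia.
- have uq : uniq (z :: B ++ A).
    by have := dg_uniq D; rewrite /os -(rot_uniq (size A)) rot_size_cat.
  have := dg_os D; rewrite /os -(rot_cycle (size A)) rot_size_cat => cyc.
  rewrite -(rot_cycle (size A)) rot_size_cat; move: cyc; rewrite /= e2z e2x1 !eqxx /=.
  have so : {subset B ++ A <= [pred u | [&& u != z, u != x1 & u != x2]]}.
    move=> u uBA; have uo : u \in os.
      by move: uBA; rewrite /os !mem_cat inE => /orP [] ->; rewrite ?orbT.
    rewrite inE; apply/and3P; split.
    + by move: uq => /= /andP [h _]; apply: contraNneq h => <-.
    + by apply: contraNneq no1 => <-.
    + by apply: contraNneq no2 => <-.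
  case: (B ++ A) so => [|v s] so /=; first by rewrite e2x2 !andbT.
  rewrite e2x2 => /andP [-> /=]; rewrite (eq_in_fpath (f := eta2) (g := eta)) // => u.
  by rewrite belast_rcons => /so /and3P [? ? ?]; apply: e2u.
- move=> u; rewrite mem_cat !inE => h.
  case: (u =P x1) => [->|/eqP n1]; first by rewrite p1 eq_sym.
  case: (u =P x2) => [->|/eqP n2]; first by rewrite p2.
  rewrite pu //; apply: (dg_live D); rewrite mem_cat inE.
  by move: h; rewrite (negbTE n1) (negbTE n2).
- rewrite map_cat /= map_rcons cat_rcons; congr (_ ++ _ :: _).
  + by apply: labo => u uA; rewrite mem_cat uA.
  + by rewrite labu.
  rewrite {1 2}/lab' [x2 == x1]eq_sym (negbTE x12) !eqxx; congr [:: _, _ & _].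
  by apply: labo => u uB; rewrite mem_cat inE uB !orbT.
Qed.

End Diagrams.

(** * The group of words modulo fillability *)

Record word_congruence (L : choiceType) (linv : L -> L) := WordCongruence {
  wc_rel :> equiv_rel (seq L);
  wc_cat : forall u u' v v', wc_rel u u' -> wc_rel v v' -> wc_rel (u ++ v) (u' ++ v');
  wc_inv : forall c, wc_rel [:: c; linv c] [::];
  wc_linvK : involutive linv }.

Section WordGroup.
Variables (L : choiceType) (linv : L -> L) (E : word_congruence linv).
Local Open Scope quotient_scope.

Definition winv (u : seq L) := rev (map linv u).

Lemma winvK : involutive winv.
Proof. by move=> u; rewrite /winv map_rev revK (mapK (wc_linvK E)). Qed.

Lemma wc_mulV u : E (u ++ winv u) [::].
Proof.
elim/last_ind: u => [|u c IH]; first exact: equiv_refl.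
have -> : rcons u c ++ winv (rcons u c) = u ++ ([:: c; linv c] ++ winv u).
  by rewrite /winv map_rcons rev_rcons cat_rcons.
apply: equiv_trans IH; apply: wc_cat; first exact: equiv_refl.
by rewrite -[X in E _ X]cat0s; apply: wc_cat; [exact: wc_inv | exact: equiv_refl].
Qed.

Lemma wc_invV u : E (winv u ++ u) [::].
Proof. by rewrite -{2}(winvK u); exact: wc_mulV. Qed.

Lemma wc_winv u v : E u v -> E (winv u) (winv v).
Proof.
move=> uv; apply: (equiv_trans (y := winv u ++ (v ++ winv v))).
  rewrite -{1}[winv u]cats0; apply: wc_cat; first exact: equiv_refl.
  by rewrite equiv_sym; exact: wc_mulV.
rewrite catA -[X in E _ X]cat0s; apply: wc_cat; last exact: equiv_refl.
apply: equiv_trans (wc_invV u); apply: wc_cat; first exact: equiv_refl.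
by rewrite equiv_sym.
Qed.

Definition word_group := {eq_quot E}.
HB.instance Definition _ := Choice.on word_group.

Definition wpi (u : seq L) : word_group := \pi_({eq_quot E}) u.
Definition wmul (x y : word_group) : word_group :=
  wpi (generic_quotient.repr (x : {eq_quot E}) ++ generic_quotient.repr (y : {eq_quot E})).
Definition winvg (x : word_group) : word_group := wpi (winv (generic_quotient.repr (x : {eq_quot E}))).

Lemma wpi_eq u v : wpi u = wpi v <-> E u v.
Proof. by split=> [/eqmodP|h]; last exact/eqmodP. Qed.

Lemma wpi_repr (x : word_group) : wpi (generic_quotient.repr (x : {eq_quot E})) = x.
Proof. exact: reprK. Qed.

Lemma E_repr u : E (generic_quotient.repr (wpi u : {eq_quot E})) u.
Proof. by apply/wpi_eq; rewrite wpi_repr. Qed.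

Lemma wpiM u v : wmul (wpi u) (wpi v) = wpi (u ++ v).
Proof. by apply/wpi_eq; apply: wc_cat; exact: E_repr. Qed.

Lemma wpiV u : winvg (wpi u) = wpi (winv u).
Proof. by apply/wpi_eq; apply: wc_winv; exact: E_repr. Qed.

Lemma wmulA : associative wmul.
Proof.
by move=> x y z; rewrite -(wpi_repr x) -(wpi_repr y) -(wpi_repr z) !wpiM catA.
Qed.

Lemma wmul1g : left_id (wpi [::]) wmul.
Proof. by move=> x; rewrite -(wpi_repr x) wpiM. Qed.

Lemma wmulg1 : right_id (wpi [::]) wmul.
Proof. by move=> x; rewrite -(wpi_repr x) wpiM cats0. Qed.

Lemma wmulVg : left_inverse (wpi [::]) winvg wmul.
Proof.
by move=> x; rewrite -(wpi_repr x) wpiV wpiM; apply/wpi_eq; exact: wc_invV.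
Qed.

Lemma wmulgV : right_inverse (wpi [::]) winvg wmul.
Proof.
by move=> x; rewrite -(wpi_repr x) wpiV wpiM; apply/wpi_eq; exact: wc_mulV.
Qed.

HB.instance Definition _ :=
  isGroup.Build word_group wmulA wmul1g wmulg1 wmulVg wmulgV.

Lemma wpi_nil : wpi [::] = 1%g. Proof. by []. Qed.
Lemma wpi_cat u v : wpi (u ++ v) = (wpi u * wpi v)%g.
Proof. by rewrite -wpiM. Qed.

End WordGroup.

(** * Boundary words of planar diagrams *)

Section Fillable.
Variables (L : choiceType) (linv : L -> L) (meets : bool -> rel L).
Hypothesis linvK : involutive linv.
Hypothesis meets_refl : forall k a, meets k a a.
Hypothesis meets_sym : forall k a b, meets k a b -> meets k b a.

Definition filled k (w : seq L) :=
  exists (T : finType) (eps eta : {perm T}) lab kd os,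
    diagram linv meets eps eta lab kd os w /\ k <= dead eps.

(* [w] bounds planar diagrams; the number of dead letters is left arbitrary so
   that a diagram can be enlarged without changing its type of letters. *)
Definition fillable w := forall k, filled k w.

(** A sphere with a single edge, both letters of which belong to the outer cell; the other [k]
    points are dead. *)
Lemma fillable_base c : fillable [:: c; linv c].
Proof.
move=> k; pose T := 'I_k.+2; pose x1 : T := ord0; pose x2 : T := lift ord0 ord0.
pose t := tperm x1 x2.
have x12 : x1 != x2 by [].
exists T, t, t, (fun x => if x == x1 then c else linv c), (fun=> false), [:: x1; x2].
have pl : planar t t.
  have p0 : planar (T := T) 1%g 1%g.
    by rewrite /planar /chi mulg1 ncyc1 ncomps1; lia.
  have p1 : planar t (T := T) 1%g.
    rewrite -[t]mulg1; apply: planar_tperm => //; apply/orP; right; apply/orP; right.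
    apply: (contra _ (x12)) => h; apply/eqP; apply: hlink_isolated h; exact: perm1.
  have -> : planar t t = planar (t * 1)%g t by rewrite mulg1.
  apply: planar_tperm; rewrite 1?planarC //.
  by apply/orP; right; apply/orP; left; apply/porbitP; exists 1%N; rewrite mul1g tpermL.
split; last first.
  have cT : #|T| = k.+2 by rewrite card_ord.
  have := cardsC [set x1; x2]; rewrite cards2 x12 cT => c2.
  apply: leq_trans (_ : #|~: [set x1; x2]| <= _); first by lia.
  apply: subset_leq_card.
  apply/subsetP => u; rewrite !inE negb_or => /andP [n1 n2].
  by apply/eqP; rewrite tpermD // eq_sym.
split=> //.
- by move=> u; rewrite tpermK.
- move=> u; rewrite /t; case: tpermP => [->|->|_ _].
  + by [].
  + by rewrite /= linvK.
  + by rewrite eqxx.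
- move=> u lu; rewrite !inE negb_or => /andP [n1 n2].
  by move: lu; rewrite /t tpermD ?eqxx // eq_sym.
- by rewrite /= tpermL tpermR !eqxx.
- by move=> u; rewrite !inE => /orP [] /eqP ->; rewrite ?tpermL ?tpermR // eq_sym.
Qed.

Lemma fillable_spur u c v : u != [::] -> fillable (u ++ v) ->
  fillable (u ++ c :: linv c :: v).
Proof.
move=> u0 F k; have [T [eps [eta [lab [kd [os [D dk]]]]]]] := F k.+2.
case: (lastP u) u0 {F} D => // u' a _ D.
have [A [z [B [Eos [Eu [Ea Ev]]]]]] : exists A z B, os = A ++ z :: B /\
    (map lab A = u' /\ (lab z = a /\ map lab B = v)).
  have w := dg_word D; have sz : size os = size u' + (size v).+1.
    by rewrite -(size_map lab) w size_cat size_rcons addSnnS.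
  have [z0 _] : exists z0 : T, z0 \in os.
    by case: (os) sz => [|z0 s] sz; [rewrite addnS in sz | exists z0; rewrite inE eqxx].
  exists (take (size u') os), (nth z0 os (size u')), (drop (size u').+1 os).
  rewrite -drop_nth ?cat_take_drop; last by rewrite sz; lia.
  split=> //; rewrite map_take map_drop w; rewrite cat_rcons take_size_cat //; split=> //.
  rewrite -(nth_map z0 a) ?sz; last by lia.
  rewrite w cat_rcons nth_cat ltnn subnn; split=> //.
  by rewrite -cat_rcons drop_size_cat // size_rcons.
have [x1 [x2 [d1 [d2 x12]]]] : exists x1 x2, eps x1 = x1 /\ (eps x2 = x2 /\ x1 != x2).
  move: dk; rewrite /dead => dk.
  have /card_gt0P [x1 h1] : 0 < #|[set x | eps x == x]| by lia.
  have /card_gt0P [x2 h2] : 0 < #|[set x | eps x == x] :\ x1|.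
    by move: dk; rewrite (cardsD1 x1) h1; lia.
  exists x1, x2; move: h1 h2; rewrite !inE => /eqP -> /andP [h /eqP ->].
  by rewrite eq_sym.
rewrite Eos in D.
have [eps' [eta' [lab' [D' pu]]]] := insert_spur linvK c D d1 d2 x12.
exists T, eps', eta', lab', kd, (A ++ [:: z, x1, x2 & B]); split.
  by move: D'; rewrite map_rcons Eu Ea Ev.
move: dk; rewrite /dead => dk.
have h1 : x1 \in [set x | eps x == x] by rewrite inE d1.
have h2 : x2 \in [set x | eps x == x] :\ x1 by rewrite !inE eq_sym x12 d2 eqxx.
rewrite (cardsD1 x1) h1 (cardsD1 x2) h2 !ltnS in dk.
apply: leq_trans dk _; apply: subset_leq_card; apply/subsetP => y.
by rewrite !inE => /and3P [n2 n1 /eqP e]; rewrite pu // e.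
Qed.

Lemma fillable_cut k u r v : u != [::] -> relator linv meets k r ->
  fillable (u ++ r ++ v) -> fillable (u ++ v).
Proof.
move=> u0 rr F; case: r rr F => [//|b r] rr F k'.
have [T [eps [eta [lab [kd [os [D dk]]]]]]] := F k'.
case: u u0 {F} D => // a u _ D.
have [y' [C [y [B [D0 [Eos [E1 [E2 E3]]]]]]]] : exists y' C y B D0,
   os = y' :: C ++ y :: B ++ D0 /\ (map lab (y' :: C) = a :: u /\
    (map lab (y :: B) = b :: r /\ map lab D0 = v)).
  have w := dg_word D; case: os w {D} => //= y' s [la w].
  have sz := congr1 size w; rewrite size_map !size_cat /= size_cat in sz.
  have szt : size (take (size u) s) = size u by rewrite size_takel // sz leq_addr.
  move: (congr1 (drop (size u)) w); rewrite -map_drop drop_size_cat //.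
  case Ed : (drop (size u) s) => [|y s'] //= [lb w'].
  exists y', (take (size u) s), y, (take (size r) s'), (drop (size r) s').
  rewrite cat_take_drop -Ed cat_take_drop; split=> //.
  rewrite la lb !map_take w map_drop w' !take_size_cat // drop_size_cat //.
rewrite Eos in D; rewrite -E2 in rr.
have [eta' [kd' D']] := cut_cell D rr.
exists T, eps, eta', lab, kd', (y' :: C ++ D0); split => //.
have -> : (a :: u) ++ v = map lab (y' :: C ++ D0) by rewrite -cat_cons map_cat E1 E3.
by [].
Qed.

Lemma fillable_rot u v : fillable (u ++ v) -> fillable (v ++ u).
Proof.
move=> F k; have [T [eps [eta [lab [kd [os [D dk]]]]]]] := F k.
exists T, eps, eta, lab, kd, (rot (size u) os); split => //.
split; rewrite ?rot_uniq ?rot_cycle; try by case: D.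
- by move=> x; rewrite mem_rot; apply: (dg_cell D).
- by move=> x; rewrite mem_rot; apply: (dg_live D).
- by rewrite map_rot (dg_word D) rot_size_cat.
Qed.

Lemma relator_inv k r : relator linv meets k r -> relator linv meets k (rev (map linv r)).
Proof.
rewrite /relator rev_cycle cycle_map; apply: sub_cycle => a b /=.
by rewrite linvK; exact: meets_sym.
Qed.

Lemma relator_spur k c : relator linv meets k [:: c; linv c].
Proof. by rewrite /relator /= linvK !meets_refl. Qed.

Lemma fillable_spurs u r v : u != [::] -> fillable (u ++ v) ->
  fillable (u ++ r ++ rev (map linv r) ++ v).
Proof.
elim: r u v => [//|c r IH] u v u0 F.
have -> : u ++ (c :: r) ++ rev (map linv (c :: r)) ++ v =
          (rcons u c) ++ r ++ rev (map linv r) ++ (linv c :: v).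
  by rewrite /= rev_cons cat_rcons -!cats1 -!catA.
apply: IH; first by case: (u).
by rewrite cat_rcons; apply: fillable_spur.
Qed.

(** The word [r] and its formal inverse are grown as nested spurs, and the inverse, a relator as
    well, is cut off as a cell. Together with [fillable_cut], relators can be inserted and removed
    at will. *)
Lemma fillable_insert k u r v : u != [::] -> relator linv meets k r ->
  fillable (u ++ v) -> fillable (u ++ r ++ v).
Proof.
move=> u0 rr F; have := fillable_spurs r u0 F; rewrite !catA -(catA (u ++ r)).
apply: (fillable_cut (k := k)); last exact: relator_inv.
by case: (u) u0.
Qed.

Variable c0 : L.

(** The syntactic congruence of fillable words. The leading pair of inverse letters keeps the rest
    of the outer word non-empty in every context, as [fillable_cut] demands. *)
Definition fill_eqv (u v : seq L) : bool :=
  `[< forall x y, fillable ([:: c0; linv c0] ++ x ++ u ++ y) <->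
                  fillable ([:: c0; linv c0] ++ x ++ v ++ y) >].

Lemma fill_eqv_refl : reflexive fill_eqv.
Proof. by move=> u; apply/asboolP. Qed.

Lemma fill_eqv_sym : symmetric fill_eqv.
Proof.
move=> u v; apply/asboolP/asboolP => h x y; split=> /h //.
Qed.

Lemma fill_eqv_trans : transitive fill_eqv.
Proof.
move=> v u w /asboolP h1 /asboolP h2; apply/asboolP => x y.
by split=> [/h1 /h2|/h2 /h1].
Qed.

Canonical fill_equiv := EquivRel fill_eqv fill_eqv_refl fill_eqv_sym fill_eqv_trans.

Lemma fill_eqv_cat u u' v v' :
  fill_equiv u u' -> fill_equiv v v' -> fill_equiv (u ++ v) (u' ++ v').
Proof.
move=> /asboolP h1 /asboolP h2; apply/asboolP => x y; rewrite -!(catA _ _ y).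
rewrite h1; have := h2 (x ++ u') y; by rewrite -!(catA x).
Qed.

Lemma fill_eqv_relator k r : relator linv meets k r -> fill_equiv r [::].
Proof.
move=> rr; apply/asboolP => x y; split; rewrite !(catA [:: c0; linv c0]) => F.
  exact: fillable_cut rr F.
exact: fillable_insert rr F.
Qed.

Lemma fill_eqv_inv c : fill_equiv [:: c; linv c] [::].
Proof. exact: (fill_eqv_relator (relator_spur true c)). Qed.

Definition fill_congruence : word_congruence linv :=
  WordCongruence fill_eqv_cat fill_eqv_inv linvK.

(** In the empty context, [w] may replace the empty word after the pair [c0], [linv c0], which is
    fillable. The pair is then rotated to the end and cut off. *)
Lemma fill_group_fillable w : w != [::] ->
  wpi fill_congruence w = 1%g -> fillable w.
Proof.
move=> w0 /wpi_eq /asboolP /(_ [::] [::]); rewrite cats0 /= => /iffRL h.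
have F := h (fillable_base c0); rewrite -[w]cats0.
apply: (fillable_cut w0 (relator_spur true c0)); rewrite cats0.
exact: (fillable_rot (u := [:: c0; linv c0])).
Qed.

End Fillable.

(** * Euler's formula for the live letters *)

Section CountingLive.
Variables (T : finType) (eps eta : {perm T}).
Hypothesis pl : planar eps eta.
Hypothesis epsK : forall x, eps (eps x) = x.
Hypothesis deadE : forall x, eps x = x -> eta x = x.

Let L := [set x | eps x != x].

Definition orbits_of (s : {perm T}) (P : {set T}) := [set porbit s x | x in P].

Lemma porbit_fix (s : {perm T}) x : s x = x -> porbit s x = [set x].
Proof.
move=> sx; apply/setP => y; rewrite inE; apply/porbitP/eqP => [[i ->]|->].
  by rewrite permX; elim: i => //= i ->.
by exists 0%N; rewrite expg0 perm1.
Qed.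

Lemma card_porbits_split (s : {perm T}) : (forall x, x \notin L -> s x = x) ->
  ncyc s = #|orbits_of s L| + #|~: L|.
Proof.
move=> sL; rewrite /ncyc; have -> : porbits s = orbits_of s L :|: orbits_of s (~: L).
  apply/setP => O; rewrite inE; apply/imsetP/orP => [[x _ ->]|].
    by case: (boolP (x \in L)) => xL; [left|right]; apply: imset_f => //; rewrite inE.
  by case=> /imsetP [x _ ->]; exists x.
rewrite cardsU; have -> : orbits_of s L :&: orbits_of s (~: L) = set0.
  apply/setP => O; rewrite !inE; apply/negP => /andP [/imsetP [x xL ->]].
  case/imsetP => y; rewrite inE => yL E.
  have := porbit_id s x; rewrite E (porbit_fix (sL _ yL)) inE => /eqP xy.
  by rewrite xy (negbTE yL) in xL.
rewrite cards0 subn0; congr (_ + _); rewrite card_in_imset // => x y.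
rewrite !inE => xL yL; rewrite (porbit_fix (sL _ _)) ?inE // (porbit_fix (sL _ _)) ?inE //.
exact: set1_inj.
Qed.

Lemma card_porbits_inv : 2 * ncyc eps = #|T| + #|~: L|.
Proof.
have E : forall x, porbit eps x = [set x; eps x].
  move=> x; apply/setP => y; rewrite !inE; apply/porbitP/orP => [[i ->]|].
    rewrite permX; elim: i => [|i [/eqP|/eqP] /=]; first by left.
      by move=> ->; right.
    by move=> ->; left; rewrite epsK.
  by case=> /eqP ->; [exists 0%N; rewrite expg0 perm1 | exists 1%N].
rewrite card_porbits_split; last by move=> x; rewrite inE negbK => /eqP.
suff : 2 * #|orbits_of eps L| = #|L|.
  by rewrite mulnDr => ->; rewrite mul2n -addnn addnA cardsC.
rewrite [in RHS](card_partition (P := orbits_of eps L)).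
  rewrite (eq_bigr (fun=> 2)) ?sum_nat_const 1?mulnC //.
  by move=> O /imsetP [x]; rewrite inE => xL ->; rewrite E cards2 eq_sym xL.
have -> : orbits_of eps L = preim_partition (porbit eps) L.
  have st x : x \in L -> porbit eps x = [set y in L | porbit eps x == porbit eps y].
    move=> xL; apply/setP => y; rewrite [RHS]inE [porbit _ _ == _]eq_sym eq_porbit_mem.
    case: (boolP (y \in porbit eps x)); rewrite ?andbF // andbT => yx.
    symmetry; move: yx; rewrite E !inE => /orP [] /eqP ->; by move: xL; rewrite inE ?epsK // eq_sym.
  apply/setP => O; apply/imsetP/imsetP => -[x xL ->]; exists x => //; first exact: st.
  by symmetry; exact: st.
exact: preim_partitionP.
Qed.

Lemma ncomps_dead x0 : x0 \in L -> #|~: L| < ncomps eps eta.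
Proof.
move=> x0L; rewrite /ncomps nclassesE; last exact: hlink_sym.
pose cl x := [set y | connect (hlink eps eta) x y].
have iso x : x \notin L -> forall y, connect (hlink eps eta) y x -> y = x.
  rewrite inE negbK => /eqP ex y; apply: hlink_isolated => //; exact: deadE.
have sub : cl x0 |: [set cl x | x in ~: L] \subset [set cl x | x : T].
  apply/subsetP => A /setU1P [->|/imsetP [x _ ->]]; exact: imset_f.
have := subset_leq_card sub; rewrite cardsU1 => h; apply: leq_trans h.
rewrite card_in_imset; last first.
  move=> x y; rewrite !inE => xL yL /setP /(_ y); rewrite !inE connect0.
  by apply: iso; rewrite inE.
case: imsetP => [[x]|_] //; rewrite inE => xL /setP /(_ x); rewrite !inE connect0.
by move=> /(iso _ xL) E; rewrite E (negbTE xL) in x0L.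
Qed.

(** Edges are half as many as live letters, and a dead letter adds 3 to both sides of the planarity
    inequality: a point and a component on one side, three fixed points on the other. The constant 4
    is twice the Euler characteristic of a sphere, at least one component being live. *)
Lemma live_count x0 : x0 \in L ->
  #|L| + 4 <= 2 * (#|orbits_of eta L| + #|orbits_of (eps * eta)%g L|).
Proof.
move=> x0L; have h := ncomps_dead x0L; have := pl; rewrite /planar /chi.
have fixL x : x \notin L -> eps x = x by rewrite inE negbK => /eqP.
rewrite (@card_porbits_split eta) => [|x /fixL /deadE //].
rewrite (@card_porbits_split (eps * eta)%g) => [|x /fixL e]; last by rewrite permM e deadE.
have := card_porbits_inv; have := cardsC L; lia.
Qed.

End CountingLive.

Section OrbitSums.
Local Open Scope ring_scope.
Variables (T : finType) (R : numDomainType).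

Lemma orbits_bound (s : {perm T}) (P : {set T}) (g : T -> R) (c : R) :
    (forall x, x \in P -> s x \in P) ->
    (forall x, x \in P -> c <= \sum_(y in porbit s x) g y) ->
  c *+ #|orbits_of s P| <= \sum_(x in P) g x.
Proof.
move=> sP h; rewrite (partition_big_imset (porbit s)) /=.
rewrite -sumr_const; apply: ler_sum => O /imsetP [x xP ->].
apply: le_trans (h x xP) _; rewrite le_eqVlt; apply/orP; left; apply/eqP.
apply: eq_bigl => y; rewrite eq_porbit_mem.
case: (boolP (y \in porbit s x)); rewrite ?andbF // andbT => /porbitP [i ->].
by symmetry; rewrite permX; elim: i => //= i; apply: sP.
Qed.

End OrbitSums.

(** * The Gauss-Bonnet inequality *)

Section Letters.
Variables (E S : finType) (nxt : S -> S) (bd : S -> E * bool).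

Definition flip (d : E * bool) : E * bool := (d.1, ~~ d.2).
(* The letter [(c, false)] crosses a polygon from the side [c] to the side
   [nxt c], cutting the corner between them; [(c, true)] is its inverse. The
   end of the edge of [lside a] at which that corner lies is [ldart a]. *)
Definition linv (a : S * bool) : S * bool := (a.1, ~~ a.2).
Definition lside (a : S * bool) := if a.2 then nxt a.1 else a.1.
Definition ldart (a : S * bool) := if a.2 then bd (nxt a.1) else flip (bd a.1).
Definition meets (k : bool) (a b : S * bool) :=
  if k then lside a == lside b else ldart a == ldart b.

Lemma flipK : involutive flip. Proof. by case=> e b; rewrite /flip /= negbK. Qed.
Lemma flip_neq d : flip d != d.
Proof. by case: d => e []; rewrite /flip xpair_eqE eqxx. Qed.
Lemma linvK : involutive linv. Proof. by case=> c b; rewrite /linv /= negbK. Qed.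
Lemma linv_neq a : linv a != a.
Proof. by case: a => c []; rewrite /linv xpair_eqE eqxx. Qed.
Lemma meets_refl k a : meets k a a. Proof. by rewrite /meets; case: k. Qed.
Lemma meets_sym k a b : meets k a b -> meets k b a.
Proof. by rewrite /meets; case: k; rewrite eq_sym. Qed.
Lemma meets_trans k a b c : meets k a b -> meets k b c -> meets k a c.
Proof. by rewrite /meets; case: k => /eqP -> /eqP ->. Qed.

Lemma ldart_edge a : (ldart a).1 = (bd (lside a)).1.
Proof. by rewrite /ldart /lside; case: a.2. Qed.

Hypothesis nxtI : injective nxt.

(** Two letters leave a given side, one at either end of it. *)
Lemma ldart_flip a b : lside a = lside b -> a != b -> (ldart a).2 = ~~ (ldart b).2.
Proof.
case: a b => [c []] [d []]; rewrite /lside /ldart /= => e; rewrite ?e ?negbK //.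
- by rewrite (nxtI e) eqxx.
- by rewrite eqxx.
Qed.

End Letters.

Section GaussBonnet.
Variables (E S : finType) (nxt : S -> S) (bd : S -> E * bool).
Hypothesis nxtI : injective nxt.
Variables (T : finType) (eps eta : {perm T}) (lab : T -> S * bool) (kd : T -> bool).
Variables (os : seq T) (w : seq (S * bool)).
Local Notation meets := (meets nxt bd).
Local Notation lside := (lside nxt).
Local Notation ldart := (ldart nxt bd).
Hypothesis D : diagram (@linv S) meets eps eta lab kd os w.

(** These four conditions are what a minimal diagram provides: otherwise an edge could be erased,
    two letters folded, or the outer cell cut at a double point. *)
Hypothesis alternating : forall x, eps x != x -> x \notin os -> eps x \notin os ->
  kd (eps x) = ~~ kd x.
Hypothesis reduced : forall x, eps x != x -> x \notin os ->
  lab (eta x) != linv (lab x).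
Hypothesis outer_inner : {in os, forall x, eps x \notin os}.
Let th := (eps * eta)%g.
Hypothesis outer_simple : {in os &, forall x y, y \in porbit th x -> x = y}.

Definition nface (O : {set T}) := #|[set y in O | (y \notin os) && kd y]|.
Definition nvert (O : {set T}) := #|[set y in O | (y \notin os) && ~~ kd y]|.
Definition prevo o := (eta^-1)%g o.

Lemma thE x : th x = eta (eps x). Proof. by rewrite permM. Qed.

Lemma eta_os x : (eta x \in os) = (x \in os).
Proof.
apply/idP/idP => h; last exact: (fcycle_mem (dg_os D)).
by have /eqP := prev_cycle (dg_os D) h; move/perm_inj => <-; rewrite mem_prev.
Qed.

Lemma sum_node (O : {set T}) (P : pred T) :
  (forall x, x \in O -> th x \in O) ->
  \sum_(z in O) nat_of_bool (P (th z)) = \sum_(z in O) nat_of_bool (P z).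
Proof.
move=> st; have im : [set th z | z in O] = O.
  apply/eqP; rewrite eqEcard card_imset ?leqnn ?andbT; last exact: perm_inj.
  by apply/subsetP => y /imsetP [z zO ->]; exact: st.
by rewrite -[in RHS]im big_imset //= => x y _ _; exact: perm_inj.
Qed.

Lemma xor_node (O : {set T}) (P : pred T) :
  (forall x, x \in O -> th x \in O) ->
  \big[addb/false]_(z in O) P (th z) = \big[addb/false]_(z in O) P z.
Proof.
move=> st; have im : [set th z | z in O] = O.
  apply/eqP; rewrite eqEcard card_imset ?leqnn ?andbT; last exact: perm_inj.
  by apply/subsetP => y /imsetP [z zO ->]; exact: st.
by rewrite -[in RHS]im big_imset //= => x y _ _; exact: perm_inj.
Qed.

Lemma porbit_st x y : y \in porbit th x -> th y \in porbit th x.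
Proof. by rewrite -!eq_porbit_mem porbit_step. Qed.

Lemma porbit_live x y : eps x != x -> y \in porbit th x -> eps y != y.
Proof.
move=> lx /porbitP [i ->]; rewrite permX; elim: i => //= i IH.
by rewrite thE; apply: (dg_eta_live D); apply: (dg_liveE D).
Qed.

Lemma nfaceE O : nface O = \sum_(z in O) nat_of_bool ((z \notin os) && kd z).
Proof. by rewrite /nface -sum1_card (eq_bigl _ _ (in_set _)) big_mkcondr. Qed.

Lemma nvertE O : nvert O = \sum_(z in O) nat_of_bool ((z \notin os) && ~~ kd z).
Proof. by rewrite /nvert -sum1_card (eq_bigl _ _ (in_set _)) big_mkcondr. Qed.

(** A node lies on an edge of the complex, and the bit tells at which end of it a letter cuts its
    corner. Turning around the node, a vertex cell keeps this end and a triangle cell changes it. *)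
Lemma step_bit z : eps z != z -> th z \notin os ->
  (ldart (lab (th z))).2 = (ldart (lab z)).2 (+) kd (th z).
Proof.
move=> lz; rewrite thE eta_os => zo; have le := dg_liveE D lz.
have [m k] := dg_cell D le zo; have r := reduced le zo.
have e : linv (lab (eps z)) = lab z by rewrite (dg_lab D lz) linvK.
rewrite e in m r; rewrite k; case: (kd (eps z)) m => /= /eqP h.
  by rewrite addbT; apply: ldart_flip.
by rewrite addbF h.
Qed.

(** Kinds alternate around the node, and a full turn changes the end of the edge an even number of
    times, once per triangle cell. So at least four cells meet at an inner node. *)
Lemma node_inner x : eps x != x -> {in porbit th x, forall y, y \notin os} ->
  nvert (porbit th x) = nface (porbit th x) /\ ~~ odd (nface (porbit th x)).
Proof.
move=> lx no; set O := porbit th x; have st : forall z, z \in O -> th z \in O by exact: porbit_st.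
have lO z : z \in O -> eps z != z by exact: porbit_live.
have kdth z : z \in O -> kd (th z) = ~~ kd z.
  move=> zO; have := no _ (st _ zO); rewrite thE eta_os => zo.
  have [_ ->] := dg_cell D (dg_liveE D (lO _ zO)) zo.
  by apply: alternating => //; [exact: lO | exact: no].
split.
  rewrite nfaceE nvertE -(sum_node (fun z => (z \notin os) && kd z) st).
  by apply: eq_bigr => z zO; rewrite kdth // !no ?st.
have := xor_node (fun z => (ldart (lab z)).2) st.
rewrite nfaceE (big_morph odd oddD (erefl (odd 0))).
rewrite (eq_bigr (fun z => (ldart (lab z)).2 (+) kd (th z))); last first.
  by move=> z zO; apply: step_bit; [exact: lO | apply: no; exact: st].
rewrite big_split /= => h.
have -> : \big[addb/false]_(z in O) odd ((z \notin os) && kd z) =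
          \big[addb/false]_(z in O) kd (th z).
  rewrite (xor_node kd st); apply: eq_bigr => z zO.
  by rewrite no //; case: (kd z).
by move: h; do 2 case: (\big[_/_]_(_ in _) _).
Qed.

(** The inner cells at an outer node form a fan of alternating kinds, from the cell across the
    letter [o] (a triangle if [A]) to the cell across the previous letter (a triangle if [B]). A
    single triangle cell cannot fill the fan when the outer word passes from one side to another
    side, and the parity of triangle cells records whether it changes the end of the edge. *)
Lemma node_outer o : o \in os ->
  let O := porbit th o in
  let A := kd (eps o) in let B := kd (eps (prevo o)) in
  [/\ #|O| = (nface O + nvert O).+1,
      nvert O + A + B = (nface O).+1,
      A || B -> 0 < nface O,
      lside (lab o) != lside (linv (lab (prevo o))) -> A && B -> 1 < nface O
    & odd (nface O) = (ldart (lab o)).2 (+) (ldart (linv (lab (prevo o)))).2].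
Proof.
move=> oo O A B; have st : forall z, z \in O -> th z \in O by exact: porbit_st.
have lo : eps o != o by exact: (dg_live D).
have lO z : z \in O -> eps z != z by exact: porbit_live.
have oO : o \in O by exact: porbit_id.
have O_os z : z \in O -> (z \in os) = (z == o).
  move=> zO; apply/idP/eqP => [zo|->//].
  by symmetry; apply: outer_simple.
have po : prevo o \in os by rewrite -eta_os /prevo permKV.
set y := eps (prevo o) in B *.
have thy : th y = o by rewrite thE (dg_inv D) permKV.
have yo : y \notin os by exact: outer_inner.
have yO : y \in O by rewrite -eq_porbit_mem -porbit_step thy.
have yo' : (y == o) = false by apply: contraNF yo => /eqP ->.
have laby : lab y = linv (lab (prevo o)) by rewrite (dg_lab D) // (dg_live D).
have th_o z : z \in O -> (th z \in os) = (z == y).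
  move=> zO; rewrite O_os ?st // -thy (inj_eq (@perm_inj _ _)) //.
have kdth z : z \in O -> z != y -> kd (th z) = kd (eps z).
  move=> zO zy; have := th_o _ zO; rewrite (negbTE zy) thE eta_os => /negbT zo.
  by have [_ ->] := dg_cell D (dg_liveE D (lO _ zO)) zo.
pose Fp z := (z \notin os) && kd z; pose Vp z := (z \notin os) && ~~ kd z.
(* Alternation, letter by letter; the two correction terms are the extremities of the fan. *)
have key z : z \in O ->
    Fp (th z) + (z == y) * ~~ B = (z == o) * A + Vp z.
  move=> zO; rewrite /Fp /Vp th_o // O_os //; case: (z =P y) => [->|/eqP zy] /=.
    by rewrite yo' mul1n mul0n.
  rewrite kdth // mul0n addn0; case: (z =P o) => [->|/eqP zo] /=.
    by rewrite mul1n addn0.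
  rewrite mul0n alternating ?lO //; first by rewrite O_os.
  have := th_o _ zO; rewrite (negbTE zy) thE eta_os; by move=> /negbT.
have one (u : T) (c : nat) : u \in O -> \sum_(z in O) (z == u) * c = c.
  move=> uO; rewrite (bigD1 u) //= eqxx mul1n big1 ?addn0 // => z /andP [_ /negbTE ->].
  by rewrite mul0n.
have sumE : nface O + ~~ B = A + nvert O.
  rewrite nfaceE nvertE -(sum_node Fp st) -{1}(one y (~~ B) yO) -big_split /=.
  rewrite (eq_bigr _ key) big_split /= one //.
have cO : #|O| = (nface O + nvert O).+1.
  rewrite (cardsD1 o) oO add1n; congr _.+1; rewrite /nface /nvert.
  rewrite -cardsUI [X in _ = _ + X]eq_card0 ?addn0.
    apply: eq_card => z; rewrite !inE; case: (boolP (z \in O)) => zO; rewrite ?andbF //=.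
    by rewrite O_os // andbT; case: (z == o); case: (kd z).
  by move=> z; rewrite !inE; case: (kd z); rewrite !andbF.
split=> //.
- by move: sumE; case: (A); case: (B) => /=; lia.
- case/orP => [hA|hB].
    have h : th o \in [set z in O | Fp z].
      have oy : o != y by rewrite eq_sym yo'.
      by rewrite inE st //= /Fp th_o // (negbTE oy) kdth.
    by apply/card_gt0P; exists (th o).
  by apply/card_gt0P; exists y; rewrite inE yO yo.
- move=> ls /andP [hA hB].
  have oy : o != y by rewrite eq_sym yo'.
  have hto : th o \in [set z in O | Fp z] by rewrite inE st //= /Fp th_o // (negbTE oy) kdth.
  have hy : y \in [set z in O | Fp z] by rewrite inE yO /Fp yo.
  rewrite /nface (cardsD1 y) hy ltnS; apply/card_gt0P; exists (th o).
  rewrite !inE in hto *; rewrite hto andbT; apply: contra_neq ls => ty.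
  have := th_o _ oO; rewrite (negbTE oy) thE eta_os => /negbT eo.
  have [m _] := dg_cell D (dg_liveE D lo) eo.
  rewrite -[kd _]/A hA (dg_lab D lo) linvK -thE ty laby in m.
  by rewrite (eqP m).
have := xor_node (fun z => (ldart (lab z)).2) st.
rewrite nfaceE (big_morph odd oddD (erefl (odd 0))) -laby.
have -> : \big[addb/false]_(z in O) odd (Fp z) = \big[addb/false]_(z in O) Fp (th z).
  by rewrite (xor_node Fp st); apply: eq_bigr => z _; case: (Fp z).
set c := _ (+) _.
rewrite (eq_bigr (fun z => (ldart (lab z)).2 (+) (Fp (th z) (+) ((z == y) && c)))); last first.
  move=> z zO; case: (z =P y) => [->|/eqP zy] /=.
    by rewrite thy /Fp oo /= /c addbCA addbb addbF.
  rewrite addbF step_bit ?lO //; first by rewrite /Fp th_o // (negbTE zy).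
  by rewrite th_o.
rewrite !big_split /=.
have -> : \big[addb/false]_(z in O) ((z == y) && c) = c.
  by rewrite (bigD1 y) //= eqxx big1 ?addbF // => z /andP [_ /negbTE ->].
by case: c; do 2 case: (\big[_/_]_(_ in _) _).
Qed.


Local Open Scope ring_scope.
Variables (R : realFieldType) (pi : R) (alpha : S -> R).
Hypothesis pi_gt0 : 0 < pi.
Hypothesis nxt3 : forall s, nxt (nxt (nxt s)) = s.
Hypothesis nxt_neq : forall s, nxt s != s.
Hypothesis alpha_gt0 : forall s, 0 < alpha s.
Hypothesis alpha_sum : forall s, alpha s + alpha (nxt s) + alpha (nxt (nxt s)) = pi.
Hypothesis link_long : forall a r,
  path (fun a b => (ldart b == ldart (linv a)) && (b != linv a)) a r ->
  ldart a = ldart (linv (last a r)) ->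
  2 * pi <= \sum_(x <- a :: r) alpha x.1.

Lemma cell_st x y : eps x != x -> x \notin os -> y \in porbit eta x ->
  [/\ eps y != y, y \notin os & kd y = kd x].
Proof.
move=> lx xo /porbitP [i ->]; rewrite permX; elim: i => //= i [l o k].
split; [exact: (dg_eta_live D) | by rewrite eta_os | ].
by have [_ ->] := dg_cell D l o.
Qed.

(** The labels around the cell form a closed reduced walk in a link, to which [link_long]
    applies. *)
Lemma vertex_cell x : eps x != x -> x \notin os -> ~~ kd x ->
  2 * pi <= \sum_(y in porbit eta x) alpha (lab y).1.
Proof.
move=> lx xo kx; set n := #|porbit eta x|.
have n0 : (0 < n)%N by apply/card_gt0P; exists x; exact: porbit_id.
rewrite (eq_bigl _ _ (porbit_traject eta x)) -big_uniq ?uniq_traject_porbit //.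
have it : iter n eta x = x by exact: iter_porbit.
have tin : {subset traject eta x n <= porbit eta x}.
  by move=> y; rewrite -porbit_traject.
move: n0 it tin; rewrite -/n; case: n => // n _ it tin.
rewrite -(big_map lab predT (fun a => alpha a.1)) trajectS map_cons; apply: link_long.
  rewrite path_map; apply: (sub_in_path (P := mem (porbit eta x)) _ _ (fpath_traject eta x n)).
    move=> y z yO zO /eqP <-.
    have [l o k] := cell_st lx xo yO; have [m _] := dg_cell D l o.
    by rewrite k (negbTE kx) /= in m; rewrite /relpre /= m; exact: reduced.
  by apply/allP => y /tin.
have [l o k] : [/\ eps (iter n eta x) != iter n eta x, iter n eta x \notin os & kd (iter n eta x) = kd x].
  by apply: cell_st => //; rewrite -permX; exact: mem_porbit.
rewrite last_map last_traject.
have [m _] := dg_cell D l o; rewrite k (negbTE kx) /= in m.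
by rewrite -(eqP m) -iterS it.
Qed.

Lemma alpha_lt s : alpha s < pi.
Proof. by have := alpha_sum s; have := alpha_gt0 (nxt s); have := alpha_gt0 (nxt (nxt s)); lra. Qed.

Lemma face_next a b : lside b = lside (linv a) -> b != linv a ->
  b.2 = a.2 /\ if a.2 then nxt b.1 = a.1 else b.1 = nxt a.1.
Proof.
case: a b => [c []] [d []]; rewrite /lside /linv /= => e.
- by [].
- by rewrite e eqxx.
- by rewrite (nxtI e) eqxx.
- by [].
Qed.

(** A reduced walk around a triangle never changes direction, so three successive letters cut its
    three corners. Their exterior angles already sum to [2 pi], and the others are positive. *)
Lemma face_cell x : eps x != x -> x \notin os -> kd x ->
  2 * pi <= \sum_(y in porbit eta x) (pi - alpha (lab y).1).
Proof.
move=> lx xo kx; set O := porbit eta x.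
have st y : y \in O -> [/\ eps y != y, y \notin os & kd y = kd x].
  by move=> h; exact: cell_st.
have nx y : y \in O -> (lab (eta y)).2 = (lab y).2 /\
    if (lab y).2 then nxt (lab (eta y)).1 = (lab y).1 else (lab (eta y)).1 = nxt (lab y).1.
  move=> /st [l o k]; have [m _] := dg_cell D l o; rewrite k kx /= in m.
  by apply: face_next; [exact/eqP | exact: reduced].
have xO : x \in O by exact: porbit_id.
have stO y : y \in O -> eta y \in O by rewrite -!eq_porbit_mem porbit_step.
have [b1 h1] := nx _ xO; have [b2 h2] := nx _ (stO _ xO).
rewrite b1 in h2.
have nn s : nxt (nxt s) != s.
  apply/eqP => e; have := nxt3 s; rewrite e => e2; have := nxt_neq s; by rewrite e2 eqxx.
have [n1 [n2 [n3 sm]]] : (lab (eta x)).1 != (lab x).1 /\ ((lab (eta (eta x))).1 != (lab x).1 /\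
    ((lab (eta (eta x))).1 != (lab (eta x)).1 /\
    alpha (lab x).1 + alpha (lab (eta x)).1 + alpha (lab (eta (eta x))).1 = pi)).
  case: (lab x).2 h1 h2 => h1 h2.
    rewrite -h1 -h2; do 3 (split; first by rewrite eq_sym ?nxt_neq ?nn).
    by rewrite -(alpha_sum (lab (eta (eta x))).1); ring.
  by rewrite h2 h1; do 3 (split; first by rewrite ?nxt_neq ?nn); exact: alpha_sum.
rewrite (bigD1 x) //= (bigD1 (eta x)) /=; last first.
  by rewrite stO //; apply: contra_neq n1 => ->.
rewrite (bigD1 (eta (eta x))) /=; last first.
  rewrite stO ?stO //=; apply/andP; split; first by apply: contra_neq n2 => ->.
  by apply: contra_neq n3 => ->.
set r := (X in _ + (_ + (_ + X))); have : 0 <= r.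
  by apply: sumr_ge0 => y _; have := alpha_lt (lab y).1; lra.
by move=> ?; lra.
Qed.

(* The angle of the cell of [x] at the letter [x]; every node has an angle
   [pi / 2] in each of the cells around it. Two paired letters have
   complementary weights. *)
Definition weight x :=
  if x \in os then (if kd (eps x) then alpha (lab x).1 else pi - alpha (lab x).1)
  else (if kd x then pi - alpha (lab x).1 else alpha (lab x).1).

Lemma weight_pair x : eps x != x -> weight x + weight (eps x) = pi.
Proof.
move=> lx; have e : (lab (eps x)).1 = (lab x).1 by rewrite (dg_lab D lx).
rewrite /weight e (dg_inv D); case: (boolP (x \in os)) => xo /=.
  by rewrite (negbTE (outer_inner xo)); case: (kd (eps x)); ring.
case: (boolP (eps x \in os)) => eo /=; first by case: (kd x); ring.
by rewrite alternating //; case: (kd x) => /=; ring.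
Qed.

(** Inner cells have total weight at least [2 pi] and inner nodes have at least four cells, so no
    positive curvature comes from inside. The term [2 pi] on the right is the outer cell; hence the
    outer nodes contribute at least [2 pi]. *)
Lemma gauss_bonnet : os != [::] ->
  4 * pi <= 2 * pi +
    \sum_(o <- os) (2 * pi - pi / 2 * #|porbit th o|%:R - weight o).
Proof.
move=> os0; have [o0 o0s] : exists o, o \in os.
  by case: os os0 => // o s _; exists o; rewrite inE eqxx.
pose L := [set x | eps x != x].
pose Li := [set x in L | x \notin os].
pose P0 := [set x in L | [forall (y | y \in porbit th x), y \notin os]].
have lc : (#|L| + 4 <= 2 * (#|orbits_of eta L| + #|orbits_of th L|))%N.
  apply: (live_count (dg_planar D) (dg_inv D) (dg_dead D) (x0 := o0)).
  by rewrite inE (dg_live D).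
have c1 : (#|orbits_of eta L| <= #|orbits_of eta Li| + 1)%N.
  rewrite -(cards1 (porbit eta o0)); apply: leq_trans (leq_card_setU _ _).
  apply: subset_leq_card; apply/subsetP => O /imsetP [x xL ->]; rewrite inE.
  case: (boolP (x \in os)) => xo; last first.
    by apply/orP; left; apply: imset_f; rewrite inE xL.
  rewrite in_set1 eq_porbit_mem (fcycle_porbit (dg_os D)) ?orbT //.
have c2 : (#|orbits_of th L| <= #|orbits_of th P0| + size os)%N.
  apply: leq_trans (_ : #|orbits_of th P0 :|: [set porbit th o | o in os]| <= _)%N.
    apply: subset_leq_card; apply/subsetP => O /imsetP [x xL ->]; rewrite inE.
    case: (boolP [forall (y | y \in porbit th x), y \notin os]) => h.
      by apply/orP; left; apply: imset_f; rewrite inE xL.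
    move: h; rewrite negb_forall_in => /exists_inP [y yx]; rewrite negbK => yo.
    by apply/orP; right; apply/imsetP; exists y => //; apply/eqP; rewrite eq_porbit_mem porbit_sym.
  apply: leq_trans (leq_card_setU _ _) _; rewrite leq_add2l.
  by apply: leq_trans (leq_imset_card _ _) _; exact: card_size.
have b1 : (2 * pi) *+ #|orbits_of eta Li| <= \sum_(x in Li) weight x.
  apply: orbits_bound => [x|x].
    rewrite !inE => /andP [lx xo]; rewrite eta_os xo andbT; exact: (dg_eta_live D).
  rewrite !inE => /andP [lx xo].
  case: (boolP (kd x)) => kx.
    apply: le_trans (face_cell lx xo kx) _; rewrite le_eqVlt; apply/orP; left; apply/eqP.
    apply: eq_bigr => y yO; have [_ o k] := cell_st lx xo yO.
    by rewrite /weight (negbTE o) k kx.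
  apply: le_trans (vertex_cell lx xo kx) _; rewrite le_eqVlt; apply/orP; left; apply/eqP.
  apply: eq_bigr => y yO; have [_ o k] := cell_st lx xo yO.
  by rewrite /weight (negbTE o) k (negbTE kx).
have P0in x : x \in P0 -> eps x != x /\ {in porbit th x, forall y, y \notin os}.
  rewrite !inE => /andP [lx /forall_inP h]; split=> // y; exact: h.
(* [P0] gathers the letters of the inner nodes, each of which has at least four. *)
have b2 : (4 : R) *+ #|orbits_of th P0| <= \sum_(x in P0) 1.
  apply: orbits_bound => [x /P0in [lx h]|x /P0in [lx h]].
    rewrite !inE; apply/andP; split.
      by apply: (porbit_live lx); apply: porbit_st; exact: porbit_id.
    by apply/forall_inP => y; rewrite porbit_step => /h.
  rewrite sumr_const; have [h1 h2] := node_inner lx h.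
  suff : (4 <= #|porbit th x|)%N by rewrite -(ler_nat R).
  have h3 : #|porbit th x| = (nface (porbit th x) + nvert (porbit th x))%N.
    rewrite /nface /nvert -cardsUI [X in _ = (_ + X)%N]eq_card0 ?addn0.
      apply: eq_card => z; rewrite !inE; case: (boolP (z \in _)) => zO //=.
      by rewrite (h _ zO) /=; case: (kd z).
    by move=> z; rewrite !inE; case: (kd z); rewrite !andbF.
  have : (0 < #|porbit th x|)%N by apply/card_gt0P; exists x; exact: porbit_id.
  by move: h2; rewrite h3 h1; case: (nface _) => [|[|[|m]]] //= _ _; lia.
have uo := dg_uniq D.
have c3 : \sum_(x in P0) 1 + \sum_(o <- os) #|porbit th o|%:R <= #|L|%:R :> R.
  have cR (A : {set T}) : #|A|%:R = \sum_x (x \in A)%:R :> R.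
    by rewrite -sum1_card natr_sum big_mkcond /=; apply: eq_bigr => x _; case: ifP.
  rewrite sumr_const (eq_bigr (fun o => \sum_x (x \in porbit th o)%:R)); last first.
    by move=> o _; exact: cR.
  rewrite !cR exchange_big /= -big_split /=; apply: ler_sum => x _.
  case: (boolP (x \in L)) => xL; last first.
    have -> : (x \in P0) = false by rewrite inE (negbTE xL).
    rewrite add0r big1_seq // => o /andP [_ oo].
    case: (boolP (x \in _)) => // h; move: xL; rewrite inE (porbit_live _ h) //.
    exact: (dg_live D).
  case: (boolP (x \in P0)) => xP.
    rewrite big1_seq ?addr0 // => o /andP [_ oo].
    case: (boolP (x \in _)) => // h; have [_ h'] := P0in _ xP.
    by move: oo; rewrite (negbTE (h' o _)) // porbit_sym.
  rewrite add0r; case: (boolP (has (fun o => x \in porbit th o) os)); last first.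
    move=> /hasPn h; rewrite big1_seq ?ler01 // => o /andP [_ /h]. by case: (x \in _).
  case/hasP => o oo xo; rewrite (bigD1_seq o) //= xo big1_seq ?addr0 // => o' /andP [n oo'].
  case: (boolP (x \in _)) => // xo'; case/eqP: n; apply: outer_simple => //.
  by rewrite -eq_porbit_mem; move: xo xo'; rewrite -!eq_porbit_mem => /eqP <- /eqP ->.
(* Weights are summed over all live letters, once directly and once through [eps]. *)
have sL : 2 * (\sum_(x in Li) weight x + \sum_(o <- os) weight o) = pi * #|L|%:R.
  have -> : \sum_(x in Li) weight x + \sum_(o <- os) weight o = \sum_(x in L) weight x.
    rewrite big_uniq // [RHS](bigID (fun x => x \in os)) /= addrC; congr (_ + _).
      by apply: eq_bigl => x; rewrite !inE.
    apply: eq_bigl => x; rewrite !inE; case: (boolP (x \in os)) => xo; rewrite ?andbF //.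
    by rewrite (dg_live D).
  have e : \sum_(x in L) weight x = \sum_(x in L) weight (eps x).
    rewrite (reindex_inj (@perm_inj _ eps)) /=; apply: eq_bigl => x.
    by rewrite !inE (dg_inv D) eq_sym.
  have -> : 2 * \sum_(x in L) weight x = \sum_(x in L) weight x + \sum_(x in L) weight (eps x).
    by rewrite -e; ring.
  rewrite -big_split /= (eq_bigr (fun=> pi)) ?sumr_const ?mulr_natr //.
  by move=> x; rewrite inE => lx; exact: weight_pair.
have c4 : (#|L| + 4 <= 2 * (#|orbits_of eta Li| + 1 + (#|orbits_of th P0| + size os)))%N by lia.
rewrite -(ler_nat R) in c4; rewrite !(natrD, natrM) in c4.
rewrite -[_ *+ #|orbits_of eta Li|]mulr_natr in b1; rewrite -[_ *+ #|_|]mulr_natr in b2.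
have -> : \sum_(o <- os) (2 * pi - pi / 2 * #|porbit th o|%:R - weight o) =
    2 * pi * (size os)%:R - pi / 2 * \sum_(o <- os) #|porbit th o|%:R - \sum_(o <- os) weight o.
  by rewrite !sumrB big_const_seq count_predT iter_addr addr0 -[_ *+ size os]mulr_natr mulr_sumr.
move: b1 b2 c3 sL c4; set l := #|L|%:R; set a := (#|orbits_of eta Li|)%:R.
set b := (#|orbits_of th P0|)%:R; set m := (size os)%:R.
set s1 := \sum_(x in Li) _; set s2 := \sum_(x in P0) _; set s3 := \sum_(o <- os) _%:R.
set s4 := \sum_(o <- os) weight o => b1 b2 c3 sL c4.
have k1 : pi * (l + 4) <= pi * (2 * (a + 1 + (b + m))) by rewrite ler_pM2l.
have k2 : pi * (4 * b) <= pi * (l - s3) by rewrite ler_pM2l //; lra.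
by lra.
Qed.

End GaussBonnet.

(** * Straight galleries *)

Section Straight.
Local Open Scope ring_scope.
Variables (E S : finType) (nxt : S -> S) (bd : S -> E * bool).
Variables (R : realFieldType) (pi : R) (alpha : S -> R).
Local Notation meets := (meets nxt bd).
Local Notation lside := (lside nxt).
Local Notation ldart := (ldart nxt bd).
Hypothesis nxtI : injective nxt.
Hypothesis pi_gt0 : 0 < pi.
Hypothesis nxt3 : forall s, nxt (nxt (nxt s)) = s.
Hypothesis nxt_neq : forall s, nxt s != s.
Hypothesis alpha_gt0 : forall s, 0 < alpha s.
Hypothesis alpha_sum : forall s, alpha s + alpha (nxt s) + alpha (nxt (nxt s)) = pi.
Hypothesis link_long : forall a r,
  path (fun a b => (ldart b == ldart (linv a)) && (b != linv a)) a r ->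
  ldart a = ldart (linv (last a r)) ->
  2 * pi <= \sum_(x <- a :: r) alpha x.1.

(* A gallery crossing triangles: [p t] is the corner cut at time [t], lying to
   the left of the gallery if [dl t] and to its right otherwise, and [X] is
   the total turning, which stays in an interval of length [pi]. *)
Variables (p : nat -> S * bool) (dl : nat -> bool) (X : nat -> R).
Hypothesis p_side : forall t, lside (p t.+1) != lside (linv (p t)).
Hypothesis p_dl : forall t,
  dl t.+1 = dl t (+) ((ldart (p t.+1)).2 (+) (ldart (linv (p t))).2).
Hypothesis X_step : forall t,
  X t.+1 = if dl t then X t + alpha (p t).1 else X t - alpha (p t).1.
Hypothesis X_gt0 : forall t, 0 < X t.
Hypothesis X_lt : forall t, X t < pi.

(* The bound of [gauss_bonnet] at the letter of time [t] is at most the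
   variation of [X], up to sign, and the sign [s t] can only change at the
   cost of [pi]. *)
Lemma gallery_turning i (T : finType) (eps eta : {perm T}) lab kd os w :
    diagram (@linv S) meets eps eta lab kd os w ->
    (forall x, eps x != x -> x \notin os -> eps x \notin os -> kd (eps x) = ~~ kd x) ->
    (forall x, eps x != x -> x \notin os -> lab (eta x) != linv (lab x)) ->
    {in os, forall x, eps x \notin os} ->
    {in os &, forall x y, y \in porbit (eps * eta)%g x -> x = y} ->
  w = map p (iota i (size w)) -> w != [::] -> False.
Proof.
move=> D alt red oi osimp Ew w0.
have szw : size os = size w by rewrite -(dg_word D) size_map.
have os0 : os != [::] by rewrite -size_eq0 szw size_eq0.
case Eos : os (os0) => [//|o0 os1] _.
pose o t := nth o0 os t.
have oin t : (t < size os)%N -> o t \in os by move=> h; exact: mem_nth.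
have labo t : (t < size os)%N -> lab (o t) = p (i + t)%N.
  move=> h; have e : nth (p 0%N) (map lab os) t = nth (p 0%N) (map p (iota i (size os))) t.
    by rewrite (dg_word D) szw -Ew.
  by move: e; rewrite (nth_map o0) // (nth_map 0%N) ?size_iota // nth_iota.
have eta_o t : (t.+1 < size os)%N -> eta (o t) = o t.+1.
  move=> h; have ht := ltnW h.
  rewrite (eqP (next_cycle (dg_os D) (oin _ ht))) next_nth oin // Eos.
  move: h (dg_uniq D); rewrite /o Eos => h uo.
  by rewrite index_uniq //; exact: ltnW.
have prev_o t : (t.+1 < size os)%N -> prevo eta (o t.+1) = o t.
  by move=> h; rewrite /prevo -eta_o // permK.
pose A t := kd (eps (o t)).
(* The sign with which the variation of [X] at time [t] enters the boundary term [G]. *)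
pose s t := dl (i + t)%N (+) A t.
pose G x := 2 * pi - pi / 2 * #|porbit (eps * eta)%g x|%:R - weight eps lab kd os pi alpha x.
have GB := gauss_bonnet nxtI D alt red oi osimp pi_gt0 nxt3 nxt_neq alpha_gt0 alpha_sum link_long os0.
rewrite -/G (big_nth o0) /= in GB.
have wtE t : (t < size os)%N -> weight eps lab kd os pi alpha (o t) =
    if A t then alpha (p (i + t)%N).1 else pi - alpha (p (i + t)%N).1.
  by move=> h; rewrite /weight oin // labo.
pose last_A := kd (eps (prevo eta (o 0%N))).
pose br (b : bool) : R := if b then 1 else 0.
have szO t : (t < size os)%N ->
    let B := kd (eps (prevo eta (o t))) in
    exists nf : nat, [/\ #|porbit (eps * eta)%g (o t)|%:R = 2 * nf%:R + 2 - br (A t) - br B,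
      A t || B -> (0 < nf)%N,
      lside (lab (o t)) != lside (linv (lab (prevo eta (o t)))) -> A t && B -> (1 < nf)%N
      & odd nf = (ldart (lab (o t))).2 (+) (ldart (linv (lab (prevo eta (o t))))).2].
  move=> ht B; have [h1 h2 h3 h4 h5] := node_outer nxtI D alt red oi osimp (oin _ ht).
  exists (nface kd os (porbit (eps * eta)%g (o t))); split=> //.
  rewrite h1 -addn1 !natrD; have := congr1 (fun n => n%:R : R) h2.
  rewrite -[(nface _ _ _).+1]addn1 !natrD /br -/(A t) -/B.
  by case: (A t); case: B => /=; lra.
have Gstep t : (t.+1 < size os)%N -> G (o t.+1) <=
    (if s t.+1 then X (i + t.+1)%N.+1 - X (i + t.+1)%N else X (i + t.+1)%N - X (i + t.+1)%N.+1)
    + pi / 2 * (br (A t.+1) - br (A t)) - pi * br (s t.+1 (+) s t).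
  move=> ht; have [nf [h1 h2 h3 h4]] := szO _ ht.
  rewrite /G wtE // h1; rewrite prev_o // in h2 h3 h4 *; rewrite -/(A t) in h2 h3 *.
  have ht' := ltnW ht.
  rewrite !labo // addnS in h3 h4 *; have {}h3 := h3 (p_side _).
  (* By [p_side], two triangle cells at the extremities of the fan are distinct; a change of sign
     alters the parity and so requires one more triangle cell. *)
  have hn : (nat_of_bool (A t.+1) + A t + (s t.+1 (+) s t) <= nf)%N.
    have : odd nf = (A t.+1 (+) A t) (+) (s t.+1 (+) s t).
      rewrite h4 /s addnS p_dl; set x1 := (ldart _).2; set x2 := (ldart _).2.
      by case: x1; case: x2; case: (dl _); case: (A _); case: (A _).
    move: (A t.+1) (A t) (_ (+) s t) h2 h3 => a b c; clear.
    by case: nf => [|[|[|nf]]]; case: a; case: b; case: c => //= h2 h3 ho; try exact: h2; try exact: h3.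
  have hR : br (A t.+1) + br (A t) + br (s t.+1 (+) s t) <= nf%:R.
    rewrite -(ler_nat R) !natrD in hn; move: hn; rewrite /br.
    by case: (A t.+1); case: (A t); case: (s t.+1 (+) s t).
  have hp : pi * (br (A t.+1) + br (A t) + br (s t.+1 (+) s t)) <= pi * nf%:R.
    by rewrite ler_pM2l.
  rewrite X_step; have -> : dl (i + t)%N.+1 = s t.+1 (+) A t.+1.
    by rewrite /s addnS -addbA addbb addbF.
  move: hp; rewrite /br; case: (A t.+1); case: (s t.+1); case: (A t); case: (s t) => /=; lra.
(* The stretch need not continue straight where it closes up. At that node only one triangle cell
   less is guaranteed, and nothing about signs; this costs the additional [pi]. *)
have G0 : G (o 0%N) <= pi +
    (if s 0%N then X (i + 0)%N.+1 - X (i + 0)%N else X (i + 0)%N - X (i + 0)%N.+1)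
    + pi / 2 * (br (A 0%N) - br last_A).
  have h0 : (0 < size os)%N by rewrite Eos.
  have [nf [h1 h2 _ _]] := szO _ h0; rewrite -/last_A in h1 h2.
  rewrite /G wtE // h1; have hp : pi * (br (A 0%N) + br last_A) <= pi * (1 + nf%:R).
    rewrite ler_pM2l //; have : (nat_of_bool (A 0%N) + last_A <= 1 + nf)%N.
      by move: h2; case: (A 0%N); case: (last_A) => //= h2; have := h2 isT; lia.
    by rewrite -(ler_nat R) !natrD /br; case: (A 0%N); case: (last_A).
  rewrite X_step; have -> : dl (i + 0)%N = s 0%N (+) A 0%N.
    by rewrite /s -addbA addbb addbF.
  move: hp; rewrite /br; case: (A 0%N); case: (s 0%N); case: (last_A) => /=; lra.
(* The terms telescope. A change of sign exchanges the bounds [X] and [pi - X], and the [pi] that it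
   costs covers the difference because [X] stays in ]0, pi[. *)
have part k : (k < size os)%N -> \sum_(0 <= t < k.+1) G (o t) <=
    pi + pi / 2 * (br (A k) - br last_A) +
    (if s k then X (i + k)%N.+1 else pi - X (i + k)%N.+1).
  elim: k => [|k IH] hk.
    rewrite big_nat1; apply: le_trans G0 _.
    by have := X_gt0 (i + 0)%N; have := X_lt (i + 0)%N; case: (s 0%N); lra.
  rewrite big_nat_recr //=; have := IH (ltnW hk); have := Gstep _ hk.
  have := X_gt0 (i + k.+1)%N; have := X_lt (i + k.+1)%N.
  rewrite /br !addnS; case: (s k.+1); case: (s k) => /=; lra.
have hl : ((size os).-1 < size os)%N by rewrite Eos.
have := part _ hl; rewrite prednK; last by rewrite Eos.
have -> : last_A = A (size os).-1.
  rewrite /last_A /A; congr (kd (eps _)).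
  have -> : o 0%N = eta (o (size os).-1); last by rewrite /prevo permK.
  rewrite (eqP (next_cycle (dg_os D) (oin _ hl))) next_nth oin // Eos.
  move: (dg_uniq D); rewrite /o Eos => uo.
  have hl' : ((size (o0 :: os1)).-1 < size (o0 :: os1))%N by [].
  have ix : index (nth o0 (o0 :: os1) (size (o0 :: os1)).-1) (o0 :: os1) = size os1.
    by rewrite index_uniq.
  by rewrite ix [RHS]nth_default.
have := X_gt0 (i + (size os).-1).+1; have := X_lt (i + (size os).-1).+1.
rewrite subrr mulr0; move: GB; rewrite (eq_bigr (fun t => G (o t))) //.
by case: (s _); lra.
Qed.

(** Induction on the length of the stretch, then on the number of live letters. The stretch is
    arbitrary, without any closing condition, because an arc cut off at a double point of the outer
    cell is again a stretch of the gallery. *)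
Lemma no_gallery_diagram m i (T : finType) (eps eta : {perm T}) lab kd os :
  (0 < m)%N -> diagram (@linv S) meets eps eta lab kd os (map p (iota i m)) -> False.
Proof.
elim/ltn_ind: m i T eps eta lab kd os => m IHm i T eps eta lab kd os m0.
have [k] := ubnP (live eps); elim: k => // k IHk in eps eta *; rewrite ltnS => lk D.
have szo : size os = m by have := congr1 size (dg_word D); rewrite !size_map size_iota.
have simp : {in os &, forall x y, y \in porbit (eps * eta)%g x -> x = y}.
  have sep A y B y' C : os = A ++ y :: B ++ y' :: C -> y' \in porbit (eps * eta)%g y -> False.
    move=> Eos h; have D' := D; rewrite Eos in D'.
    have [eps' [eta' D2]] := split_outer D' h.
    have : map lab (y :: B) = map p (iota (i + size A) (size B).+1).
      have := dg_word D'; rewrite map_cat.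
      have -> : m = (size A + ((size B).+1 + (size C).+1))%N.
        by rewrite -szo Eos size_cat /= size_cat /=.
      rewrite iotaD map_cat => /eqP; rewrite eqseq_cat; last by rewrite !size_map size_iota.
      case/andP => _; rewrite -cat_cons map_cat iotaD map_cat eqseq_cat.
        by case/andP => /eqP.
      by rewrite !size_map size_iota.
    move=> E'; rewrite E' in D2; apply: (IHm _ _ _ _ _ _ _ _ _ _ D2) => //.
    by rewrite -szo Eos size_cat /= size_cat /=; lia.
  move=> x y xo yo h; apply/eqP; apply/negP => /negP xy.
  case/splitPr: xo (sep) yo => A C sep'; rewrite mem_cat inE eq_sym (negbTE xy) /=.
  case/orP => yo; case/splitPr: yo sep' => B B' sep'.
    by apply: (sep' B y B' x C); [rewrite -catA | rewrite porbit_sym].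
  by apply: (sep' A x B y B').
(* If both letters of an edge were outer, simplicity would reduce the outer word to these two
   inverse letters: the gallery would turn back, against [p_side]. *)
have inner : {in os, forall x, eps x \notin os}.
  move=> x xo; apply/negP => eo.
  have e1 : eta (eps x) = x.
    apply/esym/simp => //; first exact: (fcycle_mem (dg_os D)).
    by rewrite -permM -eq_porbit_mem porbit_step.
  have e2 : eta x = eps x.
    apply/esym/simp => //; first exact: (fcycle_mem (dg_os D)).
    by have := mem_porbit (eps * eta)%g 1 (eps x); rewrite expg1 permM (dg_inv D).
  have lx := dg_live D xo.
  have [t [Eo Ee]] : exists t, os = [:: t; eps t] /\ eps t != t.
    have [j s Er] := rot_to xo.
    have := dg_os D; rewrite -(rot_cycle j) Er.
    have uo := dg_uniq D; rewrite -(rot_uniq j) Er in uo.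
    case: s Er uo => [|y [|z s]] Er uo /=.
    - by rewrite andbT e2 => /eqP e; rewrite e eqxx in lx.
    - case/andP => /eqP ey _; rewrite -ey e2 in Er.
      have : os = rotr j [:: x; eps x] by rewrite -Er rotK.
      have [->|->] : rotr j [:: x; eps x] = [:: x; eps x] \/ rotr j [:: x; eps x] = [:: eps x; x].
      + by rewrite /rotr; case: (size _ - j)%N => [|[|[|n]]] /=; [left|right|left|left].
      + by exists x.
      + by exists (eps x); rewrite (dg_inv D) eq_sym.
    case/and3P => /eqP ey /eqP ez _; move: uo; rewrite -ez -ey e2 e1 /=.
    by rewrite !inE eqxx orbT.
  have m2 : m = 2 by rewrite -szo Eo.
  have := dg_word D; rewrite Eo m2 /= (dg_lab D Ee) => -[h1 h2].
  by have := p_side i; rewrite -h2 h1 eqxx.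
case: (boolP [exists x, [&& eps x != x, x \notin os & lab (eta x) == linv (lab x)]]).
  case/existsP => x /and3P [lx xo /eqP e].
  have [eps' [eta' [D' l]]] := fold_cell (@linvK S) (@linv_neq S) (@meets_trans _ _ nxt bd) D lx xo e.
  exact: (IHk _ _ (leq_trans l lk) D').
rewrite negb_exists => /forallP nored.
have red x : eps x != x -> x \notin os -> lab (eta x) != linv (lab x).
  by move=> lx xo; have := nored x; rewrite lx xo.
case: (boolP [exists x, [&& eps x != x, x \notin os, eps x \notin os & kd (eps x) == kd x]]).
  case/existsP => x /and4P [lx xo eo /eqP e].
  have h : eta (eps x) != x.
    have := red _ (dg_liveE D lx) eo; apply: contra_neq => ->.
    by rewrite (dg_lab D lx) linvK.
  have [eps' [eta' [D' l]]] := delete_edge (@linvK S) (@meets_trans _ _ nxt bd) D lx xo eo e h.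
  exact: (IHk _ _ (leq_trans l lk) D').
rewrite negb_exists => /forallP alt.
apply: (gallery_turning D _ red inner simp) => //.
- by move=> x lx xo eo; have := alt x; rewrite lx xo eo /=; case: (kd _); case: (kd _).
- by rewrite size_map size_iota.
- by rewrite -size_eq0 size_map size_iota -lt0n.
Qed.

End Straight.

(** * Walks and potentials *)

Section Walks.
Variables (D A : eqType) (s t : A -> D).

Fixpoint walk (x : D) (r : seq A) (y : D) : bool :=
  if r is a :: r' then (s a == x) && walk (t a) r' y else x == y.

Lemma walk_trans x y z r r' : walk x r y -> walk y r' z -> walk x (r ++ r') z.
Proof. by elim: r x => [|a r IH] x /= => [/eqP -> //|/andP [-> /IH h] /h]. Qed.

Lemma walk_rcons x r a y : walk x (rcons r a) y = walk x r (s a) && (t a == y).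
Proof. by elim: r x => [|b r IH] x /=; rewrite 1?eq_sym // IH andbA. Qed.

Lemma walk_cycle x r : walk x r x -> path.cycle (fun a b => s b == t a) r.
Proof.
case: r => //= a r /andP [/eqP <-].
have : walk (t a) r (s a) -> path (fun a b => s b == t a) a (rcons r a).
  elim: r {1 3}a => [|b r IH] c /=; first by rewrite eq_sym andbT.
  by case/andP => -> /IH.
by [].
Qed.

Lemma walk_rev (inv : A -> A) x r y :
    (forall a, s (inv a) = t a) -> (forall a, t (inv a) = s a) ->
  walk x r y -> walk y (rev (map inv r)) x.
Proof.
move=> si ti; elim: r x => [|a r IH] x /=; first by rewrite eq_sym.
by case/andP => /eqP <- /IH; rewrite rev_cons walk_rcons si ti eqxx andbT.
Qed.
End Walks.

(** The labelling is integrated from a base point in each component along chosen walks; closed walks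
    having trivial product, the choice does not matter. *)
Lemma potential (D A : finType) (s t : A -> D) (inv : A -> A) (G : groupType) (f : A -> G) :
    (forall a, s (inv a) = t a) -> (forall a, t (inv a) = s a) ->
    (forall a, f (inv a) = (f a)^-1)%g ->
    (forall x r, walk s t x r x -> \prod_(a <- r) f a = 1)%g ->
  exists u : D -> G, forall a, (u (s a) * f a = u (t a))%g.
Proof.
move=> si ti fi cl.
pose e : rel D := fun x y => [exists a, (s a == x) && (t a == y)].
have eE a : e (s a) (t a) by apply/existsP; exists a; rewrite !eqxx.
have es : symmetric e.
  by move=> x y; apply/existsP/existsP => -[a /andP [/eqP <- /eqP <-]];
    exists (inv a); rewrite si ti !eqxx.
have cs : connect_sym e.
  exact: connect_sym_sym.
have cw x y : connect e x y -> exists r, walk s t x r y.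
  case/connectP => p; elim: p x => [|z p IH] x /= => [_ ->|/andP [/existsP [a /andP [/eqP sa /eqP ta]] zp] l].
    by exists [::] => /=.
  have [r hr] := IH _ zp l; exists (a :: r) => /=.
  by rewrite sa ta eqxx.
have /choice [w hw] : forall x, exists r, walk s t (fingraph.root e x) r x.
  by move=> x; apply: cw; rewrite cs; exact: connect_root.
exists (fun x => \prod_(a <- w x) f a)%g => a.
have rE : fingraph.root e (s a) = fingraph.root e (t a) by apply/eqP; rewrite fingraph.root_connect // connect1.
have h : walk s t (fingraph.root e (s a)) (rcons (w (s a)) a ++ rev (map inv (w (t a)))) (fingraph.root e (s a)).
  apply: walk_trans (_ : walk _ _ _ _ (t a)) _; first by rewrite walk_rcons hw eqxx.
  by apply: walk_rev => //; rewrite rE hw.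
have := cl _ _ h; rewrite big_cat -cats1 big_cat big_seq1 /=.
have fr r : (\prod_(b <- rev (map inv r)) f b = (\prod_(b <- r) f b)^-1)%g.
  elim: r => [|b r IH]; first by rewrite !big_nil invg1.
  by rewrite /= rev_cons -cats1 big_cat IH big_seq1 big_cons fi invgM.
by rewrite fr => /(canRL (mulgK _)); rewrite mul1g invgK.
Qed.

Section Systems.
Variables (V E S : finType) (src : E * bool -> V) (nxt : S -> S) (bd : S -> E * bool).

(** A system made from a partly collapsed complex keeps the whole type [E]; asking for a side over
    the edge confines paths to edges that are still there. *)
Definition bd_edges (x : E * bool) := exists s, (bd s).1 = x.1.

(* Simple connectivity, tested by labellings of the darts in arbitrary groups.
   Here [g] is a primitive of [T] along the boundary of each polygon, so that
   [T] has trivial product around it. *)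
Definition sc_system := forall (G : groupType) (T : E * bool -> G) (g : S -> G),
  (forall d, T (flip d) = (T d)^-1)%g ->
  (forall s, g s * T (bd s) = g (nxt s))%g ->
  forall v r, walk src (src \o @flip E) v r v -> {in r, forall d, bd_edges d} ->
  (\prod_(d <- r) T d = 1)%g.

Definition closed_system := forall s, src (flip (bd s)) = src (bd (nxt s)).
End Systems.

Lemma pigeonhole (A : finType) (f : nat -> A) : exists i m, 0 < m /\ f i = f (i + m).
Proof.
have : ~~ injectiveb (fun i : 'I_#|A|.+1 => f i).
  by apply/injectiveP => /leq_card; rewrite card_ord ltnn.
case/injectivePn => i [j ij e]; have {}ij : (i : nat) <> j by move=> h; case/eqP: ij; apply: val_inj.
case: (ltnP i j) => h; [exists i, (j - i)|exists j, (i - j)]; split; try lia.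
  by rewrite (subnKC (ltnW h)).
by rewrite subnKC.
Qed.

(** * Closed galleries bound diagrams *)

Section Holonomy.
Variables (V E S : finType) (src : E * bool -> V) (nxt : S -> S) (bd : S -> E * bool).
Local Notation meets := (meets nxt bd).
Local Notation lside := (lside nxt).
Local Notation ldart := (ldart nxt bd).
Hypothesis closed : closed_system src nxt bd.
Hypothesis sc : sc_system src nxt bd.
Local Open Scope group_scope.

(** Letters are evaluated in the group of words modulo fillability. As both kinds of relators are
    trivial there, this labelling has a potential [u] on ends of edges and a potential [h] on sides.
    The quotient of [u] at the two ends of an edge labels the darts, with a primitive along every
    polygon, hence is trivial on loops. Pushing the gallery towards the vertices of its corners
    makes it such a loop, and the two products are conjugate. *)
Lemma closed_gallery_fillable (p : nat -> S * bool) i m :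
    (forall t, (ldart (p t.+1)).1 = (ldart (linv (p t))).1) ->
    (0 < m)%N -> p i = p (i + m)%N ->
  fillable (@linv S) meets (map p (iota i m)).
Proof.
move=> pe m0 pm.
pose C := fill_congruence (@linvK S) (@meets_refl _ _ nxt bd) (@meets_sym _ _ nxt bd) (p 0).
pose G := word_group C; pose f (a : S * bool) : G := wpi C [:: a].
have fw r : \prod_(a <- r) f a = wpi C r.
  elim: r => [|a r IH]; first by rewrite big_nil -wpi_nil.
  by rewrite big_cons IH -wpi_cat.
have fr k r : relator (@linv S) meets k r -> \prod_(a <- r) f a = 1.
  by move=> h; rewrite fw -wpi_nil; apply/wpi_eq; exact: (fill_eqv_relator (@linvK S) (@meets_sym _ _ nxt bd) (p 0) h).
have fV a : f (linv a) = (f a)^-1.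
  have := fr true _ (relator_spur (@linvK S) (@meets_refl _ _ nxt bd) true a).
  by rewrite big_cons big_seq1 => e; apply: (mulgI (f a)); rewrite mulgV.
have [u hu] : exists u : E * bool -> G, forall a, u (ldart a) * f a = u (ldart (linv a)).
  apply: (@potential _ _ ldart (ldart \o @linv S) (@linv S)) => //= [a|x r h]; first by rewrite linvK.
  by apply: (fr false); exact: walk_cycle h.
have [h hh] : exists h : S -> G, forall a, h (lside a) * f a = h (lside (linv a)).
  apply: (@potential _ _ lside (lside \o @linv S) (@linv S)) => //= [a|x r h]; first by rewrite linvK.
  by apply: (fr true); exact: walk_cycle h.
pose T d := u d * (u (flip d))^-1; pose g s := h s * (u (bd s))^-1.
have TV d : T (flip d) = (T d)^-1 by rewrite /T flipK invgM invgK.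
have gT s : g s * T (bd s) = g (nxt s).
  have := hu (s, false); have := hh (s, false); rewrite /lside /ldart /= => h1 h2.
  rewrite /g /T mulgA mulgVK -h1 -h2 invgM; rewrite !mulgA mulgK.
  by [].
have sd a : src (ldart a) = src (ldart (linv a)).
  by case: a => c []; rewrite /ldart /= closed.
have carry a : bd_edges bd (ldart a).
  by exists (lside a); rewrite ldart_edge.
have key k : exists r, [/\ walk src (src \o @flip E) (src (ldart (p i))) r (src (ldart (p (i + k)%N))),
    {in r, forall d, bd_edges bd d}
  & \prod_(a <- map p (iota i k)) f a = (u (ldart (p i)))^-1 * (\prod_(d <- r) T d) * u (ldart (p (i + k)%N))].
  elim: k => [|k [r [hr cr er]]].
    by exists [::]; rewrite addn0 /= eqxx !big_nil mulg1 mulVg.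
  rewrite -addn1 iotaD map_cat big_cat er /= big_seq1 addn1 addnS.
  have e1 : (ldart (p (i + k).+1)%N).1 = (ldart (linv (p (i + k)%N))).1 by rewrite pe.
  set d := ldart (linv (p (i + k)%N)) in e1.
  have us : u (ldart (p (i + k)%N)) * f (p (i + k)%N) = u d by rewrite hu.
  rewrite -mulgA us.
  (* The next corner lies at the same end of the edge, and the path waits, or at the other end, and
     the path follows the edge. *)
  have [e2|e2] : ldart (p (i + k).+1)%N = d \/ ldart (p (i + k).+1)%N = flip d.
    move: e1; case: (ldart _) => e b; case: (d) => e' b' /= ->; rewrite /flip /=.
    by case: b; case: b'; [left|right|right|left].
  - by exists r; split=> //; rewrite e2 // /d -sd.
  exists (rcons r d); split.
  - by rewrite walk_rcons /= /d -sd hr e2 eqxx.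
  - by move=> x; rewrite mem_rcons inE => /orP [/eqP ->|/cr //]; exact: carry.
  rewrite -cats1 big_cat big_seq1 /= e2 /T !mulgA mulgVK; by rewrite -!mulgA.
apply: (@fill_group_fillable _ _ _ (@linvK S) (@meets_refl _ _ nxt bd) (@meets_sym _ _ nxt bd) (p 0)); first by case: (m) m0.
have [r [hr cr er]] := key m.
rewrite -pm in hr er; rewrite (sc TV gT hr cr) mulg1 mulVg in er.
by rewrite -er fw.
Qed.
End Holonomy.

(** * A gallery with bounded turning *)

Section Triangles.
Variables (V E S : finType) (src : E * bool -> V) (nxt : S -> S) (bd : S -> E * bool).
Variables (R : realFieldType) (pi : R) (alpha : S -> R).
Local Notation lside := (lside nxt).
Local Notation ldart := (ldart nxt bd).
Local Open Scope ring_scope.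

(* Closed link walks may backtrack at their base point. *)
Definition link_condition_system :=
  forall a r, path (fun a b => (ldart b == ldart (linv a)) && (b != linv a)) a r ->
  ldart a = ldart (linv (last a r)) -> 2 * pi <= \sum_(x <- a :: r) alpha x.1.

Hypothesis closed : closed_system src nxt bd.
Hypothesis sc : sc_system src nxt bd.
Hypothesis pi_gt0 : 0 < pi.
Hypothesis nxt3 : forall s, nxt (nxt (nxt s)) = s.
Hypothesis nxt_neq : forall s, nxt s != s.
Hypothesis alpha_gt0 : forall s, 0 < alpha s.
Hypothesis alpha_sum : forall s, alpha s + alpha (nxt s) + alpha (nxt (nxt s)) = pi.
Hypothesis link_long : link_condition_system.
Hypothesis no_free : forall s, exists2 s', s' != s & (bd s').1 = (bd s).1.

(** The corner being cut, whether it lies on the left, and the turning before it is counted; [turn]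
    is the turning after. *)
Let state : Type := ((S * bool) * bool * R)%type.
Let turn (x : state) : R := if x.1.2 then x.2 + alpha x.1.1.1 else x.2 - alpha x.1.1.1.
Let good (x : state) := (0 < x.2 < pi) && (0 < turn x < pi).
Let step (x y : state) := [/\ lside y.1.1 != lside (linv x.1.1),
  (ldart y.1.1).1 = (ldart (linv x.1.1)).1,
  y.1.2 = x.1.2 (+) ((ldart y.1.1).2 (+) (ldart (linv x.1.1)).2) & y.2 = turn x].

(** The corners at the two ends of the new side [q'] lie on opposite sides of the gallery. If adding
    the left angle would reach [pi], the turning is at least [pi] minus this angle, which exceeds
    the right angle, so the latter can be subtracted. *)
Lemma straight_step x : good x -> exists y, good y /\ step x y.
Proof.
case/andP => _ tx; set q := lside (linv x.1.1).
have [q' nq eq] := no_free q.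
pose c1 := (q', false); pose c2 := (nxt (nxt q'), true).
have ls : (lside c1 = q') * (lside c2 = q') by rewrite /lside /= nxt3.
have le : ((ldart c1).1 = (ldart (linv x.1.1)).1) * ((ldart c2).1 = (ldart (linv x.1.1)).1).
  by rewrite !ldart_edge !ls -/q eq.
have l2 : (ldart c1).2 = ~~ (ldart c2).2 by rewrite /ldart /= nxt3.
have [cT [cF [sT [sF [eT [eF [dT [dF asum]]]]]]]] : exists cT cF,
    lside cT = q' /\ lside cF = q' /\ (ldart cT).1 = (ldart (linv x.1.1)).1 /\
    (ldart cF).1 = (ldart (linv x.1.1)).1 /\
    x.1.2 (+) ((ldart cT).2 (+) (ldart (linv x.1.1)).2) = true /\
    x.1.2 (+) ((ldart cF).2 (+) (ldart (linv x.1.1)).2) = false /\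
    alpha cT.1 + alpha cF.1 < pi.
  have := alpha_sum q'; have := alpha_gt0 (nxt q'); rewrite /= => h1 h2.
  case E1 : (x.1.2 (+) ((ldart c1).2 (+) (ldart (linv x.1.1)).2)).
    exists c1, c2; rewrite !ls !le E1; do 5 (split=> //); split.
      by move: E1; rewrite l2; do 3 case: (_.2).
    by rewrite /=; lra.
  exists c2, c1; rewrite !ls !le E1; do 4 (split=> //); split.
    by move: E1; rewrite l2; do 3 case: (_.2).
  by split=> //=; lra.
have := alpha_gt0 cT.1; have := alpha_gt0 cF.1 => pF pT.
case: (ltP (turn x + alpha cT.1) pi) => h.
  exists (cT, true, turn x); rewrite /good /step /= tx sT nq eT dT.
  rewrite /turn /= -/(turn x); split=> //; apply/andP; split=> //.
  by case/andP: tx => t0 _; lra.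
exists (cF, false, turn x); rewrite /good /step /= tx sF nq eF dF.
rewrite /turn /= -/(turn x); split=> //; case/andP: tx => t0 t1.
by apply/andP; split; lra.
Qed.

Lemma no_triangle_system : S -> False.
Proof.
move=> s0.
have /choice [nx nxP] : forall x, exists y, good x -> good y /\ step x y.
  move=> x; case: (boolP (good x)) => gx; last by exists x.
  by have [y hy] := straight_step gx; exists y.
(* This puts the turnings before and after the initial corner symmetrically about [pi / 2]. *)
pose x0 : state := ((s0, false), true, (pi - alpha s0) / 2).
pose st t := iter t nx x0.
have a0 := alpha_gt0 s0; have s0s := alpha_sum s0.
have a1 := alpha_gt0 (nxt s0); have a2 := alpha_gt0 (nxt (nxt s0)).
have g0 : good x0.
  by rewrite /good /turn /=; apply/andP; split; apply/andP; split; lra.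
have gs t : good (st t) by elim: t => // t IH; rewrite /st iterS; case: (nxP _ IH).
have ss t : step (st t) (st t.+1) by rewrite /st iterS; case: (nxP _ (gs t)).
pose p t := (st t).1.1.
have [i [m [m0 pm]]] := pigeonhole p.
have pe t : (ldart (p t.+1)).1 = (ldart (linv (p t))).1 by case: (ss t).
have [T [eps [eta [lab [kd [os [D _]]]]]]] := closed_gallery_fillable closed sc pe m0 pm 0%N.
have nxtI : injective nxt by move=> x y e; rewrite -(nxt3 x) e nxt3.
apply: (no_gallery_diagram nxtI pi_gt0 nxt3 nxt_neq alpha_gt0 alpha_sum link_long
  (dl := fun t => (st t).1.2) (X := fun t => (st t).2) _ _ _ _ _ m0 D) => t.
- by case: (ss t).
- by case: (ss t).
- by case: (ss t).
- by case/andP: (gs t) => /andP [].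
- by case/andP: (gs t) => /andP [].
Qed.
End Triangles.

(** * Cutting ears *)

(** The angle sum [(n - 2) pi] in terms of exterior angles, which frees it from the number of
    sides. *)
Definition polygons (S : eqType) (nxt : S -> S) (R : realFieldType) (pi : R) (alpha : S -> R) :=
  (forall s, exists c, [/\ uniq c, s \in c, fcycle nxt c & \sum_(x <- c) (pi - alpha x) = 2 * pi])%R.

Section Ear.
Variables (V E S : finType) (src : E * bool -> V) (nxt : S -> S) (bd : S -> E * bool).
Hypothesis nxtI : injective nxt.
Variable r : S.
Let s := nxt r.
Let t := nxt s.
Let u := nxt t.
Hypotheses (rs : r != s) (rt : r != t) (st : s != t) (us : u != s) (ut : u != t).

(* The triangle with sides [s], [t] is cut off along a new edge [None], whose
   two sides are [inr true] (in the triangle) and [inr false] (in the rest). *)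
Definition ear_src (d : option E * bool) : V :=
  if d.1 is Some e then src (e, d.2) else
  if d.2 then src (flip (bd t)) else src (bd s).
Definition ear_bd (x : S + bool) : option E * bool :=
  match x with inl x => (Some (bd x).1, (bd x).2) | inr b => (None, b) end.
Definition ear_nxt (x : S + bool) : S + bool :=
  match x with
  | inl x => if x == t then inr true else if x == r then inr false else inl (nxt x)
  | inr true => inl s
  | inr false => inl u
  end.

Lemma ear_closed : closed_system src nxt bd -> closed_system ear_src ear_nxt ear_bd.
Proof.
move=> cl [x|[]] /=; rewrite /ear_src /=.
- case: (x =P t) => [->//|_]; case: (x =P r) => [->|_] /=.
    by have := cl r; rewrite /flip.
  by have := cl x; rewrite /flip /= -surjective_pairing.
- by rewrite -surjective_pairing.
- by rewrite -surjective_pairing; exact: cl.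
Qed.

Lemma ear_no_free : (forall x, exists2 x', x' != x & (bd x').1 = (bd x).1) ->
  forall x, exists2 x', x' != x & (ear_bd x').1 = (ear_bd x).1.
Proof.
move=> nf [x|b]; last by exists (inr (~~ b)); case: b.
by have [x' n e] := nf x; exists (inl x') => //=; rewrite e.
Qed.

Let ext (d : E * bool) : option E * bool := (Some d.1, d.2).
Let shrink (d : option E * bool) : seq (E * bool) :=
  if d.1 is Some e then [:: (e, d.2)] else
  if d.2 then [:: flip (bd t); flip (bd s)] else [:: bd s; bd t].

(** The triangle forces the label of the diagonal to be the product along [s] and [t]. A path can
    therefore be rerouted through these two sides without changing its product, into the old
    system. *)
Lemma ear_sc : closed_system src nxt bd -> sc_system src nxt bd -> sc_system ear_src ear_nxt ear_bd.
Proof.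
move=> cl sc G T g TV gT v w wv we.
have Tst : (T (ext (bd s)) * T (ext (bd t)))%g = T (None, false).
  have := gT (inl s); rewrite /= (negbTE st) [s == r]eq_sym (negbTE rs) -/t => h1.
  have := gT (inl t); rewrite /= eqxx => h2.
  have := gT (inr true); rewrite /= => h3.
  have -> : T (None, false) = (T (None, true))^-1%g by rewrite -TV.
  have e1 : (g (inl s) * T (ext (bd s)) = g (inl t))%g := h1.
  have e2 : (g (inl t) * T (ext (bd t)) = g (inr true))%g := h2.
  by apply: (mulgI (g (inl s))); rewrite mulgA e1 e2 -h3 mulgK.
pose T0 d := T (ext d).
(* Primitive along the old polygon: that of the remaining polygon, with the step along the diagonal
   refined into the steps along [s] and [t]. *)
pose g0 x := if x == s then g (inr false) else if x == t then (g (inr false) * T0 (bd s))%g else g (inl x).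
have T0V d : T0 (flip d) = (T0 d)^-1%g by rewrite /T0 -TV.
have gT0 x : (g0 x * T0 (bd x))%g = g0 (nxt x).
  rewrite /g0; case: (x =P s) => [->|/eqP xs].
    by rewrite -/t [t == s]eq_sym (negbTE st) eqxx.
  case: (x =P t) => [->|/eqP xt].
    rewrite -/u (negbTE us) (negbTE ut) -mulgA [(T0 _ * _)%g]Tst.
    exact: (gT (inr false)).
  have := gT (inl x); rewrite /= (negbTE xt); case: (x =P r) => [->|/eqP xr] h.
    by rewrite -/s eqxx.
  have -> : (nxt x == s) = false by rewrite (inj_eq nxtI) (negbTE xr).
  by have -> : (nxt x == t) = false by rewrite (inj_eq nxtI) (negbTE xs).
have sE d : (\prod_(x <- shrink d) T0 x = T d)%g.
  case: d => [[e|] b]; rewrite /shrink /=; first by rewrite big_seq1.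
  rewrite -[(None, b)]/(None, b); case: b; rewrite big_cons big_seq1 //.
  by rewrite !T0V -invgM [(_ * _)%g]Tst -TV.
have <- : (\prod_(x <- flatten (map shrink w)) T0 x = \prod_(d <- w) T d)%g.
  elim: w {wv we} => [|d w IH]; first by rewrite !big_nil.
  by rewrite /= big_cat sE IH big_cons.
apply: (sc _ _ _ T0V gT0 v).
  elim: w v {2 4}v wv {we} => [|d w IH] v v' //= /andP [/eqP <- h].
  apply: walk_trans (IH _ _ h); case: d {h} => [[e|] []]; rewrite /ear_src /= ?eqxx //.
  - by rewrite !flipK (cl s) !eqxx.
  - by rewrite (cl s) !eqxx.
move=> x /flattenP [y /mapP [d dw ->]] xd.
case: d dw xd => [[e|] []] dw; rewrite ?inE /=.
- move=> /eqP ->; have [[x'|b] /= e'] := we _ dw => //.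
  by exists x'; case: e'.
- move=> /eqP ->; have [[x'|b] /= e'] := we _ dw => //.
  by exists x'; case: e'.
- by case/orP => /eqP ->; [exists t | exists s].
- by case/orP => /eqP ->; [exists s | exists t].
Qed.

Section Angles.
Local Open Scope ring_scope.
Variables (R : realFieldType) (pi : R) (alpha : S -> R) (y y' : R).
Hypothesis ysum : y + y' + alpha s = pi.
Hypotheses (y_gt0 : 0 < y) (y_lt : y < alpha t) (y'_gt0 : 0 < y') (y'_lt : y' < alpha r).

(** The diagonal splits the corner [t] into [y] and the corner [r] into [y'], both in the triangle,
    and what is left of them outside it; the whole corner [s] goes to the triangle. *)
Definition ear_alpha (x : S + bool) : R :=
  match x with
  | inl x => if x == t then y else if x == r then alpha r - y' else alpha x
  | inr true => y'
  | inr false => alpha t - y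
  end.

Lemma ear_alpha_gt0 : (forall x, 0 < alpha x) -> forall x, 0 < ear_alpha x.
Proof.
move=> a0 [x|[]] //=; last by rewrite subr_gt0.
by case: ifP => // _; case: ifP => // _; rewrite subr_gt0.
Qed.

(** Only the cycle of [r] is affected: it becomes a triangle and a remainder, and [ysum] keeps both
    exterior angle sums at [2 pi]. *)
Lemma ear_polygons : polygons nxt pi alpha -> polygons ear_nxt pi ear_alpha.
Proof.
move=> P.
have [c [uc rc fc sc]] := P r.
have [D [c0 [fD uD Esum mD]]] : exists D c0, [/\ c0 = [:: r, s, t & D] /\ fcycle nxt c0,
    uniq c0, \sum_(x <- c0) (pi - alpha x) = 2 * pi & c0 =i c].
  have [i c1 Ec] := rot_to rc.
  have fc1 : fcycle nxt (r :: c1) by rewrite -Ec rot_cycle.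
  have uc1 : uniq (r :: c1) by rewrite -Ec rot_uniq.
  have sc1 : \sum_(x <- r :: c1) (pi - alpha x) = 2 * pi.
    by rewrite -Ec -sc; apply: perm_big; rewrite perm_rot.
  have mc1 : r :: c1 =i c by move=> x; rewrite -Ec mem_rot.
  case: c1 fc1 uc1 sc1 mc1 {Ec} => [|s1 [|t1 D]] /=.
  - by rewrite andbT => /eqP e; have := rs; rewrite eq_sym -e eqxx.
  - case/and3P => /eqP <- /eqP e; by have := rt; rewrite eq_sym -e eqxx.
  case/and3P => /eqP <- /eqP <- h1 h2 h3 h4.
  by exists D, [:: r, s, t & D]; split=> //; split=> //=; rewrite !eqxx.
case: fD => Ec0 fc0; move: uD Esum mD fc0; rewrite Ec0 => uD Esum mD /= /and3P [_ _ fD].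
have tri : exists c', [/\ uniq c', [&& inl s \in c', inl t \in c' & inr true \in c'],
    fcycle ear_nxt c' & \sum_(x <- c') (pi - ear_alpha x) = 2 * pi].
  exists [:: inl s; inl t; inr true]; split.
  - by rewrite /= !inE /= !orbF !andbT; apply: contra_neq st => -[].
  - by rewrite !inE !eqxx ?orbT.
  - by rewrite /= (negbTE st) [s == r]eq_sym (negbTE rs) !eqxx.
  - rewrite !big_cons big_nil /= (negbTE st) [s == r]eq_sym (negbTE rs) eqxx -ysum; ring.
have uD' : [/\ r \notin D, s \notin D, t \notin D & uniq D].
  by move: uD; rewrite /= !inE !negb_or => /and4P [/and3P [_ _ ->] /andP [_ ->] -> ->].
case: uD' => rD sD tD uqD.
have fD' (q : seq S) : r \notin q -> t \notin q -> {in q, forall x, ear_nxt (inl x) = inl (nxt x)}.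
  move=> rq tq x xq /=; have -> : (x == t) = false by apply: contraNF tq => /eqP <-.
  by have -> : (x == r) = false by apply: contraNF rq => /eqP <-.
have aD (q : seq S) : r \notin q -> t \notin q ->
    \sum_(x <- map inl q) (pi - ear_alpha x) = \sum_(x <- q) (pi - alpha x).
  move=> rq tq; rewrite big_map !big_seq; apply: eq_bigr => x xq /=.
  have -> : (x == t) = false by apply: contraNF tq => /eqP <-.
  by have -> : (x == r) = false by apply: contraNF rq => /eqP <-.
have rest : exists c', [/\ uniq c', {subset inr false :: inl r :: map inl D <= c'},
    fcycle ear_nxt c' & \sum_(x <- c') (pi - ear_alpha x) = 2 * pi].
  exists (inl r :: inr false :: map inl D); split.
  - rewrite /= !inE /= !(mem_map (@inl_inj _ _)) rD map_inj_uniq ?uqD //; last exact: inl_inj.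
    by rewrite andbT; apply/mapP => -[].
  - by move=> x; rewrite !inE orbCA.
  - rewrite /= (negbTE rt) !eqxx /=; move: (D) fD rD tD => [|d D'] /=.
      by rewrite !andbT -/u => /eqP ->.
    rewrite -/u => /andP [/eqP <-]; rewrite eqxx /= !rcons_path !path_map !last_map => /andP [h1 h2] rD' tD'.
    have := fD' _ rD' tD'; rewrite /relpre => /= fD''.
    rewrite fD'' ?mem_last // (eqP h2) eqxx andbT.
    apply: (sub_in_path (P := mem (u :: D'))) h1; last by apply/allP => x.
    by move=> a b aD' bD' /eqP <-; rewrite /= fD''.
  - move: Esum; rewrite !big_cons aD //= (negbTE rt) eqxx; move: (\sum_(_ <- _) _) ysum => S0 h h'; lra.
move=> x; case: (boolP (x \in [:: inl s; inl t; inr true])) => x1.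
  have [c' [h1 /and3P [m1 m2 m3] h3 h4]] := tri; exists c'; split=> //.
  by move: x1; rewrite !inE => /or3P [] /eqP ->.
case: (boolP (x \in inr false :: inl r :: map inl D)) => x2.
  have [c' [h1 m h3 h4]] := rest; exists c'; split=> //; exact: m.
case: x x1 x2 => [x|[]] //= x1 x2; try by rewrite !inE eqxx ?orbT in x1 x2.
have xc : x \notin c.
  rewrite -mD !inE !negb_or; move: x1 x2; rewrite !inE !(inj_eq (@inl_inj _ _)) /= (mem_map (@inl_inj _ _)) !negb_or.
  by case/and3P => -> -> _ /andP [-> ->].
have [c' [uc' xc' fc' sc']] := P x.
have [rc' tc'] : r \notin c' /\ t \notin c'.
  suff dis z : z \in c -> z \notin c' by split; apply: dis; rewrite -mD !inE eqxx ?orbT.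
  move=> zc; apply: contra xc => zc'.
  have : {in c', forall z, z \in c -> x \in c}.
    move=> z0 z0c' z0c; case: (rot_to z0c') => i c1 Ec1.
    have : x \in z0 :: c1 by rewrite -Ec1 mem_rot.
    have : fpath nxt z0 c1.
      have : fcycle nxt (z0 :: c1) by rewrite -Ec1 rot_cycle.
      by rewrite /= rcons_path => /andP [].
    elim: c1 z0 z0c {z0c' Ec1} => [|z1 c1 IH] z0 z0c /=; first by rewrite inE => _ /eqP ->.
    case/andP => /eqP <- h; rewrite inE => /orP [/eqP -> //|]; apply: IH h.
    exact: (fcycle_mem fc).
  by move/(_ z zc' zc).
exists (map inl c'); split; rewrite ?aD //.
- by rewrite map_inj_uniq //; exact: inl_inj.
- by rewrite (mem_map (@inl_inj _ _)).
- rewrite cycle_map; case: c' uc' xc' fc' sc' rc' tc' => [|z0 c1] // _ _ fc' _ rc' tc'.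
  apply: (sub_in_cycle (P := mem (z0 :: c1))) fc'; last by apply/allP => z.
  by move=> a b ac bc /eqP <-; apply/eqP; exact: (fD' _ rc' tc').
Qed.

Local Notation ol := (ldart nxt bd).
Local Notation nl := (ldart ear_nxt ear_bd).
Local Notation reduced_walk ld := (path (fun a b => (ld b == ld (linv a)) && (b != linv a))).

(* The new corners at the ends of the cut subdivide the old corners [r] and
   [t]; [half a] is the first part of the old corner [a]. *)
Let half (a : S * bool) : (S + bool) * bool :=
  if a.2 then
    ((if a.1 == t then inr false else if a.1 == r then inr true else inl a.1), true)
  else (inl a.1, false).
Let half2 (a : S * bool) := linv (half (linv a)).
Let split (a : S * bool) : seq ((S + bool) * bool) :=
  half a :: (if (a.1 == t) || (a.1 == r) then [:: half2 a] else [::]).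
Let old (d : option E * bool) : bool := d.1.

Lemma ext_inj : injective ext.
Proof. by case=> e1 b1 [e2 b2] [-> ->]. Qed.

Lemma nl_half a : nl (half a) = ext (ol a).
Proof.
case: a => x []; rewrite /half /ldart //=.
case: (x =P t) => [->|/eqP xt] //=; case: (x =P r) => [->|/eqP xr] //=.
by rewrite (negbTE xt) (negbTE xr).
Qed.

Lemma last_split a : last (half a) (behead (split a)) = half2 a.
Proof.
rewrite /split /half2 /half /linv /=; case: a => x b /=.
by case: (x == t); case: (x == r); case: b.
Qed.

Lemma sum_split a : \sum_(x <- split a) ear_alpha x.1 = alpha a.1.
Proof.
rewrite /split /half2 /half /linv; case: a => x b /=.
case: (x =P t) => [->|/eqP xt] /=.
  by rewrite big_cons big_seq1 ?eqxx; case: b; rewrite /= ?eqxx /=; ring.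
case: (x =P r) => [->|/eqP xr] /=; last first.
  by rewrite big_seq1; case: b => /=; rewrite ?(negbTE xt) ?(negbTE xr) /= ?(negbTE xt) ?(negbTE xr).
by rewrite big_cons big_seq1; case: b; rewrite /= ?eqxx ?(negbTE rt) /= ?eqxx; ring.
Qed.

Lemma split_first a : old (nl a) -> exists b, half b = a.
Proof.
case: a => [[x|[]] []]; rewrite /ldart /= => o.
- exists (x, true); rewrite /half /=; move: o.
  by case: (x == t) => //; case: (x == r).
- by exists (x, false).
- by exists (r, true); rewrite /half /= (negbTE rt) eqxx.
- by [].
- by exists (t, true); rewrite /half /= eqxx.
- by [].
Qed.

(** At each end of the diagonal just two corners adjoin it, the two halves of an old corner; a walk
    that does not backtrack has to go on to the other half. *)
Lemma split_next a b : (a.1 == t) || (a.1 == r) -> nl b = nl (linv (half a)) ->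
  b != linv (half a) -> b = half2 a.
Proof.
have srF : (s == t) = false by rewrite (negbTE st).
case: a => x c /= /orP [] /eqP ->; case: b => [[z|[]] []]; case: c;
  rewrite /half2 /half /linv /ldart /= ?eqxx ?(negbTE rt) /= ?eqxx ?(negbTE rt) //=;
  (case: (z =P t) => [->|_]; first by rewrite ?eqxx); case: (z =P r) => [->|_] //; by rewrite ?eqxx.
Qed.

Lemma split_stop a : nl (linv (half2 a)) = ext (ol (linv a)).
Proof. by rewrite /half2 linvK nl_half. Qed.

Lemma split_single a : (a.1 == t) || (a.1 == r) = false -> half2 a = half a.
Proof.
case: a => x b /= /norP []; rewrite /half2 /half /linv => /= xt xr.
by case: b; rewrite /= ?(negbTE xt) ?(negbTE xr).
Qed.

(** The new link is the old one with two of its edges subdivided, so a reduced walk between old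
    vertices runs through whole old edges. *)
Lemma old_walk_split n a q : (size q <= n)%N ->
    reduced_walk nl a q -> old (nl a) -> old (nl (linv (last a q))) ->
  exists b w, a :: q = flatten (map split (b :: w)).
Proof.
elim: n a q => [|n IH] a q sq rw oa ol'; have [b eb] := split_first oa; subst a.
  case: q sq rw ol' => // _ _ h; exists b, [::]; rewrite /= cats0 /split.
  case: ifP => // ts; move: h.
  case: b ts {oa} => x c /= /orP [] /eqP ->; case: c; rewrite /half /linv /ldart /= ?eqxx ?(negbTE rt) //= ?eqxx ?(negbTE rt) //=.
case Eb : ((b.1 == t) || (b.1 == r)); last first.
  case: q sq rw ol' => [|a' q] sq rw h; first by exists b, [::]; rewrite /= cats0 /split Eb.
  have [] := IH a' q sq; rewrite //=.
  - by case/andP: rw.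
  - by case/andP: rw => /andP [/eqP -> _]; rewrite -(split_single Eb) split_stop.
  by move=> b' [w ->]; exists b, (b' :: w) => /=; rewrite {2}/split Eb.
case: q sq rw ol' => [|a' q] sq rw h.
  move: h.
  case: b Eb {oa rw} => x c /= /orP [] /eqP ->; case: c; rewrite /half /linv /ldart /= ?eqxx ?(negbTE rt) //= ?eqxx ?(negbTE rt) //=.
case/andP: rw => /andP [/eqP h1 h2] rw; have {h1 h2}e := split_next Eb h1 h2; subst a'.
case: q sq rw h => [|a' q] sq rw h; first by exists b, [::]; rewrite /= cats0 /split Eb.
have [] := IH a' q (ltnW sq) _ _ h.
- by case/andP: rw.
- by case/andP: rw => /andP [/eqP -> _]; rewrite split_stop.
by move=> b' [w ->]; exists b, (b' :: w) => /=; rewrite {2}/split Eb.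
Qed.

Lemma split_cons b c w : behead (flatten (map split [:: b, c & w])) =
  behead (split b) ++ half c :: behead (flatten (map split (c :: w))).
Proof. by []. Qed.

Lemma split_walk b w : reduced_walk nl (half b) (behead (flatten (map split (b :: w)))) ->
  reduced_walk ol b w.
Proof.
elim: w b => [//|c w IH] b; rewrite split_cons cat_path last_split.
case/andP => _ /= /andP [/andP [h1 h2] h3]; rewrite (IH _ h3) andbT.
move: h1 h2; rewrite split_stop nl_half => /eqP h1 h2; apply/andP; split.
  by apply/eqP; exact: ext_inj.
by apply: contra_neq h2 => ->; rewrite /half2 linvK.
Qed.

Lemma split_last b w : last (half b) (behead (flatten (map split (b :: w)))) = half2 (last b w).
Proof.
elim: w b => [|c w IH] b; last by rewrite split_cons last_cat last_cons IH.
by rewrite /= cats0 -[RHS]last_split.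
Qed.

Lemma old_walk_long a q : link_condition_system nxt bd pi alpha ->
    reduced_walk nl a q -> nl a = nl (linv (last a q)) -> old (nl a) ->
  2 * pi <= \sum_(x <- a :: q) ear_alpha x.1.
Proof.
move=> L rw cl oa; have [b [w e]] := old_walk_split (leqnn _) rw oa (eq_ind _ old oa _ cl).
have [ea eq] : a = half b /\ q = behead (flatten (map split (b :: w))).
  by move: e => /= -[-> ->].
have -> : \sum_(x <- a :: q) ear_alpha x.1 = \sum_(x <- b :: w) alpha x.1.
  rewrite e; elim: (b :: w) => [|c w' IH]; first by rewrite !big_nil.
  rewrite -[flatten _]/(split c ++ flatten (map split w')) big_cat IH [RHS]big_cons.
  by rewrite -(sum_split c).
rewrite ea eq split_last split_stop nl_half in cl rw.
apply: L; first exact: split_walk.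
exact: ext_inj.
Qed.

Lemma new_stop a : ~~ old (nl a) -> old (nl (linv a)).
Proof.
case: a => [[x|[]] []]; rewrite /ldart /linv //=.
Qed.

(** A walk based at an end of the diagonal is rebased at the next vertex, which is old. If it
    backtracks at its base, its first and last letters are dropped instead, which only shortens
    it. *)
Lemma ear_link : (forall x, 0 < alpha x) -> link_condition_system nxt bd pi alpha ->
  link_condition_system ear_nxt ear_bd pi ear_alpha.
Proof.
move=> a0 L a q rw cl; case: (boolP (old (nl a))) => oa; first exact: old_walk_long.
have os := new_stop oa.
case: q rw cl => [|a' q] rw cl; first by rewrite /= in cl; rewrite cl os in oa.
case/andP: rw => /andP [/eqP h1 h2] rw; have {}rw : reduced_walk nl a' q := rw.
case: (altP (last a' q =P linv a)) => e.
  case/lastP: q rw cl e => [|q l] rw cl e; first by rewrite /= in e; rewrite e eqxx in h2.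
  rewrite last_rcons in e; subst l; move: rw; rewrite rcons_path => /andP [rw /andP [/eqP h3 _]].
  have cl' : nl a' = nl (linv (last a' q)) by rewrite h1.
  apply: le_trans (old_walk_long L rw cl' _) _; first by rewrite h1.
  rewrite -cats1 !big_cons big_cat /= !big_cons big_nil.
  by have := ear_alpha_gt0 a0 a.1; rewrite /=; lra.
have -> : \sum_(x <- [:: a, a' & q]) ear_alpha x.1 = \sum_(x <- a' :: rcons q a) ear_alpha x.1.
  by rewrite -cats1 !big_cons big_cat /= big_seq1; ring.
apply: old_walk_long => //.
- rewrite rcons_path rw /=; rewrite /= in cl; rewrite cl eqxx.
  by apply: contra e => /eqP ->; rewrite linvK.
- by rewrite last_rcons.
- by rewrite h1.
Qed.

End Angles.
End Ear.

(** * Finding an ear *)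

Lemma fcycle_closed (T : eqType) (f : T -> T) (P : T -> Prop) c x y :
  fcycle f c -> {in c, forall z, P z -> P (f z)} -> x \in c -> y \in c -> P x -> P y.
Proof.
move=> fc cl xc yc Px; have [i c1 Ec] := rot_to xc.
have : y \in x :: c1 by rewrite -Ec mem_rot.
have : fpath f x c1.
  have : fcycle f (x :: c1) by rewrite -Ec rot_cycle.
  by rewrite /= rcons_path => /andP [].
have : {subset x :: c1 <= c} by move=> z; rewrite -Ec mem_rot.
elim: c1 x Px {xc Ec} => [|z c1 IH] x Px sub /=; first by rewrite inE => _ /eqP ->.
case/andP => /eqP ez h; have {ez}Pz : P z.
  by rewrite -ez; apply: cl Px; apply: sub; rewrite inE eqxx.
rewrite inE => /orP [/eqP yx|]; last by apply: IH h => // v vz; apply: sub; rewrite inE vz orbT.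
by rewrite yx.
Qed.

Lemma fcycle_map (T : eqType) (f : T -> T) c : fcycle f c -> map f c = rot 1 c.
Proof.
case: c => // x p; rewrite rot1_cons /= => h.
rewrite -[f x :: _]/(map f (x :: p)) -[x :: p](belast_rcons x p x); move: h.
have : forall q y, fpath f y q -> map f (belast y q) = q.
  by elim=> //= z q IH y /andP [/eqP -> /IH ->].
by move=> h /h.
Qed.

Section Polygons.
Variables (S : finType) (nxt : S -> S).
Variables (R : realFieldType) (pi : R) (alpha : S -> R).
Local Open Scope ring_scope.
Hypothesis pi_gt0 : 0 < pi.
Hypothesis alpha_gt0 : forall s, 0 < alpha s.
Hypothesis P : polygons nxt pi alpha.

(** With positive angles, one or two exterior angles sum to less than [2 pi]; so there are no
    monogons or digons. *)
Lemma polygon_at s : exists a b c, let p := [:: s, a, b & c] in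
  [/\ uniq p, fcycle nxt p & \sum_(x <- p) (pi - alpha x) = 2 * pi].
Proof.
have [c [uc sc fc Ec]] := P s; have [i c1 E1] := rot_to sc.
have [uc1 fc1 Ec1] : [/\ uniq (s :: c1), fcycle nxt (s :: c1) & \sum_(x <- s :: c1) (pi - alpha x) = 2 * pi].
  by rewrite -E1 rot_uniq rot_cycle; split=> //; rewrite -Ec; apply: perm_big; rewrite perm_rot.
case: c1 uc1 fc1 Ec1 {E1} => [|a [|b c1]] uc1 fc1 Ec1; last by exists a, b, c1.
  by exfalso; move: Ec1; rewrite big_seq1; have := alpha_gt0 s; have := pi_gt0; lra.
by exfalso; move: Ec1; rewrite big_cons big_seq1; have := alpha_gt0 s; have := alpha_gt0 a; lra.
Qed.

Lemma polygon_nxtI : injective nxt.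
Proof.
have pre s : {r | nxt r == s}.
  apply: sigW; have [a [b [c [_ fc _]]]] := polygon_at s.
  exists (last b c); move: fc; rewrite /= => /and3P [_ _].
  by rewrite rcons_path => /andP [].
have K : cancel (fun s => sval (pre s)) nxt by move=> s; exact/eqP/(svalP (pre s)).
exact: can_inj (canF_sym K).
Qed.

Lemma polygon_nxt_neq s : (nxt s != s) * (nxt (nxt s) != s).
Proof.
have [a [b [c [u f _]]]] := polygon_at s; move: u f; rewrite /= !inE !negb_or.
case/and4P => /and3P [sa sb _] _ _ _ /and3P [/eqP -> /eqP -> _].
by split; rewrite eq_sym.
Qed.

Lemma polygon_triangle s : nxt (nxt (nxt s)) = s ->
  alpha s + alpha (nxt s) + alpha (nxt (nxt s)) = pi.
Proof.
have [a [b [c [u f e]]]] := polygon_at s; move: u f e => /=.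
case: c => [|d c] u /and4P [/eqP ea /eqP eb].
  by move=> _ _; rewrite !big_cons big_nil -eb -ea; lra.
move=> /eqP ed _ _ h; move: u; rewrite -ed -eb -ea h !inE eqxx !orbT.
by [].
Qed.

(** Without such an [r], an angle of at least [pi] forces the next one to be as large, hence all of
    them, and the exterior angles cannot sum to [2 pi]. If all angles are below [pi], adding the
    sums of three consecutive angles over the [n] sides gives 3 (n - 2) pi <= n pi, which fails for
    n >= 4. *)
Lemma ear_exists s : nxt (nxt (nxt s)) != s ->
  exists r, [/\ nxt (nxt (nxt r)) != r, alpha (nxt r) < pi
    & pi < alpha r + alpha (nxt r) + alpha (nxt (nxt r))].
Proof.
have [a [b [c [u f e]]]] := polygon_at s; set p := [:: s, a, b & c] in u f e * => s3.
have sp : s \in p by rewrite inE eqxx.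
have sz : (4 <= size p)%N.
  move: f s3; rewrite /p; case: (c) => //= /and4P [/eqP -> /eqP -> /eqP -> _].
  by rewrite eqxx.
have n3 x : x \in p -> nxt (nxt (nxt x)) != x.
  move=> xp; apply/negP => /eqP h; case/eqP: s3.
  by apply: (fcycle_closed (P := fun z => nxt (nxt (nxt z)) = z) f _ xp sp h) => z _ e3; rewrite e3.
case: (boolP (has (fun r => (alpha (nxt r) < pi) &&
    (pi < alpha r + alpha (nxt r) + alpha (nxt (nxt r)))) p)).
  by case/hasP => r rp /andP [h1 h2]; exists r; split=> //; exact: n3.
move/hasPn => no; exfalso.
have nop r : r \in p -> alpha (nxt r) < pi ->
    alpha r + alpha (nxt r) + alpha (nxt (nxt r)) <= pi.
  by move=> /no; case: ltP => //= _; rewrite -leNgt.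
case: (boolP (has (fun r => pi <= alpha r) p)) => big.
  have [r rp br] := hasP big.
  have all_big x : x \in p -> pi <= alpha x.
    move=> xp; apply: (fcycle_closed (P := fun z => is_true (pi <= alpha z)) f _ rp xp br) => z zp zb; rewrite leNgt; apply/negP => h.
    have := nop _ zp h; have := alpha_gt0 (nxt z); have := alpha_gt0 (nxt (nxt z)); lra.
  have : \sum_(x <- p) (pi - alpha x) <= 0.
    by rewrite big_seq; apply: sumr_le0 => x /all_big; lra.
  by rewrite e; have := pi_gt0; lra.
have small x : x \in p -> alpha x < pi by rewrite ltNge; exact: (hasPn big).
have sumnx (F : S -> R) : \sum_(x <- p) F (nxt x) = \sum_(x <- p) F x.
  by rewrite -(big_map nxt predT F) (fcycle_map f); apply: perm_big; rewrite perm_rot.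
have : \sum_(x <- p) (alpha x + alpha (nxt x) + alpha (nxt (nxt x))) <= \sum_(x <- p) pi.
  rewrite !big_seq; apply: ler_sum => x xp; apply: nop => //.
  by apply: small; exact: (fcycle_mem f).
rewrite !big_split /= (sumnx (fun x => alpha (nxt x))) !sumnx.
move: e; rewrite sumrB big_const_seq count_predT iter_addr addr0 -[_ *+ size p]mulr_natr => e.
have : pi * 4 <= pi * (size p)%:R by rewrite ler_pM2l // ler_nat.
move: e; have := pi_gt0.
by lra.
Qed.
End Polygons.

(** Counted are the sides outside triangles. The two sides that are cut off leave the count, and
    only [inr false] can enter it. *)
Lemma ear_measure (S : finType) (nxt : S -> S) r : injective nxt ->
    nxt (nxt (nxt r)) != r -> r != nxt r -> r != nxt (nxt r) -> nxt r != nxt (nxt r) ->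
  #|[set x | ear_nxt nxt r (ear_nxt nxt r (ear_nxt nxt r x)) != x]| <
  #|[set x | nxt (nxt (nxt x)) != x]|.
Proof.
move=> nxtI r3 rs rt st; set A := [set x | nxt _ != x].
have sA : nxt r \in A by rewrite inE (inj_eq nxtI).
have tA : nxt (nxt r) \in A :\ nxt r by rewrite !inE !(inj_eq nxtI) r3 eq_sym rs.
rewrite (cardsD1 (nxt r) A) sA (cardsD1 (nxt (nxt r))) tA.
set B := _ :\ nxt (nxt r).
apply: (@leq_trans (#|inl @: B :|: [set inr false : S + bool]|.+1)).
  rewrite ltnS; apply: subset_leq_card; apply/subsetP => x; rewrite inE.
  case: x => [x|[]] hx; last by rewrite !inE eqxx orbT.
    rewrite inE (mem_imset _ _ (@inl_inj _ _)) orbC; apply/orP; right.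
    rewrite !inE; apply/and3P; split; apply: contra hx.
    - by move=> /eqP ->; rewrite /= eqxx /= (negbTE st) [nxt r == r]eq_sym (negbTE rs).
    - by move=> /eqP ->; rewrite /= (negbTE st) [nxt r == r]eq_sym (negbTE rs) /= eqxx.
    move=> /eqP e; have per z : nxt (nxt (nxt z)) = z -> (z == nxt (nxt r)) = false /\ (z == r) = false.
      move=> ez; split; apply/eqP => zr; case/eqP: r3; last by rewrite -zr.
      by apply/nxtI/nxtI; rewrite -zr.
    have [h1 h2] := per x e; have [h3 h4] := per (nxt x) (congr1 nxt e).
    have [h5 h6] := per (nxt (nxt x)) (congr1 nxt (congr1 nxt e)).
    by rewrite /= h1 h2 /= h3 h4 /= h5 h6 e.
  by move: hx; rewrite /= (negbTE st) [nxt r == r]eq_sym (negbTE rs) /= eqxx.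
rewrite !add1n ltnS; apply: leq_trans (leq_card_setU _ _) _.
by rewrite cards1 addn1 ltnS; exact: leq_imset_card.
Qed.

Section Induction.
Local Open Scope ring_scope.

Theorem no_polygon_system (V E S : finType) (src : E * bool -> V) (nxt : S -> S)
    (bd : S -> E * bool) (R : realFieldType) (pi : R) (alpha : S -> R) :
    closed_system src nxt bd -> sc_system src nxt bd -> 0 < pi ->
    (forall s, 0 < alpha s) -> polygons nxt pi alpha ->
    link_condition_system nxt bd pi alpha ->
    (forall s, exists2 s', s' != s & (bd s').1 = (bd s).1) ->
  S -> False.
Proof.
move=> + + pi_gt0; have [n] := ubnP #|[set s | nxt (nxt (nxt s)) != s]|.
elim: n => // n IH in E S src nxt bd alpha *; rewrite ltnS => ln cl sc a0 P L nf s0.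
have nxtI := polygon_nxtI pi_gt0 a0 P.
have nn := polygon_nxt_neq pi_gt0 a0 P.
case: (boolP [exists s, nxt (nxt (nxt s)) != s]); last first.
  rewrite negb_exists => /forallP h.
  have n3 s : nxt (nxt (nxt s)) = s by apply/eqP; have := h s; rewrite negbK.
  apply: (no_triangle_system cl sc pi_gt0 n3 _ a0 _ L nf s0) => s; first by rewrite nn.
  exact: (polygon_triangle pi_gt0 a0 P).
case/existsP => s1 /(ear_exists pi_gt0 a0 P) [r [r3 as_lt sum_gt]].
set s := nxt r in as_lt sum_gt; set t := nxt s in sum_gt.
have rs : r != nxt r by rewrite eq_sym nn.
have rt : r != nxt (nxt r) by rewrite eq_sym nn.
have st : nxt r != nxt (nxt r) by rewrite eq_sym nn.
have us : nxt (nxt (nxt r)) != nxt r by rewrite nn.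
have ut : nxt (nxt (nxt r)) != nxt (nxt r) by rewrite nn.
(* The triangle needs [pi - alpha s] in its other two corners, taken from [alpha t] and [alpha r] in
   proportion. The two inequalities of [ear_exists] say that the proportion [k] is strictly between
   0 and 1. *)
pose d := pi - alpha s; pose k := d / (alpha r + alpha t).
have D0 : 0 < alpha r + alpha t by rewrite addr_gt0.
have k0 : 0 < k by rewrite divr_gt0 // subr_gt0.
have k1 : k < 1 by rewrite ltr_pdivrMr // mul1r /d; lra.
have kD : k * alpha t + k * alpha r = d by rewrite -mulrDr addrC mulfVK // gt_eqF.
have ysum : k * alpha t + k * alpha r + alpha (nxt r) = pi by rewrite kD /d subrK.
have y1 : k * alpha t < alpha t by rewrite gtr_pMl.
have y2 : k * alpha r < alpha r by rewrite gtr_pMl.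
have y3 : 0 < k * alpha t by rewrite mulr_gt0.
have y4 : 0 < k * alpha r by rewrite mulr_gt0.
apply: (IH _ _ (ear_src src nxt bd r) (ear_nxt nxt r) (ear_bd bd)
  (ear_alpha nxt r alpha (k * alpha t) (k * alpha r))).
- exact: leq_trans (ear_measure nxtI r3 rs rt st) ln.
- exact: ear_closed.
- exact: ear_sc.
- exact: ear_alpha_gt0.
- exact: ear_polygons.
- exact: ear_link.
- exact: ear_no_free.
- exact: inl s0.
Qed.
End Induction.

(** * Collapses of 2-complexes *)

Lemma not_uniq_map (A B : eqType) (f : A -> B) l : ~~ uniq (map f l) ->
  exists l1 x l2 y l3, l = l1 ++ x :: l2 ++ y :: l3 /\ f x = f y.
Proof.
elim: l => //= x l IH; rewrite negb_and negbK => /orP [/mapP [y yl e]|/IH].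
  by case/splitPr: yl => l2 l3; exists [::], x, l2, y, l3.
by case=> l1 [z [l2 [y [l3 [-> e]]]]]; exists (x :: l1), z, l2, y, l3.
Qed.

Lemma fcycle_enum_ord n : fcycle (@ordS n) (enum 'I_n).
Proof.
case: n => [|n]; first by rewrite (size0nil (size_enum_ord 0)).
rewrite (eq_cycle (e' := relpre val (fun i j => (i.+1 %% n.+1)%N == j))); last by move=> i j; rewrite /= -val_eqE.
rewrite -cycle_map val_enum_ord /=.
suff h k m : (k + m = n)%N -> path (fun i j => (i.+1 %% n.+1)%N == j) k (rcons (iota k.+1 m) 0).
  exact: h.
elim: m k => [|m IH] k e /=; first by rewrite addn0 in e; rewrite e modnn.
by rewrite modn_small ?eqxx ?IH //; lia.
Qed.

(** * The polygon system of a complex without free edges *)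

Section Complex.
Variable X : complex2.

Lemma is_pathE (x : vert X) p y : is_path x p y = walk (@src X) (@src X \o @flip (edge X)) x p y.
Proof. by elim: p x => //= d p IH x; rewrite IH. Qed.

Definition in_edges (Y : cells X) (p : seq (dart X)) := {in p, forall d : edge X * bool, d.1 \in cedge Y}.

Definition closed_cells (Y : cells X) :=
  (forall e b, e \in cedge Y -> endpt e b \in cvert Y) /\
  (forall f (i : 'I_(sides f)), f \in cface Y -> (bd i).1 \in cedge Y).

Definition connected_cells (Y : cells X) :=
  (exists x, x \in cvert Y) /\
  {in cvert Y &, forall x y, exists2 p, is_path x p y & in_edges Y p}.

(** Simple connectivity of a subcomplex through group-valued labellings. Labellings are easy to
    extend over a collapsed cell, so no homotopy has to be rebuilt. *)
Definition sc_cells (Y : cells X) := forall (G : groupType) (T : edge X * bool -> G),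
  (forall d, T (flip d) = (T d)^-1)%g ->
  (forall f, f \in cface Y -> \prod_(d <- bd_word f) T d = 1)%g ->
  forall x p, is_path x p x -> in_edges Y p -> (\prod_(d <- p) T d = 1)%g.

Lemma simply_connected_sc : simply_connected X -> sc_cells (all_cells X).
Proof.
case=> _ sc G T TV Tf x p px _.
have h q q' : homotopic x x q q' -> (\prod_(d <- q) T d = \prod_(d <- q') T d)%g.
  elim=> {q q'} [q q' [_ _ h]|q|q q' _ ->|q q' q'' _ -> _ ->] //.
  have inv d : (T d * T (dinv d) = 1)%g by rewrite -[dinv d]/(flip d) TV mulgV.
  case: h => [q1 q2 d|q1 q2 f].
    have e : (\prod_(c <- [:: d, dinv d & q2]) T c = \prod_(c <- q2) T c)%g.
      by rewrite 2!big_cons mulgA inv mul1g.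
    by rewrite big_cat [RHS]big_cat e.
  have e : (\prod_(c <- bd_word f ++ q2) T c = \prod_(c <- q2) T c)%g.
    by rewrite big_cat Tf ?inE // [LHS]mul1g.
  by rewrite big_cat [RHS]big_cat e.
by rewrite (h _ _ (sc _ _ px)) big_nil.
Qed.

Lemma connected_all : simply_connected X -> connected_cells (all_cells X).
Proof.
case=> -[[x _] c] _; split; first by exists x; rewrite inE.
by move=> y z _ _; have [p h] := c y z; exists p => // d _; rewrite inE.
Qed.

Section System.
Variables (R : realType) (angle : corner X -> R) (Y : cells X).
Local Open Scope ring_scope.
Hypothesis cY : closed_cells Y.
Hypothesis scY : sc_cells Y.
Hypothesis ang : is_angling angle.
Hypothesis lk : forall v, link_condition angle v.
Hypothesis nofree : forall e f, ~ free_edge Y e f.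

Definition csides := {c : {f : face X & 'I_(sides f)} | tag c \in cface Y}.
HB.instance Definition _ := Finite.on csides.

Definition cside (f : face X) (i : 'I_(sides f)) (h : f \in cface Y) : csides :=
  exist (fun c => tag c \in cface Y) (Corner i) h.
Definition cnxt (c : csides) : csides := cside (ordS (tagged (val c))) (valP c).
Definition cbd (c : csides) : edge X * bool := bd (tagged (val c)).
Definition cangle (c : csides) : R := angle (val c).

Lemma csidesP (P : csides -> Prop) :
  (forall f (i : 'I_(sides f)) h, P (cside i h)) -> forall c, P c.
Proof. by move=> h [[f i] hc]; exact: (h f i hc). Qed.

Lemma cside_irr f (i : 'I_(sides f)) h h' : cside i h = cside i h'.
Proof. by rewrite (eq_irrelevance h h'). Qed.

Lemma cnxtE f (i : 'I_(sides f)) h : cnxt (cside i h) = cside (ordS i) h.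
Proof. by apply: cside_irr. Qed.

Lemma csides_closed : closed_system (@src X) cnxt cbd.
Proof. by elim/csidesP => f i h; rewrite cnxtE; exact: (bd_closed i). Qed.

Lemma csides_sc : sc_system (@src X) cnxt cbd.
Proof.
move=> G T g TV gT x p px pe; rewrite -is_pathE in px; apply: (scY TV _ px); last first.
  move=> d /pe [s <-]; elim/csidesP: s => f i h; exact: (cY.2).
move=> f hf; rewrite /bd_word big_map.
have gT' (i : 'I_(sides f)) : (g (cside i hf) * T (bd i) = g (cside (ordS i) hf))%g.
  by have := gT (cside i hf); rewrite cnxtE.
have := fcycle_enum_ord (sides f).
have : {subset enum 'I_(sides f) <= predT} by [].
case: (enum _) => [|i0 l _ /=]; first by rewrite big_nil.
have tel i l' : fpath (@ordS _) i l' ->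
    (g (cside i hf) * \prod_(j <- belast i l') T (bd j) = g (cside (last i l') hf))%g.
  elim: l' i => [|j l' IH] i /=; first by rewrite big_nil mulg1.
  by case/andP => /eqP <- /IH e; rewrite big_cons mulgA gT' e.
move/tel; rewrite last_rcons belast_rcons => e; apply: (mulgI (g (cside i0 hf))).
by rewrite e mulg1.
Qed.

Lemma csides_polygons : polygons cnxt pi cangle.
Proof.
elim/csidesP => f i h; exists [seq cside j h | j <- enum 'I_(sides f)].
have inj : injective (fun j : 'I_(sides f) => cside j h).
  by move=> j k /(congr1 val) /= /eqP; rewrite eq_Tagged /= => /eqP.
split.
- by rewrite map_inj_uniq ?enum_uniq.
- by rewrite mem_map // mem_enum.
- rewrite cycle_map (eq_cycle (e' := frel (@ordS _))) ?fcycle_enum_ord //.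
  by move=> j k; rewrite /= cnxtE (inj_eq inj).
rewrite big_map big_enum /= sumrB sumr_const cardT size_enum_ord.
have -> : \sum_(j < sides f) cangle (cside j h) = ((sides f)%:R - 2) * pi by exact: ang.2.
by rewrite -mulr_natr; ring.
Qed.

Lemma csides_no_free s : exists2 s', s' != s & (cbd s').1 = (cbd s).1.
Proof.
elim/csidesP: s => f i h; apply: contrapT => no.
apply: (nofree (e := (bd i).1) (f := f)); split=> //; first exact: cY.2.
- apply/eqP/cards1P; exists i; apply/setP => j; rewrite !inE.
  apply/eqP/eqP => [e|->//]; apply/eqP/negP => /negP ij; apply: no.
  exists (cside j h) => //; apply: contra ij => /eqP /(congr1 val) /= /eqP.
  by rewrite eq_Tagged.
move=> g j hg e; apply: contrapT => gf; apply: no; exists (cside j hg) => //.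
by apply/eqP => /(congr1 (fun c => tag (val c))).
Qed.

Definition clet (a : csides * bool) : corner X * bool := (val a.1, a.2).

Lemma clet_start a : ldart cnxt cbd a = lk_start (clet a).
Proof. by case: a => c []. Qed.

Lemma clet_stop a : ldart cnxt cbd (linv a) = lk_stop (clet a).
Proof. by case: a => c []. Qed.

Lemma apex_start (a : corner X * bool) : src (lk_start a) = apex a.1.
Proof. by case: a => -[f i] []; rewrite /lk_start /lk_end //=; exact/esym/(bd_closed i). Qed.

Lemma apex_stop (a : corner X * bool) : src (lk_stop a) = apex a.1.
Proof. by case: a => -[f i] []; rewrite /lk_stop /lk_end //=; exact/esym/(bd_closed i). Qed.

(** A closed reduced walk contains a graph-theoretic cycle. A repeated vertex cuts out a shorter
    closed walk. With distinct vertices, a repeated corner would be run in opposite directions; the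
    letter after its first passage starts at the vertex where the second passage starts, so that
    vertex is repeated or the walk backtracks. *)
Lemma csides_link : link_condition_system cnxt cbd pi cangle.
Proof.
move=> a q; have [n] := ubnP (size q); elim: n a q => // n IH a q; rewrite ltnS => sq rw cl.
have [a0 _] := ang.
pose st := ldart cnxt cbd; pose F l := \sum_(x <- l) cangle (x : csides * bool).1.
have F0 l : 0 <= F l by apply: sumr_ge0 => x _; apply: ltW; exact: a0.
case: (boolP (uniq (map st (a :: q)))) => us; last first.
  have [l1 [x [l2 [y [l3 [e exy]]]]]] := not_uniq_map us.
  have [rx ry] : path (fun a b => (st b == st (linv a)) && (b != linv a)) x l2 /\ st y = st (linv (last x l2)).
    have : sorted (fun a b => (st b == st (linv a)) && (b != linv a)) (a :: q) by [].
    rewrite e => /cat_sorted2 [_] /=; rewrite cat_path /= => /and3P [-> /andP [/eqP -> _] _].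
    by [].
  apply: (@le_trans _ _ (F (x :: l2))).
    apply: IH => //; last exact: (etrans exy ry).
    have := congr1 size e; rewrite /= size_cat /= size_cat /= addnS => -[h].
    by apply: leq_trans sq; rewrite h !addnS ltnS addnCA leq_addr.
  have FD l l' : F (l ++ l') = F l + F l' by rewrite /F big_cat.
  rewrite -/(F (a :: q)) e FD -cat_cons FD.
  by have := F0 l1; have := F0 (y :: l3); lra.
case: (boolP (uniq (map fst (a :: q)))) => uc; last first.
  have [l1 [x [l2 [y [l3 [e exy]]]]]] := not_uniq_map uc.
  have yx : y = linv x.
    have : x != y.
      apply: contraTneq us => xy; rewrite e -xy map_cat /= map_cat /= cat_uniq /=.
      by rewrite mem_cat inE eqxx orbT /= !andbF.
    by move: exy; case: (x) => x1 b; case: (y) => y1 b' /= ->; case: b; case: b'; rewrite ?eqxx.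
  have : sorted (fun a b => (st b == st (linv a)) && (b != linv a)) (a :: q) by [].
  rewrite e => /cat_sorted2 [_] /=; rewrite cat_path /=.
  case: l2 e => [|z l2] e /and3P [h1 h2 h3].
    by case/andP: h2 => _; rewrite /= yx eqxx.
  move: h1; rewrite /= -yx => /andP [/andP [/eqP h1 _] _]; move: us.
  rewrite e map_cat cat_uniq => /and3P [_ _ /andP [_ /andP [nz _]]].
  case/negP: (nz : st z \notin map st (l2 ++ y :: l3)); rewrite h1.
  by apply: map_f; rewrite mem_cat inE eqxx orbT.
have := lk (v := apex (val a.1)) (s := map clet (a :: q)); rewrite big_map; apply.
have adj : {homo clet : x y / (st y == st (linv x)) && (y != linv x) >-> lk_stop x == lk_start y}.
  by move=> x y /andP [/eqP h _]; rewrite -clet_start -clet_stop; apply/eqP/esym/h.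
apply/and5P; split=> //.
- apply/allP => _ /mapP [x xq ->]; apply/eqP.
  elim: (q) (a) rw x xq {sq cl us uc} => [|b l IHl] c /= rw x; rewrite !inE.
    by move/eqP => ->.
  case/andP: rw => /andP [/eqP h _] rw /orP [/eqP -> //|xl].
  rewrite (IHl b rw x xl) /=; move: h; rewrite /st clet_start clet_stop => /(congr1 (@src X)).
  by rewrite apex_start apex_stop.
- rewrite cycle_map /= rcons_path; apply/andP; split.
    by apply: sub_path rw => x y; exact: adj.
  by rewrite /= -clet_start -clet_stop cl.
- rewrite -map_comp (map_comp val fst) map_inj_uniq //; exact: val_inj.
- by rewrite -map_comp (eq_map (g := st)) // => x; rewrite /st clet_start.
Qed.

Lemma no_full_cells f : f \in cface Y -> False.
Proof.
move=> hf.
apply: (no_polygon_system csides_closed csides_sc (pi_gt0 R) _ csides_polygons csides_link csides_no_free).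
  by move=> s; exact: ang.1.
exact: (cside (Ordinal (sides_gt0 f)) hf).
Qed.
End System.
End Complex.

(** * Elementary collapses preserve simple connectivity *)

Lemma walk_split (D A : eqType) (s t : A -> D) x r a r' y :
  walk s t x (r ++ a :: r') y = walk s t x r (s a) && walk s t (t a) r' y.
Proof. by elim: r x => [|b r IH] x /=; rewrite 1?[s a == x]eq_sym // IH andbA. Qed.

Lemma prod_rev_flip (E : finType) (G : groupType) (T : E * bool -> G) p :
    (forall d, T (flip d) = (T d)^-1)%g ->
  (\prod_(d <- rev (map (@flip E) p)) T d = (\prod_(d <- p) T d)^-1)%g.
Proof.
move=> TV; elim: p => [|d p IH]; first by rewrite !big_nil invg1.
by rewrite /= rev_cons -cats1 big_cat IH big_seq1 big_cons TV invgM.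
Qed.

Lemma first_return (A : eqType) (f : nat -> A) i m : 0 < m -> f i = f (i + m) ->
  exists i m, [/\ 0 < m, f i = f (i + m) & forall a b, i <= a -> a < b -> b < i + m -> f a <> f b].
Proof.
elim/ltn_ind: m i => m IH i m0 e.
have [h|h] := pselect (exists a b, [/\ i <= a, a < b, b < i + m & f a = f b]).
  have [a [b [h1 h2 h3 h4]]] := h.
  apply: (IH (b - a) _ a); rewrite ?subn_gt0 //; first by lia.
  by rewrite subnKC // ltnW.
by exists i, m; split=> // a b h1 h2 h3 h4; apply: h; exists a, b.
Qed.

Section Collapse.
Variable X : complex2.
Implicit Types Y : cells X.
Local Notation E := (edge X).

Definition good_cells Y := [/\ closed_cells Y, connected_cells Y & sc_cells Y].

Lemma bd_word_path (f : face X) : exists x, is_path x (bd_word f) x.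
Proof.
rewrite /bd_word; have := fcycle_enum_ord (sides f).
have i0 := Ordinal (sides_gt0 f); have := mem_enum 'I_(sides f) i0.
case: (enum _) => // i l _ /=.
have tel j l' : fpath (@ordS _) j l' ->
    is_path (src (bd j)) [seq bd k | k <- belast j l'] (src (bd (last j l'))).
  elim: l' j => [|k l' IH] j /=; first by rewrite eqxx.
  by case/andP => /eqP <- /IH h; rewrite eqxx [tgt _](bd_closed j).
by move/tel; rewrite last_rcons belast_rcons; exists (src (bd i)).
Qed.

Section FreeEdge.
Variables (Y : cells X) (e : edge X) (f : face X).
Hypothesis gY : good_cells Y.
Hypothesis fr : free_edge Y e f.
Let Y' := Cells (cvert Y) (cedge Y :\ e) (cface Y :\ f).

Lemma free_edge_word : exists A d B, [/\ bd_word f = A ++ d :: B, d.1 = e,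
    in_edges Y' (B ++ A) & is_path (tgt d) (B ++ A) (src d)].
Proof.
have [[cv ce] _ _] := gY; have [eY fY /eqP /cards1P [i0 Ei0] _] := fr.
have ei0 : (bd i0).1 = e by have := set11 i0; rewrite -Ei0 inE => /eqP.
have [x px] := bd_word_path f.
have : i0 \in enum 'I_(sides f) by rewrite mem_enum.
have := enum_uniq 'I_(sides f); move: px; rewrite /bd_word => + + il.
case/splitPr: il => l1 l2 px; rewrite cat_uniq /= negb_or => /and3P [_ /andP [n1 _] /andP [n2 _]].
exists (map (@bd X f) l1), (bd i0), (map (@bd X f) l2).
move: px; rewrite map_cat /= !is_pathE walk_split => /andP [pA pB]; split=> //.
  have sub (l : seq 'I_(sides f)) : i0 \notin l -> in_edges Y' (map (@bd X f) l).
    move=> nl _ /mapP [j jl ->]; rewrite !inE ce // andbT; apply: contra nl => ej.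
    by have : j \in [set i0]; [rewrite -Ei0 inE | rewrite inE => /eqP <-].
  by move=> c; rewrite mem_cat => /orP []; exact: sub.
exact: walk_trans pB pA.
Qed.

(** The removed edge is replaced by the rest of the boundary of [f]. This reroutes paths, and it
    extends a labelling of what remains to one that is trivial around [f]. *)
Lemma collapse_edge_good : good_cells Y'.
Proof.
have [A [d [B [Ew de inBA pBA]]]] := free_edge_word.
have [[cv ce] [ne cn] sc] := gY; have [eY fY _ fu] := fr.
pose R := rev (map (@flip E) (B ++ A)).
pose sub (x : E * bool) := if x == d then R else if x == flip d then B ++ A else [:: x].
have sub_ne x : x.1 != e -> sub x = [:: x].
  rewrite /sub -de; case: (x =P d) => [->|_]; first by rewrite eqxx.
  by case: (x =P flip d) => [->|_] //; rewrite eqxx.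
have inR : in_edges Y' R.
  by move=> x; rewrite mem_rev => /mapP [y yB ->]; exact: (inBA y).
have in_sub x : x.1 \in cedge Y -> in_edges Y' (sub x).
  rewrite /sub => xY; case: (x =P d) => // xd; case: (x =P flip d) => // xfd.
  move=> y; rewrite inE => /eqP ->; rewrite !inE xY andbT -de; apply/eqP.
  move: xd xfd; case: (x) => x1 x2; case: (d) => d1 d2 /= h1 h2 h; apply: h1.
  rewrite h in h2 *; congr pair; move: h2; rewrite /flip /=.
  by case: x2; case: d2.
split.
- split=> [x b|g i]; first by rewrite !inE => /andP [_ /cv].
  rewrite !inE => /andP [gf gY']; rewrite ce // andbT.
  by apply: contra gf => /eqP h; apply/eqP/(fu g i).
- split=> // x y xY yY; have [p px pY] := cn x y xY yY.
  exists (flatten (map sub p)); last first.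
    move=> z /flattenP [q /mapP [w wp ->]]; apply: in_sub; exact: pY.
  move: px; rewrite !is_pathE; elim: p x {xY} pY => //= z p IH x pY /andP [/eqP <- h].
  apply: (walk_trans (y := tgt z)); last first.
    by apply: IH h => w wp; apply: pY; rewrite inE wp orbT.
  rewrite is_pathE in pBA; rewrite /sub; case: (z =P d) => [->|_].
    have := walk_rev (inv := @flip E) _ _ pBA; apply=> w //=; by rewrite flipK.
  case: (z =P flip d) => [->|_]; last by rewrite /= !eqxx.
  by rewrite /tgt -[dinv _]/(flip (flip d)) flipK.
move=> G T TV Tf x p px pY'.
pose T' x := (\prod_(y <- sub x) T y)%g.
have T'ne q : {in q, forall x : E * bool, x.1 != e} -> (\prod_(x <- q) T' x = \prod_(x <- q) T x)%g.
  elim: q => [|y q IH] qe; first by rewrite !big_nil.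
  rewrite !big_cons IH; last by move=> z zq; apply: qe; rewrite inE zq orbT.
  by rewrite /T' sub_ne ?big_seq1 // qe // inE eqxx.
have ne' q : in_edges Y' q -> {in q, forall x : E * bool, x.1 != e}.
  by move=> h y /h; rewrite !inE => /andP [].
have T'd : (T' d = (\prod_(x <- A) T x)^-1 * (\prod_(x <- B) T x)^-1)%g.
  by rewrite /T' /sub eqxx prod_rev_flip // big_cat invgM.
have T'fd : (T' (flip d) = (T' d)^-1)%g.
  by rewrite /T' /sub (negbTE (flip_neq _)) !eqxx prod_rev_flip // invgK.
rewrite -(T'ne _ (ne' _ pY')).
apply: (sc G T' _ _ x p px) => [y|g gg|y /pY'].
- case: (y =P d) => [->|yd] //; case: (y =P flip d) => [->|yfd].
    by rewrite T'fd flipK invgK.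
  have fy1 : (flip y == d) = false by apply/eqP => h; apply: yfd; rewrite -h flipK.
  have fy2 : (flip y == flip d) = false by rewrite (inj_eq (can_inj (@flipK E))); apply/eqP.
  by rewrite /T' /sub fy1 fy2 !big_seq1; move/eqP/negbTE: yd => ->; move/eqP/negbTE: yfd => ->; rewrite !big_seq1.
- case: (g =P f) => [->|/eqP gf].
    rewrite Ew big_cat big_cons T'd.
    have [nA nB] : in_edges Y' A /\ in_edges Y' B.
      by split=> z zA; apply: inBA; rewrite mem_cat zA ?orbT.
    rewrite (T'ne _ (ne' _ nA)) (T'ne _ (ne' _ nB)).
    move: (\prod_(x <- A) T x)%g (\prod_(x <- B) T x)%g => a b.
    by rewrite -[LHS]/(a * (a^-1 * b^-1 * b))%g mulgVK mulgV.
  rewrite T'ne; first by apply: Tf; rewrite !inE gf.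
  move=> _ /mapP [i _ ->]; apply: contra gf => /eqP h; apply/eqP; exact: (fu g i).
- by rewrite !inE => /andP [].
Qed.
End FreeEdge.

(* Without leaves, a path that never backtracks contains a closed path through
   some edge exactly once, which is detected by labelling this edge with a
   transposition. *)
Lemma leaf_exists Y e : good_cells Y -> cface Y = set0 -> e \in cedge Y ->
  exists v e', free_vertex Y v e'.
Proof.
move=> [[cv ce] _ sc] f0 eY; apply: contrapT => no.
have nx (d : E * bool) : d.1 \in cedge Y -> exists d', [/\ d'.1 \in cedge Y, src d' = tgt d & d' <> flip d].
  move=> dY; apply: contrapT => no'; apply: no; exists (tgt d), d.1; split=> //.
  - exact: cv.
  - apply/eqP/cards1P; exists (~~ d.2); apply/setP => b; rewrite !inE.
    case: (b =P ~~ d.2) => [->|nb]; first by apply/eqP.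
    apply/eqP => h; apply: no'; exists (d.1, b); split=> //.
    by rewrite /flip => -[].
  - move=> e' b e'Y h; apply: contrapT => ne'; apply: no'; exists (e', b); split=> //.
    by rewrite /flip => -[].
  - by move=> g i; rewrite f0 inE.
have /choice [n nP] : forall d : E * bool, exists d', d.1 \in cedge Y -> [/\ d'.1 \in cedge Y, src d' = tgt d & d' <> flip d].
  move=> d; case: (boolP (d.1 \in cedge Y)) => [dY|]; last by exists d.
  by have [d' h] := nx d dY; exists d'.
pose w k := iter k n (e, false).
have wY k : (w k).1 \in cedge Y by elim: k => //= k IH; case: (nP _ IH).
have ws k : src (w k.+1) = tgt (w k) by case: (nP _ (wY k)).
have wn k : w k.+1 <> flip (w k) by case: (nP _ (wY k)).
have [i1 [m1 [m10 e1]]] := pigeonhole (fun k => src (w k)).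
have [i [m [m0 ei inj]]] := first_return (f := fun k => src (w k)) m10 e1.
pose T (d : E * bool) : {perm bool} := if d.1 == (w i).1 then tperm false true else 1%g.
have TV d : (T (flip d) = (T d)^-1)%g.
  by rewrite /T /flip /=; case: ifP => _; rewrite ?tpermV ?invg1.
have pw k j : is_path (src (w j)) (map w (iota j k)) (src (w (j + k)%N)).
  elim: k j => [|k IH] j /=; first by rewrite addn0.
  by rewrite eqxx -ws -addSnnS IH.
have := pw m i; rewrite -ei => p1.
have : (\prod_(d <- map w (iota i m)) T d = 1)%g.
  apply: (sc _ T TV _ _ _ p1) => [g|_ /mapP [k _ ->]] //; by rewrite f0 inE.
case: m m0 inj {ei p1} => // m _ inj; rewrite /= big_cons big1_seq.
  rewrite mulg1 /T eqxx => /(congr1 (fun s : {perm bool} => s false)).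
  by rewrite tpermL perm1.
move=> d /andP [_ /mapP [k]]; rewrite mem_iota => /andP [k1 k2] ->.
(* A second passage through the edge would revisit a vertex too early or be an immediate
   backtrack. *)
rewrite /T; case: ifP => // /eqP ek; exfalso.
have km : (k < i + m.+1)%N by lia.
have [h|h] : w k = w i \/ w k = flip (w i).
  rewrite /flip; move: ek; case: (w k) => a b; case: (w i) => a' b' /= ->.
  by case: b; case: b'; [left|right|right|left].
  by apply: (inj i k) => //; rewrite h.
have [k2'|k2'] : k = i.+1 \/ (i.+1 < k)%N by lia.
  by apply: (wn i); rewrite -k2'.
by apply: (inj i.+1 k) => //; rewrite ws h.
Qed.

(** Sending [v] to the other end of [e] is a retraction: a path between other vertices remains a
    path once [e] is erased from it. *)
Lemma collapse_vertex_good Y v e : good_cells Y -> cface Y = set0 -> free_vertex Y v e ->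
  good_cells (Cells (cvert Y :\ v) (cedge Y :\ e) (cface Y)).
Proof.
move=> [[cv ce] [ne cn] sc] f0 [vY eY /eqP /cards1P [b0 Eb] vu _].
set Y' := Cells _ _ _.
have eb0 : endpt e b0 = v by have := set11 b0; rewrite -Eb inE => /eqP.
pose u := endpt e (~~ b0).
have uv : u != v.
  apply/negP => h; have : ~~ b0 \in [set b0] by rewrite -Eb inE.
  by rewrite inE; case: (b0).
split.
- split=> [e' b|f i]; last by rewrite f0 inE.
  rewrite !inE => /andP [e'e e'Y]; rewrite cv // andbT.
  by apply: contra e'e => /eqP h; apply/eqP; exact: vu h.
- split; first by exists u; rewrite !inE uv cv.
  pose phi w := if w == v then u else w.
  have phiP p x y : is_path x p y -> in_edges Y p ->
      is_path (phi x) [seq d <- p | d.1 != e] (phi y).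
    elim: p x => [|d p IH] x /= ; first by move/eqP => ->.
    case/andP => /eqP <- h dY; have {}IH := IH _ h (fun z zp => dY z (mem_behead (s := d :: p) zp)).
    case: ifP => [de|/negbFE/eqP de] /=.
      have nv b : endpt d.1 b != v.
        apply: contra de => /eqP h'; apply/eqP; apply: vu h'.
        by apply: (dY d); rewrite inE eqxx.
      by move: IH; rewrite /phi (negbTE (nv d.2 : src d != v)) (negbTE (nv _ : tgt d != v)) eqxx.
    have -> // : phi (src d) = phi (tgt d).
    rewrite /phi /src /tgt /src /dinv /= de; case: (d.2 =P b0) => [->|/eqP nb].
      by rewrite eb0 eqxx -/u (negbTE uv).
    have -> : d.2 = ~~ b0 by case: (d.2) (b0) nb => [] [].
    by rewrite negbK eb0 eqxx -/u (negbTE uv).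
  move=> x y; rewrite !inE => /andP [xv xY] /andP [yv yY].
  have [p px pY] := cn x y xY yY; exists [seq d <- p | d.1 != e].
    by have := phiP _ _ _ px pY; rewrite /phi (negbTE xv) (negbTE yv).
  by move=> d; rewrite mem_filter => /andP [de /pY dY]; rewrite !inE de.
move=> G T TV Tf x p px pY; apply: (sc G T TV Tf x p px) => d /pY.
by rewrite !inE => /andP [].
Qed.

Lemma good_collapses Y :
    (forall Z, good_cells Z -> forall f, f \in cface Z -> exists e g, free_edge Z e g) ->
    good_cells Y ->
  exists x, collapses Y (Cells [set x] set0 set0).
Proof.
move=> fe; have [n] := ubnP #|cedge Y|; elim: n Y => // n IH Y; rewrite ltnS => ln gY.
have step Y' e : e \in cedge Y -> cedge Y' = cedge Y :\ e -> good_cells Y' ->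
    elementary_collapse Y Y' -> exists x, collapses Y (Cells [set x] set0 set0).
  move=> eY E' gY' st; have [|x hx] := IH Y' _ gY'.
    by rewrite E'; apply: leq_trans ln; rewrite [in X in _ < X](cardsD1 e) eY.
  by exists x; apply: rt_trans hx; exact: rt_step.
case: (set_0Vmem (cface Y)) => [f0|[f fY]]; last first.
  have [e [g fr]] := fe Y gY f fY; have [eY _ _ _] := fr.
  apply: (step _ e eY _ (collapse_edge_good gY fr)) => //; exact: collapse_edge.
case: (set_0Vmem (cedge Y)) => [e0|[e eY]]; last first.
  have [v [e' fr]] := leaf_exists gY f0 eY; have [_ eY' _ _ _] := fr.
  apply: (step _ e' eY' _ (collapse_vertex_good gY f0 fr)) => //; exact: collapse_vertex.
have [_ [[x xY] cn] _] := gY; exists x.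
have -> : Y = Cells [set x] set0 set0; last exact: rt_refl.
case: Y gY e0 f0 xY cn {ln step} => vY eY fY _ /= -> -> xY cn; congr Cells.
apply/setP => y; rewrite inE; apply/idP/eqP => [yY|->//].
have [[|d p] /= px pY] := cn x y xY yY; first by rewrite (eqP px).
by have := pY d; rewrite !inE eqxx => /(_ isT).
Qed.
End Collapse.

Theorem theorem1p1 (R : realType) (X : complex2) (angle : corner X -> R) :
  simply_connected X ->
  conformally_nonpositively_curved angle ->
  collapsible X.
Proof.
move=> sc [ang lk]; apply: good_collapses; last first.
  split; [|exact: connected_all|exact: simply_connected_sc].
  by split=> *; rewrite inE.
move=> Y [cY _ scY] f fY; apply: contrapT => no.
by apply: (no_full_cells cY scY ang lk _ fY) => e g fr; apply: no; exists e, g.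
Qed.
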